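(* Let $N\ge1$ and let $X=\dot W^{1,N}(\mathbb{R}^N)=\{f\in\mathcal{S}'(\mathbb{R}^N):|\nabla f|\in L^N(\mathbb{R}^N)\}$, normed by $\|f\|_X=\||\nabla f|\|_{L^N(\mathbb{R}^N)}$. Then: (1) There exists a finite constant $C$ such that for all $f\in X$, $\|f\|_{\mathrm{BMO}(\mathbb{R}^N)}\le C\|f\|_X$. (2) If $f\in X$ and, in addition, $|\nabla f|\in\mathcal{H}^N(\mathbb{R}^N)$, then $f\in\mathrm{VMO}(\mathbb{R}^N)$. In any event (i.e. for every $f\in X$, without the additional assumption), there exists an absolute finite constant $C$ such that for every ball $B=B_r(x_0)$, $r>0$, $x_0\in\mathbb{R}^N$, $$|f-f_B|_B\le C\,\||\nabla f|\|_{L^N(B)},\qquad f_B:=\frac1{|B|}\int_B f\,dx .$$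
   Context: $|g|_B:=\frac1{|B|}\int_B|g|\,dx$ denotes the average of $|g|$ over $B$. $\mathcal{S}'(\mathbb{R}^N)$ is the space of tempered distributions. $\mathrm{BMO}(\mathbb{R}^N)$ is the space of locally integrable $f$ (modulo constants) with $\|f\|_{\mathrm{BMO}}=\sup_Q\frac1{|Q|}\int_Q|f-f_Q|\,dx<\infty$, the supremum being over all cubes $Q$, with $f_Q=\frac1{|Q|}\int_Qf$. $\mathrm{VMO}(\mathbb{R}^N)$ is the closure of $C_0(\mathbb{R}^N)$ (continuous functions vanishing at infinity) in $\mathrm{BMO}(\mathbb{R}^N)$. $\mathcal{H}^p(\mathbb{R}^N)$, $0<p<\infty$, is the space of tempered distributions $f$ such that $\sup_{t>0}|\varphi_t*f|\in L^p(\mathbb{R}^N)$, where $\varphi\in C_c^\infty(\mathbb{R}^N)$ has $\int\varphi=1$ and $\varphi_t=t^{-N}\varphi(t^{-1}\cdot)$. (It does not depend on $\varphi$, and for $1<p<\infty$ it equals $L^p$.) *)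

(* Defs.v *)
From HB Require Import structures.
From mathcomp Require Import all_boot all_order all_algebra.
From mathcomp Require Import all_classical all_reals all_analysis.

Set Implicit Arguments.
Unset Strict Implicit.
Unset Printing Implicit Defensive.

Import Order.TTheory GRing.Theory Num.Theory.
Import numFieldNormedType.Exports.

Local Open Scope classical_set_scope.
Local Open Scope ring_scope.

(* R^n is 'rV[R]_n with the sigma-algebra generated by the coordinates, that is,
   the Borel sigma-algebra. *)
Section measurable_rV.
Context (R : realType) (n : nat).

Definition rV_coord (i : 'I_n) (x : 'rV[R]_n) : R := x ord0 i.

Let rV_set0 : g_sigma_preimage rV_coord set0.
Proof. exact: sigma_algebra0. Qed.

Let rV_setC A : g_sigma_preimage rV_coord A -> g_sigma_preimage rV_coord (~` A).
Proof. exact: sigma_algebraC. Qed.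

Let rV_bigcup (F : (set 'rV[R]_n)^nat) :
  (forall i, g_sigma_preimage rV_coord (F i)) ->
  g_sigma_preimage rV_coord (\bigcup_i (F i)).
Proof. exact: sigma_algebra_bigcup. Qed.

HB.instance Definition _ :=
  @isMeasurable.Build (measure_tuple_display default_measure_display)
  'rV[R]_n (g_sigma_preimage rV_coord) rV_set0 rV_setC rV_bigcup.

End measurable_rV.

Section measurable_fun_rV.
Context (R : realType) (n : nat).

Lemma measurable_rV_coord (i : 'I_n) :
  measurable_fun [set: 'rV[R]_n] (@rV_coord R n i).
Proof.
move=> _ Y mY; rewrite setTI; apply: sub_sigma_algebra => /=.
rewrite -bigcup_seq/=; exists i => /=; first by rewrite mem_index_enum.
by exists Y => //; rewrite setTI.
Qed.

Lemma measurable_fun_rVP d (T : measurableType d) (f : T -> 'rV[R]_n) :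
  measurable_fun [set: T] f <->
  forall i, measurable_fun [set: T] (fun t => f t ord0 i).
Proof.
split=> [mf i|mf].
  exact: (measurableT_comp (measurable_rV_coord i) mf).
suff : g_sigma_preimage (fun i => @rV_coord R n i \o f) `<=` measurable.
  rewrite g_sigma_preimage_comp => prefS.
  by move=> _ A mA; apply: prefS; exists A.
apply: smallest_sub; first exact: sigma_algebra_measurable.
rewrite -bigcup_seq/=; apply: bigcup_sub => i _ A [B mB <-].
exact: mf.
Qed.

End measurable_fun_rV.

(* Lebesgue measure on R^n, by recursion on n: the image of the product of
   Lebesgue measure on R and Lebesgue measure on R^n under R x R^n ~ R^(n+1). *)
Section lebesgue_rV.
Context (R : realType).

Definition rV_cons n (p : measurableTypeR R * 'rV[R]_n) : 'rV[R]_n.+1 :=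
  row_mx (p.1 : R)%:M p.2.

Lemma rV_cons0 n (p : measurableTypeR R * 'rV[R]_n) :
  rV_cons p ord0 ord0 = p.1.
Proof.
have -> : ord0 = lshift n ord0 :> 'I_(1 + n) by exact/val_inj.
transitivity ((row_mx (p.1 : R)%:M p.2 : 'rV_(1 + n)) ord0 (lshift n ord0)) => //.
by rewrite row_mxEl mxE eqxx mulr1n.
Qed.

Lemma rV_consS n (p : measurableTypeR R * 'rV[R]_n) (i : 'I_n) :
  rV_cons p ord0 (lift ord0 i) = p.2 ord0 i.
Proof.
rewrite -rshift1.
transitivity ((row_mx (p.1 : R)%:M p.2 : 'rV_(1 + n)) ord0 (rshift 1 i)) => //.
by rewrite row_mxEr.
Qed.

Lemma measurable_rV_cons n : measurable_fun setT (@rV_cons n).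
Proof.
apply/measurable_fun_rVP => i; case: (unliftP ord0 i) => [j|] ->.
  rewrite (_ : (fun _ => _) = @rV_coord R n j \o snd).
    exact: (measurableT_comp (measurable_rV_coord j) measurable_snd).
  by apply/funext => p; rewrite rV_consS.
rewrite (_ : (fun _ => _) = fst) //; apply/funext => p.
by rewrite rV_cons0.
Qed.

Section lebesgue_rVS.
Local Open Scope ereal_scope.
Context (n : nat) (mu : {measure set 'rV[R]_n -> \bar R}).

Definition lebesgue_rVS : set 'rV[R]_n.+1 -> \bar R :=
  pushforward (lebesgue_measure \x^ mu) (@rV_cons n).

Let lebesgue_rVS0 : lebesgue_rVS set0 = 0.
Proof. by apply: measure0; exact: measurable_rV_cons. Qed.

Let lebesgue_rVS_ge0 A : 0 <= lebesgue_rVS A.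
Proof. by apply: measure_ge0; exact: measurable_rV_cons. Qed.

Let lebesgue_rVS_sigma_additive : semi_sigma_additive lebesgue_rVS.
Proof.
by apply: measure_semi_sigma_additive; exact: measurable_rV_cons.
Qed.

HB.instance Definition _ := isMeasure.Build _ _ _ lebesgue_rVS
  lebesgue_rVS0 lebesgue_rVS_ge0 lebesgue_rVS_sigma_additive.

End lebesgue_rVS.

Fixpoint lebesgue_rV n : {measure set 'rV[R]_n -> \bar R} :=
  if n is m.+1 then lebesgue_rVS (lebesgue_rV m) else dirac (0 : 'rV[R]_0).

Let box n (a b : 'I_n -> R) : set 'rV[R]_n :=
  [set x | forall i, a i <= x ord0 i <= b i].

Let measurable_box n (a b : 'I_n -> R) : measurable (box a b).
Proof.
rewrite (_ : box a b = \bigcap_(i in [set: 'I_n])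
    (@rV_coord R n i @^-1` `[a i, b i]%classic)).
  apply: fin_bigcap_measurable => // i _.
  by rewrite -[X in measurable X]setTI; exact: measurable_rV_coord.
apply/seteqP; split=> x /= xab i; first by move=> _; rewrite /= in_itv/=.
by have := xab i I; rewrite /= in_itv.
Qed.

Lemma lebesgue_rV_box n (a b : 'I_n -> R) : (forall i, a i <= b i) ->
  lebesgue_rV n [set x | forall i, a i <= x ord0 i <= b i] =
  (\prod_(i < n) (b i - a i))%:E.
Proof.
rewrite -/(box a b); elim: n => [|n IHn] in a b * => ab.
  by rewrite big_ord0 /= diracE mem_set// => -[].
rewrite /= /lebesgue_rVS /pushforward.
have -> : @rV_cons n @^-1` box a b =
    `[a ord0, b ord0]%classic `*` box (a \o lift ord0) (b \o lift ord0).
  apply/seteqP; split=> -[t x] /=.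
    move=> tx; split.
      by have := tx ord0; rewrite rV_cons0 in_itv.
    by move=> i; have := tx (lift ord0 i); rewrite rV_consS.
  rewrite in_itv/= => -[t0 x0] i; case: (unliftP ord0 i) => [k|] ->.
    by rewrite rV_consS; exact: x0.
  by rewrite rV_cons0.
rewrite product_measure2E//; last exact: measurable_box.
rewrite IHn; last by move=> i; exact: ab.
rewrite big_ord_recl EFinM; congr (_ * _)%E.
rewrite [LHS](lebesgue_measure_itv `[a ord0, b ord0])/= lte_fin.
by case: ltgtP (ab ord0) => // -> _; rewrite subrr.
Qed.

End lebesgue_rV.

Section definitions.
Context (R : realType) (N : nat).
Local Notation E := 'rV[R]_N.
Local Notation leb := (@lebesgue_rV R N).
Implicit Types (A B : set E) (h F : E -> R) (phi psi : E -> R).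

Definition enorm (x : E) : R := Num.sqrt (\sum_(i < N) x ord0 i ^+ 2).

Definition eball (x0 : E) (r : R) : set E := [set x | enorm (x - x0) < r].

(* The cube with sides parallel to the axes, lower corner a and side l. *)
Definition cube (a : E) (l : R) : set E :=
  [set x | forall i, a ord0 i <= x ord0 i <= a ord0 i + l].

Definition avg A h : R := (fine (leb A))^-1 * \int[leb]_(x in A) h x.

(* \fint_A |h - h_A| *)
Definition mean_osc A h : R := avg A (fun x => `|h x - avg A h|).

Definition loc_integrable h : Prop :=
  measurable_fun [set: E] h /\
  forall K, compact K -> (\int[leb]_(x in K) `|h x|%:E < +oo)%E.

Definition bmo_norm h : \bar R :=
  ereal_sup [set (mean_osc (cube p.1 p.2) h)%:E | p in [set p : E * R | 0 < p.2]].

(* Functions are not quotiented by constants: bmo_norm is a seminorm that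
   vanishes on constants. *)
Definition BMO : set (E -> R) :=
  [set h | loc_integrable h /\ (bmo_norm h < +oo)%E].

Definition C0 : set (E -> R) :=
  [set h | continuous h /\
    forall e : R, 0 < e -> exists r : R, forall x, r < enorm x -> `|h x| < e].

(* The closure of C0 for the seminorm of BMO. *)
Definition VMO : set (E -> R) :=
  [set h | BMO h /\
    forall e : R, 0 < e ->
      exists2 g, C0 g & (bmo_norm (fun x => (h x - g x)%R) < e%:E)%E].

Definition partial (i : 'I_N) phi : E -> R := 'D_(delta_mx 0 i) phi.

(* For s = [:: i1; ..; ik], the derivative d_i1 (.. (d_ik phi)). *)
Definition partials (s : seq 'I_N) phi : E -> R := foldr partial phi s.

Definition smooth phi : Prop :=
  forall s : seq 'I_N, continuous (partials s phi) /\
    forall i x, derivable (partials s phi) x (delta_mx 0 i).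

Definition test_function : set (E -> R) :=
  [set phi | smooth phi /\ compact (closure [set x | phi x != 0])].

Definition schwartz_norm (m : nat) phi : \bar R :=
  ereal_sup [set ((1 + enorm p.1) ^+ m * `|partials p.2 phi p.1|)%:E |
              p in [set p : E * seq 'I_N | (size p.2 <= m)%N]].

Definition schwartz : set (E -> R) :=
  [set phi | smooth phi /\ forall m, (schwartz_norm m phi < +oo)%E].

(* A distribution is a functional on all functions E -> R, of which only the
   restriction to Schwartz functions is meaningful. *)
Definition functional : Type := (E -> R) -> R.
Implicit Types f : functional.

Definition tempered f : Prop :=
  (forall (c : R) phi psi, schwartz phi -> schwartz psi ->
     f (fun x => c * phi x + psi x) = c * f phi + f psi) /\
  exists (C : R) (m : nat), forall phi, schwartz phi ->
    (`|f phi|%:E <= C%:E * schwartz_norm m phi)%E.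

Definition dist_of h : functional := fun phi => \int[leb]_x (h x * phi x).

(* f is the regular distribution given by the locally integrable function h. *)
Definition represents f h : Prop :=
  loc_integrable h /\ forall phi, test_function phi -> f phi = dist_of h phi.

Definition dist_partial (i : 'I_N) f : functional :=
  fun phi => - f (partial i phi).

Definition is_gradient f (g : E -> E) : Prop :=
  forall i, represents (dist_partial i f) (fun x => g x ord0 i).

(* The distributional gradient when it is a locally integrable vector field
   (it is then unique up to a null set), and 0 otherwise. *)
Definition gradient f : E -> E := xget (fun=> 0) [set g | is_gradient f g].

Definition norm_gradient f : E -> R := fun x => enorm (gradient f x).

Definition LN_norm A h : \bar R :=
  Lnorm leb N%:R%:E (fun x => (\1_A x * h x)%:E).

Definition W1N_norm f : \bar R := LN_norm setT (norm_gradient f).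

Definition W1N : set functional :=
  [set f | [/\ tempered f, (exists g, is_gradient f g) &
               (W1N_norm f < +oo)%E]].

(* x |-> sup_(t > 0) |phi_t * f (x)|, with (phi_t * f)(x) = f (phi_t (x - .)) *)
Definition radial_maximal phi f (x : E) : \bar R :=
  ereal_sup [set `|f (fun y => t ^- N * phi (t^-1 *: (x - y)))|%:E |
              t in [set t : R | 0 < t]].

Definition hardy phi (p : R) : set functional :=
  [set f | tempered f /\ (Lnorm leb p%:E (radial_maximal phi f) < +oo)%E].

End definitions.

(* Main.v *)
(* Existence of F.  On test functions f is linear with a locally integrable gradient g.
   Writing phi - A_i phi = d_i (P_i phi), where A_i averages phi along the i-th axis against
   a fixed bump, f phi = f (A_i phi) - \int g_i P_i phi, and after treating all coordinates
   only a multiple of a fixed tensor product is left; taking adjoints of P_i and A_i gives F.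

   Poincare.  Testing the weak gradient against integrals of test functions along segments
   shows F (x + v) - F x = \int_0^1 g (x + s v) . v ds for a.e. x.  Integrating over pairs of
   points of a convex set B of diameter l and substituting, the double oscillation of F over
   B is at most 2^N l |B| \int_B |g|, and Hoelder's inequality gives (1) on cubes and the
   last claim on balls.

   VMO, N >= 2.  F is approximated in BMO by a mollification U: on small cubes both
   oscillations are small by absolute continuity of \int |g|^N, on large cubes F and U are
   close in mean.  U is approximated by chi_k * k atan (U / k) with a logarithmic cutoff
   chi_k: as \int |d chi_k|^N decays like (log radius)^(1 - N), the gradient of the
   difference tends to 0 in L^N.

   VMO, N = 1.  A nonnegative integrable function whose maximal function is integrable
   vanishes a.e., so F has norm 0 in BMO. *)

Require Import Defs.
From HB Require Import structures.
From mathcomp Require Import all_boot all_order all_algebra.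
From mathcomp Require Import all_classical all_reals all_analysis.
From mathcomp Require Import measurable_realfun.
From mathcomp Require Import ring lra.

Set Implicit Arguments.
Unset Strict Implicit.
Unset Printing Implicit Defensive.

Import Order.TTheory GRing.Theory Num.Theory.
Import numFieldNormedType.Exports.

Local Open Scope classical_set_scope.
Local Open Scope ring_scope.

(** * Lebesgue measure on R^n *)

Section box.
Context (R : realType) (n : nat).
Local Notation E := 'rV[R]_n.

(** An element of [W1N] is a functional, linear only on Schwartz functions, so a representing
    function has to be built before any oscillation makes sense. The operators used for this must
    map test functions to test functions, which is why an axis is averaged against a bump instead of
    being integrated out. Oscillations are measured by the double integral of [|h y - h x|] over a
    set: no average is subtracted, hence it is subadditive, compatible with translations and not
    increased by mollification, and it controls the mean oscillation. A cutoff alone cannot give the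
    approximation in C0: the derivative of [chi * U] contains [U * d chi], and [U] may be unbounded,
    which forces the truncation [k * atan (U / k)]. Its height [k] must then be beaten by the
    logarithmic gain; a cutoff over about [k ^ 4] dyadic shells leaves about [k ^ (4 - 3 * N)],
    which decays for [N >= 2] only. In dimension one there is no such gain: a smooth step from 0 to
    1 has an integrable derivative, yet on long intervals its oscillation stays large after
    subtracting any function that vanishes at infinity. *)

Definition box (a b : 'I_n -> R) : set E :=
  [set x | forall i, a i <= x ord0 i <= b i].

Definition boxes : set (set E) := [set A | exists a b, A = box a b].

Lemma measurable_box a b : measurable (box a b).
Proof.
rewrite (_ : box a b = \bigcap_(i in [set: 'I_n])
    (@rV_coord R n i @^-1` `[a i, b i]%classic)).
  apply: fin_bigcap_measurable => // i _.
  by rewrite -[X in measurable X]setTI; exact: measurable_rV_coord.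
apply/seteqP; split=> x /= xab i; first by move=> _; rewrite /= in_itv/=.
by have := xab i I; rewrite /= in_itv.
Qed.
Hint Resolve measurable_box : core.

Lemma box_setI : setI_closed boxes.
Proof.
move=> _ _ [a [b ->]] [c [d ->]].
exists (fun i => Num.max (a i) (c i)), (fun i => Num.min (b i) (d i)).
apply/seteqP; split=> x /=.
  move=> [ab cd] i; rewrite ge_max le_min.
  by case/andP: (ab i) => -> ->; case/andP: (cd i) => -> ->.
move=> h; split=> i; have := h i; rewrite ge_max le_min.
  by case/andP=> /andP[-> _] /andP[-> _].
by case/andP=> /andP[_ ->] /andP[_ ->].
Qed.

Lemma archi_coord (x : E) : exists k : nat, forall i, `|x ord0 i| <= k%:R.
Proof.
exists (Num.truncn (\sum_i `|x ord0 i|)).+1 => i.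
have /ltW : \sum_i `|x ord0 i| < (Num.truncn (\sum_i `|x ord0 i|)).+1%:R.
  exact: truncnS_gt.
by apply: le_trans; rewrite (bigD1 i)//= lerDl sumr_ge0.
Qed.

Lemma box_cover : \bigcup_k box (fun=> - k%:R) (fun=> k%:R) = setT.
Proof.
apply/seteqP; split=> // x _; have [k kx] := archi_coord x.
by exists k => // i; rewrite -ler_norml.
Qed.

Lemma measurable_boxes : @measurable _ E = <<s boxes >>.
Proof.
apply/seteqP; split; last first.
  apply: smallest_sub; first exact: sigma_algebra_measurable.
  by move=> _ [a [b ->]].
apply: smallest_sub; first exact: smallest_sigma_algebra.
rewrite -bigcup_seq/=; apply: bigcup_sub => i _.
pose T := g_sigma_algebraType boxes.
suff mf : measurable_fun [set: T] (@rV_coord R n i).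
  by move=> _ [B mB <-]; exact: mf.
apply: (measurability (@RGenCInfty.G R)).
  exact: RGenCInfty.measurableE.
move=> _ [_ [c ->] <-]; rewrite setTI.
(* A closed half-space is a countable union of boxes, bounded by [k] in all other directions. *)
rewrite (_ : _ @^-1` _ = \bigcup_k
  (box (fun j => if j == i then c else - k%:R) (fun=> k%:R))); last first.
  apply/seteqP; split=> x /=.
    rewrite in_itv/= andbT => cx; have [k kx] := archi_coord x.
    exists k => // j; have := kx j; rewrite ler_norml => /andP[k1 k2].
    by rewrite k2 andbT; case: eqP => [->|].
  by move=> [k _ /(_ i)]; rewrite eqxx in_itv/= andbT => /andP[].
apply: bigcupT_measurable => k; apply: sub_sigma_algebra.
by eexists; eexists; reflexivity.
Qed.

Local Notation leb := (@lebesgue_rV R n).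

Lemma leb_box a b : (forall i, a i <= b i) ->
  leb (box a b) = (\prod_(i < n) (b i - a i))%:E.
Proof. exact: lebesgue_rV_box. Qed.

(** Boxes form a pi-system that generates the sigma-algebra, and the cubes [[-k, k]^n] exhaust the
    space with finite measure. The change of variables rests on this. *)
Lemma leb_unique (mu : {measure set E -> \bar R}) :
  (forall a b, (forall i, a i <= b i) ->
     mu (box a b) = (\prod_(i < n) (b i - a i))%:E) ->
  forall A, measurable A -> mu A = leb A.
Proof.
move=> mub A mA.
apply: (measure_unique boxes (fun k => box (fun=> - k%:R) (fun=> k%:R))).
- exact: measurable_boxes.
- exact: box_setI.
- by move=> k; do 2 eexists.
- exact: box_cover.
- move=> _ [a [b ->]]; have [ab|/existsNP[i /negP ba]] := pselect (forall i, a i <= b i).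
    by rewrite [RHS]leb_box; [exact: mub|].
  have -> : box a b = set0; last by rewrite !measure0.
  apply/seteqP; split=> // x /(_ i) /andP[h1 h2].
  by case/negP: ba; exact: le_trans h1 h2.
- move=> k; suff -> : mu (box (fun=> - k%:R) (fun=> k%:R)) =
     (\prod_(i < n) (k%:R - - k%:R))%:E by rewrite ltry.
  by apply: mub => i; rewrite (le_trans _ (ler0n _ k))// oppr_le0 ler0n.
- by [].
Qed.

Lemma leb_sigma_finite : sigma_finite setT leb.
Proof.
exists (fun k => box (fun=> - k%:R) (fun=> k%:R)); first by rewrite box_cover.
move=> k; split; first by [].
rewrite leb_box ?ltry// => i.
by rewrite (le_trans _ (ler0n _ k))// oppr_le0 ler0n.
Qed.

(* A copy of Lebesgue measure that carries its sigma-finite structure. *)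
Definition lebs : set E -> \bar R := leb.
HB.instance Definition _ := Measure.on lebs.
HB.instance Definition _ := @Measure_isSigmaFinite.Build _ _ _ lebs leb_sigma_finite.

End box.
#[global] Hint Resolve measurable_box : core.

(** * Translations and dilations of Lebesgue measure *)

Section change_of_variables.
Context (R : realType) (n : nat).
Local Notation E := 'rV[R]_n.
Local Notation leb := (@lebesgue_rV R n).
Local Open Scope ereal_scope.

Lemma measurable_rVD d (T : measurableType d) (f g : T -> E) :
  measurable_fun setT f -> measurable_fun setT g ->
  measurable_fun setT (fun t => (f t + g t)%R).
Proof.
move=> /measurable_fun_rVP mf /measurable_fun_rVP mg.
apply/measurable_fun_rVP => i.
by under eq_fun do rewrite mxE; exact: measurable_funD.
Qed.

Lemma measurable_rVZ d (T : measurableType d) (f : T -> R) (g : T -> E) :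
  measurable_fun setT f -> measurable_fun setT g ->
  measurable_fun setT (fun t => (f t *: g t)%R).
Proof.
move=> mf /measurable_fun_rVP mg.
apply/measurable_fun_rVP => i.
by under eq_fun do rewrite mxE; exact: measurable_funM.
Qed.

Lemma measurable_rVB d (T : measurableType d) (f g : T -> E) :
  measurable_fun setT f -> measurable_fun setT g ->
  measurable_fun setT (fun t => (f t - g t)%R).
Proof.
move=> mf mg; apply: measurable_rVD => //.
under eq_fun do rewrite -scaleN1r.
exact: measurable_rVZ.
Qed.

Definition affine (a : E) (c : R) (x : E) : E := (a + c *: x)%R.

Lemma measurable_affine a c : measurable_fun setT (affine a c).
Proof. by apply: measurable_rVD => //; exact: measurable_rVZ. Qed.

HB.instance Definition _ a c :=
  isMeasurableFun.Build _ _ _ _ (affine a c) (measurable_affine a c).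

Section pushforward.
Variables (a : E) (c : R) (c0 : c != 0%R).

Definition affine_push : set E -> \bar R :=
  fun A => (`|c| ^+ n)%:E * leb (affine a c @^-1` A).

Let mpre A : measurable A -> measurable (affine a c @^-1` A).
Proof. by move=> mA; rewrite -[X in measurable X]setTI; exact: measurable_affine. Qed.

Let affine_push0 : affine_push set0 = 0.
Proof. by rewrite /affine_push preimage_set0 measure0 mule0. Qed.

Let affine_push_ge0 A : 0 <= affine_push A.
Proof. by rewrite mule_ge0// lee_fin exprn_ge0. Qed.

Let affine_push_sigma_additive : semi_sigma_additive affine_push.
Proof.
move=> F mF tF mUF; rewrite /affine_push preimage_bigcup.
rewrite [X in X @ _ --> _](_ : _ = fun k => (`|c| ^+ n)%:E *
    \sum_(0 <= i < k) leb (affine a c @^-1` F i)); last first.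
  apply/funext => k; rewrite ge0_sume_distrr//.
apply: cvgeZl => //.
apply: measure_semi_sigma_additive.
- by move=> i; exact: mpre.
- apply/trivIsetP => i j _ _ ij; rewrite -preimage_setI.
  by move/trivIsetP : tF => -> //; rewrite preimage_set0.
- by rewrite -preimage_bigcup; exact: mpre.
Qed.

HB.instance Definition _ := isMeasure.Build _ _ _ affine_push
  affine_push0 affine_push_ge0 affine_push_sigma_additive.

Lemma affine_pushE A : measurable A -> affine_push A = leb A.
Proof.
apply: leb_unique => u v uv.
change ((`|c| ^+ n)%:E * leb (affine a c @^-1` box u v) =
  (\prod_(i < n) (v i - u i))%:E).
(* The preimage of a box is a box whose endpoints are exchanged when [c < 0]; minimum and maximum
   treat both signs at once. *)
pose p i := Num.min ((u i - a ord0 i) / c)%R ((v i - a ord0 i) / c)%R.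
pose q i := Num.max ((u i - a ord0 i) / c)%R ((v i - a ord0 i) / c)%R.
have pq i : (p i <= q i)%R by rewrite /p /q le_max !ge_min lexx.
have -> : affine a c @^-1` box u v = box p q.
  apply/seteqP; split=> x /= h i; have := h i;
  rewrite /affine !mxE /p /q ge_min le_max.
    have [cn|cp|c00] := ltgtP c 0%R; last by move: c0; rewrite c00 eqxx.
    - rewrite !ler_ndivrMr// !ler_ndivlMr// ![(_ * c)%R]mulrC.
      by move=> /andP[h1 h2]; apply/andP; split; apply/orP; [right|left]; lra.
    - rewrite !ler_pdivrMr// !ler_pdivlMr// ![(_ * c)%R]mulrC.
      by move=> /andP[h1 h2]; apply/andP; split; apply/orP; [left|right]; lra.
  have [cn|cp|c00] := ltgtP c 0%R; last by move: c0; rewrite c00 eqxx.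
  - rewrite !ler_ndivrMr// !ler_ndivlMr// ![(_ * c)%R]mulrC.
    have := uv i.
    by move=> ? /andP[/orP[h1|h1] /orP[h2|h2]]; apply/andP; split; lra.
  - rewrite !ler_pdivrMr// !ler_pdivlMr// ![(_ * c)%R]mulrC.
    have := uv i.
    by move=> ? /andP[/orP[h1|h1] /orP[h2|h2]]; apply/andP; split; lra.
rewrite [leb _]leb_box// -EFinM; congr _%:E.
rewrite -[X in (_ ^+ X)%R](card_ord n) -prodr_const -big_split/=.
apply: eq_bigr => i _; rewrite /p /q.
have [cn|cp|c00] := ltgtP c 0%R; last by move: c0; rewrite c00 eqxx.
- have h : ((v i - a ord0 i) / c <= (u i - a ord0 i) / c)%R.
    by rewrite ler_wnM2r ?invr_le0 ?(ltW cn)// lerD2r.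
  by rewrite (min_idPr h) (max_idPl h) ltr0_norm//; field; exact: c0.
- have h : ((u i - a ord0 i) / c <= (v i - a ord0 i) / c)%R.
    by rewrite ler_wpM2r ?invr_ge0 ?(ltW cp)// lerD2r.
  by rewrite (min_idPl h) (max_idPr h) gtr0_norm//; field; exact: c0.
Qed.

End pushforward.

Lemma ge0_integral_affine (a : E) (c : R) (f : E -> \bar R) : c != 0%R ->
  measurable_fun setT f -> (forall x, 0 <= f x) ->
  \int[leb]_x f (a + c *: x)%R = (`|c| ^- n)%:E * \int[leb]_x f x.
Proof.
move=> c0 mf f0.
have cn0 : (0 < `|c| ^+ n)%R by rewrite exprn_gt0// normr_gt0.
have -> : \int[leb]_x f (a + c *: x)%R = \int[pushforward leb (affine a c)]_x f x.
  rewrite (@ge0_integral_pushforward _ _ _ _ _ _ (measurable_affine a c))//.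
have -> : \int[leb]_x f x = (`|c| ^+ n)%:E * \int[pushforward leb (affine a c)]_x f x.
  pose m := measure_function_pushforward__canonical__measure_function_Measure
    leb (measurable_affine a c).
  transitivity (\int[mscale (NngNum (ltW cn0)) m]_x f x).
    apply: eq_measure_integral => A mA _.
    by rewrite -(affine_pushE a c0)//.
  by rewrite ge0_integral_mscale.
by rewrite muleA -EFinM mulVf ?gt_eqF// mul1e.
Qed.

Lemma ge0_integral_shift (v : E) (f : E -> \bar R) :
  measurable_fun setT f -> (forall x, 0 <= f x) ->
  \int[leb]_x f (x + v)%R = \int[leb]_x f x.
Proof.
move=> mf f0; under eq_integral do rewrite addrC -[X in (_ + X)%R]scale1r.
by rewrite ge0_integral_affine ?oner_eq0// normr1 expr1n invr1 mul1e.
Qed.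

Lemma integral_shift (v : E) (f : E -> R) :
  measurable_fun setT f ->
  (\int[leb]_x f (x + v) = \int[leb]_x f x)%R.
Proof.
move=> mf; rewrite /Rintegral; congr fine.
have mfE : measurable_fun setT (EFin \o f) by exact/measurable_EFinP.
rewrite [LHS]integralE [RHS]integralE; congr (_ - _).
- rewrite -(ge0_integral_shift v (measurable_funepos mfE)) => [|x].
    by apply: eq_integral => x _; rewrite !funeposE.
  exact: funepos_ge0.
- rewrite -(ge0_integral_shift v (measurable_funeneg mfE)) => [|x].
    by apply: eq_integral => x _; rewrite !funenegE.
  exact: funeneg_ge0.
Qed.

End change_of_variables.

(** * Borel sets, cubes and compact sets of R^n *)

Section topology_rV.
Context (R : realType) (n : nat).
Local Notation E := 'rV[R]_n.
Local Notation leb := (@lebesgue_rV R n).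

Lemma coord_le_norm (x : E) i : `|x ord0 i| <= `|x|.
Proof.
have /mapP[j Hj ->] : `|x ord0 i| \in [seq `|x y.1 y.2| | y : 'I_1 * 'I_n].
  by apply/mapP; exists (ord0, i) => //=; rewrite mem_enum.
by rewrite [leRHS]/Num.norm /= mx_normrE; apply/bigmax_geP; right => /=; exists j.
Qed.

Lemma rV_norm_leP (x : E) M : 0 <= M ->
  (`|x| <= M) <-> (forall i, `|x ord0 i| <= M).
Proof.
move=> M0; split=> [xM i|h]; first exact: le_trans (coord_le_norm _ _) xM.
rewrite [leLHS]/Num.norm /= mx_normrE; apply/bigmax_leP; split => // -[i j] _ /=.
by rewrite ord1; exact: h.
Qed.

Lemma rV_norm_ltP (x : E) M : 0 < M ->
  (`|x| < M) <-> (forall i, `|x ord0 i| < M).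
Proof.
move=> M0; split=> [xM i|h]; first exact: le_lt_trans (coord_le_norm _ _) xM.
rewrite [ltLHS]/Num.norm /= mx_normrE; apply/bigmax_ltP; split => // -[i j] _ /=.
by rewrite ord1; exact: h.
Qed.

(** Boxes with rational corners form a countable family of neighbourhoods. This links the
    sigma-algebra generated by the coordinates to the topology, and makes open sets and continuous
    functions measurable. *)
Lemma near_box (U : set E) (x : E) : nbhs x U ->
  exists a b : 'I_n -> rat, box (ratr \o a : 'I_n -> R) (ratr \o b) x /\
    box (ratr \o a : 'I_n -> R) (ratr \o b) `<=` U.
Proof.
move=> /nbhs_ballP[e /= e0 eU].
have hl i : exists q : rat, ratr q \in `]x ord0 i - e, x ord0 i[.
  by apply: rat_in_itvoo; rewrite ltrBlDr ltrDl.
have hr i : exists q : rat, ratr q \in `]x ord0 i, x ord0 i + e[.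
  by apply: rat_in_itvoo; rewrite ltrDl.
have [a ha] := choice hl; have [b hb] := choice hr.
exists a, b; split=> [i|y hy].
  have := ha i; have := hb i; rewrite !in_itv/= => /andP[/ltW h1 _] /andP[_ /ltW h2].
  by rewrite h1 h2.
apply: eU; rewrite mx_norm_ball/= rV_norm_ltP// => i; rewrite !mxE.
have := hy i; have := ha i; have := hb i; rewrite !in_itv/= ltr_norml.
by move=> /andP[? ?] /andP[? ?] /andP[? ?]; apply/andP; split; lra.
Qed.

Lemma open_measurable_rV (U : set E) : open U -> measurable U.
Proof.
move=> oU; pose D := ({ffun 'I_n -> rat} * {ffun 'I_n -> rat})%type.
pose B (p : D) : set E := box (ratr \o p.1 : 'I_n -> R) (ratr \o p.2).
have -> : U = \bigcup_(p : D) (if `[< B p `<=` U >] then B p else set0).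
  apply/seteqP; split=> x.
    move=> Ux; have [a [b [abx abU]]] := near_box (open_nbhs_nbhs (conj oU Ux)).
    have eqB : B (finfun a, finfun b) = box (ratr \o a : 'I_n -> R) (ratr \o b).
      by apply/seteqP; split=> y /= h i; have := h i; rewrite /= !ffunE.
    exists (finfun a, finfun b) => //; rewrite eqB.
    by rewrite ifT//; exact/asboolP.
  by case=> p _; case: asboolP => // h /h.
apply: countable_bigcupT_measurable; first exact: countableP.
by move=> p; case: ifP => // _; exact: measurable_box.
Qed.

Lemma continuous_measurable_rV (h : E -> R) : continuous h ->
  measurable_fun setT h.
Proof.
move=> ch; apply: (measurability (@RGenOpens.G R)).
  exact: RGenOpens.measurableE.
move=> _ [_ [c [d ->]] <-]; rewrite setTI; apply: open_measurable_rV.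
by apply: open_comp => // y _; exact: ch.
Qed.

Definition cbox (M : R) : set E := box (fun=> - M) (fun=> M).

Lemma cboxE M : 0 <= M -> cbox M = [set x | `|x| <= M].
Proof.
by move=> M0; apply/seteqP; split=> x; rewrite /= rV_norm_leP// => h i;
  have := h i; rewrite ler_norml.
Qed.

Lemma measurable_cbox M : measurable (cbox M).
Proof. exact: measurable_box. Qed.

Lemma leb_cbox M : 0 <= M -> leb (cbox M) = ((2 * M) ^+ n)%:E.
Proof.
move=> M0; rewrite leb_box => [|i]; last by rewrite (le_trans _ M0)// oppr_le0.
congr _%:E; rewrite -[X in _ ^+ X](card_ord n) -prodr_const.
by apply: eq_bigr => i _; lra.
Qed.

Lemma compact_box (a b : 'I_n -> R) : compact (box a b).
Proof.
rewrite (_ : box a b = [set v : E | forall i, `[a i, b i]%classic (v ord0 i)]).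
  by apply: (@rV_compact _ _ (fun i => `[a i, b i]%classic)) => i; exact: segment_compact.
by apply/seteqP; split=> x /= h i; have := h i; rewrite /= in_itv.
Qed.

Lemma compact_measurable_rV (K : set E) : compact K -> measurable K.
Proof.
move=> cK; rewrite -[K]setCK; apply: measurableC; apply: open_measurable_rV.
by apply: closed_openC; apply: compact_closed.
Qed.

Lemma compact_cbox (K : set E) : compact K -> exists2 M : nat, K `<=` cbox M%:R & true.
Proof.
move=> /compact_bounded[M [_ hM]].
exists (Num.truncn (`|M| + 1)).+1 => //.
move=> x Kx; rewrite cboxE//=; apply: le_trans (ltW (truncnS_gt _)).
apply: hM => //; rewrite (le_lt_trans (ler_norm M))// ltrDl//.
Qed.

Lemma loc_integrableP (h : E -> R) : loc_integrable h <->
  measurable_fun setT h /\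
  (forall M : nat, (\int[leb]_(x in cbox M%:R) `|h x|%:E < +oo)%E).
Proof.
split=> -[mh ih]; split=> //.
  by move=> M; apply: ih; exact: compact_box.
move=> K /[dup] cK /compact_cbox[M KM _]; apply: le_lt_trans (ih M).
apply: ge0_subset_integral => //.
- exact: compact_measurable_rV.
- exact: measurable_cbox.
- by apply/measurable_EFinP; apply: measurableT_comp => //; exact: measurable_funTS.
Qed.

End topology_rV.
#[global] Hint Extern 0 (measurable _) =>
  solve [apply: measurable_cbox | apply: measurable_box] : core.

(** * Test functions *)

Section smooth1.
Context (R : realType).
Implicit Types f g : R -> R.

(** Differentiability of order [k], with no continuity asked of the last derivative and no condition
    for [k = 0]. This is why [Mk_coord] gives up one order. *)
Fixpoint Ck (k : nat) f : Prop :=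
  if k is k'.+1 then
    exists2 g, (forall x : R, is_derive x 1 f (g x)) & Ck k' g
  else True.

Lemma CkW k f : Ck k.+1 f -> Ck k f.
Proof.
elim: k f => // k IH f [g fg Cg]; exists g => //.
exact: IH.
Qed.

Lemma CkD k f g : Ck k f -> Ck k g -> Ck k (f \+ g).
Proof.
elim: k f g => // k IH f g [f' ff' Cf] [g' gg' Cg]; exists (f' \+ g').
  by move=> x; apply: is_deriveD.
exact: IH.
Qed.

Lemma CkZ k c f : Ck k f -> Ck k (fun x => c * f x).
Proof.
elim: k f => // k IH f [f' ff' Cf]; exists (fun x => c * f' x).
  by move=> x; exact: (@is_deriveZ _ _ _ _ c).
exact: IH.
Qed.

Lemma CkM k f g : Ck k f -> Ck k g -> Ck k (fun x => f x * g x).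
Proof.
elim: k f g => // k IH f g /[dup] /CkW Cf [f' ff' Cf'] /[dup] /CkW Cg [g' gg' Cg'].
exists ((fun x => f x * g' x) \+ (fun x => g x * f' x)).
  by move=> x; exact: is_deriveM.
by apply: CkD; exact: IH.
Qed.

Lemma is_derive_affine f (a b x df : R) : is_derive (a * x + b) 1 f df ->
  is_derive x 1 (fun t => f (a * t + b)) (a * df).
Proof.
move=> fdf; rewrite mulrC.
have h : is_derive x 1 (fun t : R => a * t + b) a.
  by apply: is_derive_eq; rewrite addr0 /GRing.scale /= mulr1.
exact: (@is_derive1_comp _ f (fun t => a * t + b) x df a).
Qed.

Lemma Ck_affine k f a b : Ck k f -> Ck k (fun x => f (a * x + b)).
Proof.
elim: k f => // k IH f [f' ff' Cf]; exists (fun x => a * f' (a * x + b)).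
  by move=> x; exact: is_derive_affine.
by apply: CkZ; exact: IH.
Qed.

(** A quadratic remainder estimate is stable under integration, so this criterion replaces
    differentiation under the integral sign in [lint_is_derive] and [conv_is_derive]; it also
    handles [flat] at the origin. *)
Lemma is_derive_taylor f (x d C : R) :
  (forall h, `|h| <= 1 -> `|f (x + h) - f x - h * d| <= C * h ^+ 2) ->
  is_derive x 1 f d.
Proof.
move=> fC; have h : h^-1 *: ((f \o shift x) (h *: 1) - f x) @[h --> 0^'] --> d.
  apply: cvg_zero; apply: (@cvg_to_0_linear _ _ C 1) => // r /andP[r0 r1].
  have r0' : r != 0 by rewrite -normr_gt0.
  change (`|r^-1 * (f (r * 1 + x) - f x) - d| <= C * `|r|).
  have -> : r^-1 * (f (r * 1 + x) - f x) - d = r^-1 * (f (x + r) - f x - r * d).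
    by rewrite mulr1 [r + x]addrC [in RHS]mulrBr [in RHS]mulrA mulVf// mul1r.
  rewrite normrM normfV ler_pdivrMl//.
  have -> : `|r| * (C * `|r|) = C * r ^+ 2.
    by rewrite mulrCA -expr2 real_normK ?num_real.
  exact/fC/ltW.
by apply: DeriveDef; [apply/cvg_ex; exists d|exact/cvg_lim].
Qed.

(* The index [n] makes the family closed under differentiation. *)
Definition flat (n : nat) (t : R) : R :=
  if t <= 0 then 0 else t ^- n * expR (- t^-1).

(** The exponential series gives [exp (1 / t) >= (1 / t) ^ (n + 2) / (n + 2)!] for [t > 0]. The
    quadratic decay is what [is_derive_taylor] requires at 0. *)
Lemma flat_le n t : `|flat n t| <= (n.+2)`!%:R * t ^+ 2.
Proof.
rewrite /flat; case: (leP t 0) => t0; first by rewrite normr0 mulr_ge0// sqr_ge0.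
rewrite ger0_norm; last by rewrite mulr_ge0 ?expR_ge0// invr_ge0 exprn_ge0// ltW.
have := @expR_ge1Dxn R t^-1 n.+1 (ltW _); rewrite invr_gt0 => /(_ t0) h.
have {h} : t^-1 ^+ n.+2 / (n.+2)`!%:R <= expR t^-1.
  by apply: le_trans h; rewrite lerDr.
rewrite ler_pdivrMr ?ltr0n ?fact_gt0// expRN => h.
rewrite ler_pdivrMr ?expR_gt0//.
rewrite -mulrA mulrCA -ler_pdivrMl ?exprn_gt0//.
apply: le_trans (_ : t^-1 ^+ n.+2 <= _); last by rewrite mulrC.
by rewrite -!exprVn -exprD.
Qed.

Lemma is_derive_flat n (t : R) :
  is_derive t 1 (flat n) (flat n.+2 t - n%:R * flat n.+1 t).
Proof.
have [t0|t0|->] := ltgtP t 0.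
- rewrite /flat (ltW t0) mulr0 subr0.
  have h : is_derive t 1 (cst 0 : R -> R) 0 by exact: is_derive_cst.
  apply: near_eq_is_derive h; rewrite ?oner_neq0//.
  near=> u; rewrite /flat ifT// ltW//.
  by near: u; exact: lt_nbhsl.
- rewrite /flat !leNgt t0/=.
  have tn0 : t != 0 by rewrite gt_eqF.
  have hV : is_derive t 1 (fun u : R => u^-1) (- t ^- 2).
    apply: is_derive_eq; first exact: is_deriveV.
    by rewrite /GRing.scale /= mulr1.
  have hE : is_derive t 1 (fun u : R => expR (- u^-1)) (t ^- 2 * expR (- t^-1)).
    rewrite mulrC.
    apply: (@is_derive1_comp _ expR (fun u => - u^-1) t).
    by apply: is_derive_eq; rewrite opprK.
  have hX : is_derive t 1 (fun u : R => u^-1 ^+ n) (- n%:R * t ^- n.+1).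
    rewrite (_ : (fun u : R => u^-1 ^+ n) = (fun u : R => u^-1) ^+ n); last first.
      by rewrite exprfctE.
    apply: (is_derive_eq (is_deriveX n hV)).
    rewrite /GRing.scale /=; case: n => [|m]; first by rewrite !mul0r oppr0 mul0r.
    by rewrite succnK mulrN -mulrA -!exprVn -exprD addn2 mulNr.
  have h : is_derive t 1 (fun u : R => u^-1 ^+ n * expR (- u^-1))
      (t ^- n.+2 * expR (- t^-1) - n%:R * (t ^- n.+1 * expR (- t^-1))).
    apply: is_derive_eq (is_deriveM hX hE) _.
    by rewrite /GRing.scale /= -!exprVn !exprS expr0; ring.
  apply: near_eq_is_derive h; rewrite ?oner_neq0//.
  near=> u; rewrite /flat ifF ?exprVn//.
  by apply/negbTE; rewrite -ltNge; near: u; exact: lt_nbhsr.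
- rewrite [X in is_derive _ _ _ X](_ : _ = 0); last first.
    by rewrite /flat lexx mulr0 subr0.
  apply: (@is_derive_taylor _ _ _ (n.+2)`!%:R) => h _.
  rewrite add0r {2}/flat lexx mulr0 !subr0.
  exact: flat_le.
Unshelve. all: by end_near. Qed.

Lemma Ck_flat k n : Ck k (flat n).
Proof.
elim: k n => // k IH n; exists (fun t => flat n.+2 t - n%:R * flat n.+1 t).
  exact: is_derive_flat.
rewrite (_ : (fun _ => _) = flat n.+2 \+ (fun t => - n%:R * flat n.+1 t)).
  by apply: CkD => //; exact: CkZ.
by apply/funext => t /=; rewrite mulNr.
Qed.

Lemma flat_ge0 t : 0 <= flat 0 t.
Proof.
by rewrite /flat; case: ifP => // _; rewrite mulr_ge0 ?expR_ge0// invr_ge0.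
Qed.

Lemma flat0 t : t <= 0 -> flat 0 t = 0.
Proof. by rewrite /flat => ->. Qed.

Lemma flat_gt0 t : 0 < t -> 0 < flat 0 t.
Proof.
by move=> t0; rewrite /flat leNgt t0/= expr0 invr1 mul1r expR_gt0.
Qed.

Lemma flat_le1 t : flat 0 t <= 1.
Proof.
rewrite /flat; case: (leP t 0) => [_|t0]; first exact: ler01.
by rewrite expr0 invr1 mul1r -expR0 ler_expR oppr_le0 invr_ge0 ltW.
Qed.

(** For [t >= 0] the argument is at least [k], and [flat 0] tends to 1 at infinity; for [t < 0] the
    argument is eventually negative. The summand [k] yields the limit 1 at [t = 0], so that
    indicators of closed boxes are obtained later. *)
Lemma cvg_flat (t : R) :
  flat 0 (k%:R + k%:R ^+ 2 * t) @[k --> \oo] --> (\1_[set s : R | 0 <= s] t : R).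
Proof.
have [t0|t0] := leP 0 t; last first.
  rewrite indicE memNset/=; last by apply/negP; rewrite -ltNge.
  apply: cvg_near_cst; near=> k; apply: flat0.
  have kt : - t^-1 <= k%:R by near: k; exact: nbhs_infty_ger.
  rewrite expr2 -mulrA -{1}[k%:R]mulr1 -mulrDr mulr_ge0_le0//.
  suff : k%:R * t <= -1 by lra.
  by rewrite -ler_ndivrMr// mulN1r.
rewrite indicE mem_set//=.
apply/cvgrPdist_lt => e e0; near=> k.
have k0 : 0 < k%:R :> R by rewrite ltr0n; near: k; exact: nbhs_infty_gt.
have kt : 0 < k%:R + k%:R ^+ 2 * t by rewrite ltr_pwDl// mulr_ge0// sqr_ge0.
rewrite ger0_norm; last by rewrite subr_ge0 flat_le1.
rewrite /flat leNgt kt/= expr0 invr1 mul1r ltrBlDr.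
apply: lt_le_trans (_ : e + (1 - (k%:R + k%:R ^+ 2 * t)^-1) <= _).
  rewrite addrCA ltrDl subr_gt0 invf_plt ?posrE//.
  apply: (@lt_le_trans _ _ k%:R); last by rewrite lerDl mulr_ge0// sqr_ge0.
  near: k; exact: nbhs_infty_gtr.
by rewrite lerD2l; exact: expR_ge1Dx.
Unshelve. all: by end_near. Qed.

End smooth1.

(** * Smooth functions of several variables *)

Section smoothN.
Context (R : realType) (n : nat).
Local Notation E := 'rV[R]_n.
Implicit Types phi psi : E -> R.
Local Notation e_ i := (delta_mx 0 i : E).

(** The class C^k through partial derivatives. The recursion on [k] makes closure under sums,
    products and line integrals a plain induction; [smoothP] relates it to [smooth]. *)
Fixpoint Mk (k : nat) phi : Prop :=
  if k is k'.+1 then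
    continuous phi /\
    exists2 D : 'I_n -> E -> R, (forall i x, is_derive x (e_ i) phi (D i x)) &
      forall i, Mk k' (D i)
  else continuous phi.

Lemma Mk_continuous k phi : Mk k phi -> continuous phi.
Proof. by case: k => // k []. Qed.

Lemma MkW k phi : Mk k.+1 phi -> Mk k phi.
Proof.
elim: k phi => [|k IH] phi; first by case.
move=> [cphi [D dD MD]]; split => //; exists D => // i.
exact/IH/MD.
Qed.

Lemma Mk_partial k phi i : Mk k.+1 phi -> Mk k (partial i phi).
Proof.
move=> [_ [D dD MD]]; rewrite (_ : partial i phi = D i); first exact: MD.
by apply/funext => x; exact: derive_val.
Qed.

Lemma Mk_is_derive k phi i x : Mk k.+1 phi ->
  is_derive x (e_ i) phi (partial i phi x).
Proof. by move=> [_ [D dD MD]]; apply/derivableP/ex_derive. Qed.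

Lemma smoothP phi : smooth phi <-> forall k, Mk k phi.
Proof.
split=> [sphi k|Mphi s].
  suff : forall s, Mk k (partials s phi) by move=> /(_ [::]).
  elim: k => [|k IH] s; first exact: (sphi s).1.
  split; first exact: (sphi s).1.
  exists (fun i => partial i (partials s phi)).
    by move=> i x; apply/derivableP; exact: (sphi s).2.
  by move=> i; exact: (IH (i :: s)).
have H k : Mk k (partials s phi).
  elim: s k => [|i s IH] k; first exact: Mphi.
  exact/Mk_partial/IH.
split; first exact: (H 0%N).
by move=> i x; have [_ [D dD _]] := H 1%N; case: (dD i x).
Qed.

Lemma MkD k phi psi : Mk k phi -> Mk k psi -> Mk k (phi \+ psi).
Proof.
elim: k phi psi => [|k IH] phi psi /=.
  by move=> cf cg x; exact: cvgD (cf x) (cg x).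
move=> [cf [D dD MD]] [cg [D' dD' MD']]; split.
  by move=> x; exact: cvgD (cf x) (cg x).
exists (fun i => D i \+ D' i) => [i x|i]; first exact: is_deriveD.
exact: IH.
Qed.

Lemma MkM k phi psi : Mk k phi -> Mk k psi -> Mk k (fun x => phi x * psi x).
Proof.
elim: k phi psi => [|k IH] phi psi.
  by move=> cf cg x; exact: cvgM (cf x) (cg x).
move=> /[dup] /MkW Mf [cf [D dD MD]] /[dup] /MkW Mg [cg [D' dD' MD']]; split.
  by move=> x; exact: cvgM (cf x) (cg x).
exists (fun i => (fun x => phi x * D' i x) \+ (fun x => psi x * D i x)).
  by move=> i x; exact: is_deriveM.
by move=> i; exact: MkD (IH _ _ Mf (MD' i)) (IH _ _ Mg (MD i)).
Qed.

Lemma Mk_cst k c : Mk k (cst c).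
Proof.
elim: k c => [|k IH] c; first exact: cst_continuous.
split; first exact: cst_continuous.
by exists (fun=> cst 0) => // i x; exact: is_derive_cst.
Qed.

Lemma MkZ k c phi : Mk k phi -> Mk k (fun x => c * phi x).
Proof. by move=> Mf; apply: MkM => //; exact: Mk_cst. Qed.

Lemma Mk_sum k (I : Type) (s : seq I) (F : I -> E -> R) :
  (forall i, Mk k (F i)) -> Mk k (fun x => \sum_(i <- s) F i x).
Proof.
move=> MF; elim: s => [|i s IH].
  under eq_fun do rewrite big_nil; exact: Mk_cst.
by under eq_fun do rewrite big_cons; exact: MkD.
Qed.

Lemma Mk_prod k (I : Type) (s : seq I) (F : I -> E -> R) :
  (forall i, Mk k (F i)) -> Mk k (fun x => \prod_(i <- s) F i x).
Proof.
move=> MF; elim: s => [|i s IH].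
  under eq_fun do rewrite big_nil; exact: Mk_cst.
by under eq_fun do rewrite big_cons; exact: MkM.
Qed.

(** Reduces directional derivatives to calculus in one real variable, where the chain rule and the
    mean value theorem are at hand. *)
Lemma is_derive_line (phi : E -> R) (x v : E) (d : R) :
  is_derive x v phi d <-> is_derive (0 : R) 1 (fun t : R => phi (x + t *: v)) d.
Proof.
have H : (fun h : R => h^-1 *: ((phi \o shift x) (h *: v) - phi x)) =
  (fun h : R => h^-1 *: (((fun t : R => phi (x + t *: v)) \o shift 0) (h *: 1)
     - phi (x + 0 *: v))).
  apply/funext => h /=.
  by rewrite scale0r !addr0 -[h%:A]/(h * 1) mulr1 [x + _]addrC.
split=> -[dv ev]; apply: DeriveDef.
- by rewrite /derivable -H.
- by rewrite -ev /derive -H.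
- by rewrite /derivable H.
- by rewrite -ev /derive -H.
Qed.

Lemma is_derive_shift (phi : E -> R) (x v w : E) (d : R) :
  is_derive (x + w) v phi d -> is_derive x v (fun y => phi (y + w)) d.
Proof.
move=> /is_derive_line h; apply/is_derive_line.
by under eq_fun do rewrite addrAC.
Qed.

Lemma continuous_coord i : continuous (fun x : E => x ord0 i).
Proof. exact: coord_continuous. Qed.

Lemma Mk_coord k (h : R -> R) i : Ck k.+1 h -> Mk k (fun x : E => h (x ord0 i)).
Proof.
have ch f : Ck 1 f -> continuous (fun x : E => f (x ord0 i)).
  move=> [f' ff' _] x; apply: (@continuous_comp _ _ _ (fun x : E => x ord0 i) f).
    exact: continuous_coord.
  by apply/differentiable_continuous/derivable1_diffP/ex_derive.
have C1 m f : Ck m.+1 f -> Ck 1 f by case=> f' ff' _; exists f'.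
elim: k h => [|k IH] h Ch; first exact: ch.
split; first exact/ch/C1/Ch.
case: Ch => h' hh' Ch'.
exists (fun j x => (i == j)%:R * h' (x ord0 i)).
  move=> j x; apply/is_derive_line.
  rewrite (_ : (fun _ => _) = fun t => h ((i == j)%:R * t + x ord0 i)).
    by apply: is_derive_affine; rewrite mulr0 add0r.
  by apply/funext => t; rewrite !mxE eqxx/= addrC mulrC eq_sym.
by move=> j; apply: MkZ; exact: IH.
Qed.

Lemma Mk_shift k phi w : Mk k phi -> Mk k (fun x => phi (x + w)).
Proof.
have cs (f : E -> R) : continuous f -> continuous (fun x : E => f (x + w)).
  move=> cf x; apply: (@continuous_comp _ _ _ (fun x : E => x + w) f).
    exact: (cvgD cvg_id (cvg_cst w)).
  exact: cf.
elim: k phi => [|k IH] phi; first exact: cs.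
move=> [cphi [D dD MD]]; split; first exact: cs.
exists (fun i x => D i (x + w)) => [i x|i]; first exact: is_derive_shift.
exact: (IH (D i) (MD i)).
Qed.

End smoothN.

Section directional_derivative.
Context (R : realType) (n : nat).
Local Notation E := 'rV[R]_n.
Implicit Types phi psi : E -> R.
Local Notation e_ i := (delta_mx 0 i : E).

Lemma MVT0 (f f' : R -> R) (b : R) : (forall t : R, is_derive t 1 f (f' t)) ->
  exists2 c, `|c| <= `|b| & f b - f 0 = f' c * b.
Proof.
move=> ff'; have cf : continuous f.
  by move=> t; apply/differentiable_continuous/derivable1_diffP/ex_derive.
have [b0|b0|->] := ltgtP b 0.
- have [c cbox h] := @MVT R f f' b 0 b0 (fun t _ => ff' t) (continuous_subspaceT cf).
  exists c.
    by move: cbox; rewrite in_itv/= => /andP[? ?]; rewrite !ltr0_norm//; lra.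
  by rewrite -opprB h; ring.
- have [c cbox h] := @MVT R f f' 0 b b0 (fun t _ => ff' t) (continuous_subspaceT cf).
  exists c; last by rewrite h subr0.
  by move: cbox; rewrite in_itv/= => /andP[? ?]; rewrite !gtr0_norm//; lra.
- by exists 0 => //; rewrite subrr mulr0.
Qed.

(** Directional derivatives are not additive in general. Continuity of the derivative along [w] at
    [x] repairs this: the increment along [w] is given by the mean value theorem, and its
    intermediate point tends to [x]. *)
Lemma is_derive_addd phi (D : E -> R) (x v w : E) (c d : R) :
  is_derive x v phi d -> (forall y, is_derive y w phi (D y)) ->
  {for x, continuous D} -> is_derive x (v + c *: w) phi (d + c * D x).
Proof.
move=> dv dw cD.
have H (h : R) : exists th : R, `|th| <= `|h * c| /\
    phi (x + h *: v + (h * c) *: w) - phi (x + h *: v) =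
    D (x + h *: v + th *: w) * (h * c).
  have := @MVT0 (fun t => phi (x + h *: v + t *: w))
    (fun t => D (x + h *: v + t *: w)) (h * c).
  rewrite scale0r addr0 => /(_ _)[t|th h1 h2]; last by exists th.
  have /is_derive_line := dw (x + h *: v + t *: w) => h1.
  rewrite (_ : (fun _ => _) = fun s => phi (x + h *: v + t *: w + (1 * s + - t) *: w)).
    rewrite -[X in is_derive _ _ _ X]mul1r.
    by apply: (@is_derive_affine _ (fun u => phi (x + h *: v + t *: w + u *: w)));
      rewrite mul1r subrr.
  apply/funext => s; rewrite mul1r scalerBl; congr phi.
  by rewrite [s *: w - _]addrC addrA addrK.
have [th hth] := choice H.
have c1 : (fun h : R => x + h *: v + th h *: w) @ 0^' --> x.
  rewrite -[X in _ --> X]addr0; apply: cvgD.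
    rewrite -[X in _ --> X]addr0; apply: cvgD; first exact: cvg_cst.
    rewrite -(scale0r v); by apply: cvgZr_tmp; exact: nbhs_dnbhs.
  rewrite -(scale0r w); apply: cvgZr_tmp.
  by apply: (@cvg_to_0_linear _ _ `|c| 1) => // r _; rewrite mulrC -normrM (hth r).1.
have c2 : (fun h : R => c * D (x + h *: v + th h *: w)) @ 0^' --> c * D x.
  apply: cvgM; first exact: cvg_cst.
  exact: (continuous_cvg _ cD c1).
have c3 : (fun h : R => h^-1 *: (phi (h *: v + x) - phi x)) @ 0^' --> d.
  by case: dv => dv <-; exact: dv.
have c4 : (fun h : R => h^-1 *: (phi (h *: (v + c *: w) + x) - phi x)) @ 0^' -->
    d + c * D x.
  apply: cvg_trans (cvgD c3 c2); apply: near_eq_cvg.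
  near=> h; have h0 : h != 0 by near: h; exact: nbhs_dnbhs_neq.
  have [_ h2] := hth h.
  change (h^-1 * (phi (h *: v + x) - phi x) + c * D (x + h *: v + th h *: w) =
    h^-1 * (phi (h *: (v + c *: w) + x) - phi x)).
  have -> : h *: (v + c *: w) + x = x + h *: v + (h * c) *: w.
    by rewrite scalerDr scalerA addrC addrA.
  rewrite [h *: v + x]addrC.
  apply: (@mulfI _ h) => //; rewrite mulrDr !mulrA mulfV// !mul1r.
  rewrite -[RHS]addr0 -[X in _ = _ + X](subrr (phi (x + h *: v))).
  by rewrite [h * c * _]mulrC -h2; ring.
by apply: DeriveDef; [apply/cvg_ex; exists (d + c * D x)|exact/cvg_lim].
Unshelve. all: by end_near. Qed.

Lemma Mk1_is_derive phi (x v : E) : Mk 1 phi ->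
  is_derive x v phi (\sum_i v ord0 i * partial i phi x).
Proof.
move=> Mphi.
have := row_sum_delta v => {1}->.
elim/big_rec2 : _ => [|i d u _ IH].
  apply/is_derive_line; under eq_fun do rewrite scaler0 addr0.
  exact: is_derive_cst.
rewrite addrC [_ * _ + d]addrC; apply: is_derive_addd => //.
  by move=> y; exact: Mk_is_derive Mphi.
exact: (Mk_continuous (Mk_partial i Mphi)).
Qed.

End directional_derivative.

Section test_functions.
Context (R : realType) (n : nat).
Local Notation E := 'rV[R]_n.
Local Notation leb := (@lebesgue_rV R n).
Implicit Types phi psi : E -> R.
Local Notation e_ i := (delta_mx 0 i : E).

Definition bsupp (M : R) phi : Prop := forall x, M < `|x| -> phi x = 0.

(** The working form of [test_function]: the support is controlled by a number, which can be
    followed through integrals along lines. *)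
Definition tf phi : Prop := (forall k, Mk k phi) /\ exists M, bsupp M phi.

Lemma bsuppW M M' phi : M <= M' -> bsupp M phi -> bsupp M' phi.
Proof. by move=> MM' h x Mx; apply: h; exact: le_lt_trans Mx. Qed.

Lemma tf_bs phi : tf phi -> exists2 M, 0 < M & bsupp M phi.
Proof.
move=> [_ [M hM]]; exists (`|M| + 1); first by rewrite ltr_pwDr.
by apply: bsuppW hM; rewrite (le_trans (ler_norm M))// lerDl.
Qed.

Lemma test_functionP phi : test_function phi <-> tf phi.
Proof.
split=> -[sphi cphi].
  split; first exact/smoothP.
  have [M cM _] := compact_cbox cphi; exists M%:R => x Mx.
  apply/eqP/negPn/negP => phix.
  suff : (cbox M%:R : set E) x by rewrite cboxE//= leNgt Mx.
  exact/cM/subset_closure.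
split; first exact/smoothP.
have [M M0 hM] := tf_bs (conj sphi cphi).
apply: (@subclosed_compact _ _ (cbox M)); first exact: closed_closure.
  exact: compact_box.
rewrite [X in _ `<=` X](closure_id _).1; last first.
  by apply: compact_closed; [exact: norm_hausdorff|exact: compact_box].
apply: closure_subset => x /= phix; rewrite cboxE ?ltW//=.
by rewrite leNgt; apply: contra phix => /hM ->.
Qed.

Lemma bs_bounded phi M : continuous phi -> bsupp M phi ->
  exists2 C, 0 <= C & forall x, `|phi x| <= C.
Proof.
move=> cphi hM; pose M' := `|M| + 1.
have M'0 : 0 <= M' by rewrite addr_ge0.
have : compact (phi @` (cbox M' : set E)).
  apply: continuous_compact; last exact: compact_box.
  exact: continuous_subspaceT.
move=> /compact_bounded[C [_ hC]].
exists (`|C| + 1); first by rewrite addr_ge0.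
move=> x; have [xM|xM] := leP `|x| M'.
  apply: hC; first by rewrite (le_lt_trans (ler_norm C))// ltrDl.
  by exists x => //; rewrite cboxE.
rewrite hM ?normr0 ?addr_ge0//; apply: lt_trans xM.
by rewrite (le_lt_trans (ler_norm M))// ltrDl.
Qed.

Lemma bs_partial i phi M : bsupp M phi -> bsupp M (partial i phi).
Proof.
move=> hM x Mx; rewrite /partial.
rewrite (@near_eq_derive _ _ _ phi (cst 0) x (e_ i)) ?derive_cst//.
near=> y; apply: hM; near: y.
by apply: (cvgr_gt _ _ _ Mx); exact: norm_continuous.
Unshelve. all: by end_near. Qed.

Lemma tf_partial i phi : tf phi -> tf (partial i phi).
Proof.
move=> [Mphi [M hM]]; split; last by exists M; exact: bs_partial.
by move=> k; exact: Mk_partial.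
Qed.

Lemma tfD phi psi : tf phi -> tf psi -> tf (phi \+ psi).
Proof.
move=> [Mf [M hM]] [Mg [M' hM']]; split; first by move=> k; exact: MkD.
exists (Num.max M M') => x; rewrite gt_max => /andP[h1 h2].
by rewrite /= hM// hM'// addr0.
Qed.

Lemma tfMl phi psi : (forall k, Mk k phi) -> tf psi -> tf (fun x => phi x * psi x).
Proof.
move=> Mf [Mg [M hM]]; split; first by move=> k; exact: MkM.
by exists M => x /hM ->; rewrite mulr0.
Qed.

Lemma tfZ c phi : tf phi -> tf (fun x => c * phi x).
Proof. by move=> tp; apply: tfMl => // k; exact: Mk_cst. Qed.

Lemma tf_sum (I : Type) (s : seq I) (F : I -> E -> R) :
  (forall i, tf (F i)) -> tf (fun x => \sum_(i <- s) F i x).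
Proof.
move=> MF; elim: s => [|i s IH].
  under eq_fun do rewrite big_nil; split; first by move=> k; exact: Mk_cst.
  by exists 0.
by under eq_fun do rewrite big_cons; exact: tfD.
Qed.

Lemma tf_shift phi w : tf phi -> tf (fun x => phi (x + w)).
Proof.
move=> [Mf [M hM]]; split; first by move=> k; exact: Mk_shift.
exists (M + `|w|) => x Mx; apply: hM.
have : `|x| <= `|x + w| + `|w|.
  by rewrite -[in leLHS](addrK w x) (le_trans (ler_normB _ _)).
lra.
Qed.

Lemma tf_continuous phi : tf phi -> continuous phi.
Proof. by case=> /(_ 0%N). Qed.

Lemma tf_bounded phi : tf phi -> exists2 C, 0 <= C & forall x, `|phi x| <= C.
Proof.
by move=> /[dup] /tf_continuous cphi [_ [M hM]]; exact: bs_bounded hM.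
Qed.

Lemma tf_lipschitz phi : tf phi ->
  exists2 C, 0 <= C & forall x y, `|phi y - phi x| <= C * `|y - x|.
Proof.
move=> tphi.
have /choice[C hC] : forall i, exists C, 0 <= C /\ forall x, `|partial i phi x| <= C.
  by move=> i; have [C C0 hC] := tf_bounded (tf_partial i tphi); exists C.
exists (\sum_i C i); first by apply: sumr_ge0 => i _; exact: (hC i).1.
move=> x y; pose v := y - x.
have [|c _] := @MVT0 R (fun t => phi (x + t *: v))
  (fun t => \sum_i v ord0 i * partial i phi (x + t *: v)) 1.
  move=> t; have /is_derive_line := @Mk1_is_derive _ _ phi (x + t *: v) v (tphi.1 1%N).
  move=> h; rewrite (_ : (fun _ => _) = fun s => phi (x + t *: v + (1 * s + - t) *: v)).
    rewrite -[X in is_derive _ _ _ X]mul1r.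
    by apply: (@is_derive_affine _ (fun u => phi (x + t *: v + u *: v)));
      rewrite mul1r subrr.
  by apply/funext => s; rewrite mul1r scalerBl [s *: v - _]addrC addrA addrK.
rewrite scale1r scale0r addr0 mulr1 {1}/v [x + _]addrC subrK => ->.
rewrite mulr_suml (le_trans (ler_norm_sum _ _ _))//.
apply: ler_sum => i _; rewrite normrM mulrC ler_pM//; first exact: (hC i).2.
exact: coord_le_norm.
Qed.

Lemma enorm_ge0 (x : E) : 0 <= enorm x.
Proof. exact: sqrtr_ge0. Qed.

Lemma coord_le_enorm (x : E) i : `|x ord0 i| <= enorm x.
Proof.
rewrite -sqrtr_sqr ler_wsqrtr// (bigD1 i)//= lerDl.
by apply: sumr_ge0 => j _; exact: sqr_ge0.
Qed.

Lemma norm_le_enorm (x : E) : `|x| <= enorm x.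
Proof. by apply/rV_norm_leP; [exact: enorm_ge0|exact: coord_le_enorm]. Qed.

Lemma sum_norm_ge (I : finType) (a : I -> R) :
  \sum_i a i ^+ 2 <= (\sum_i `|a i|) ^+ 2.
Proof.
rewrite [leRHS]expr2 mulr_suml; apply: ler_sum => i _.
rewrite -[a i ^+ 2]real_normK ?num_real// expr2 ler_wpM2l//.
by rewrite (bigD1 i)//= lerDl sumr_ge0.
Qed.

Lemma enorm_le (x : E) : enorm x <= n%:R * `|x|.
Proof.
apply: (@le_trans _ _ (\sum_i `|x ord0 i|)).
  rewrite -[leRHS]ger0_norm ?sumr_ge0// -sqrtr_sqr ler_wsqrtr//.
  exact: sum_norm_ge.
rewrite -[X in X%:R * _](card_ord n) -sumr_const mulr_suml.
by apply: ler_sum => i _; rewrite mul1r coord_le_norm.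
Qed.

(** A tempered functional is known to be linear on Schwartz functions only, so this inclusion is
    what makes it linear on test functions. *)
Lemma tf_schwartz phi : tf phi -> schwartz phi.
Proof.
move=> tphi; split; first by apply/smoothP; exact: tphi.1.
move=> m.
have H : forall psi, tf psi -> exists2 C, 0 <= C &
    forall s : seq 'I_n, (size s <= m)%N -> forall x, `|partials s psi x| <= C.
  elim: m => [|k IH] psi tpsi.
    have [C C0 hC] := tf_bounded tpsi; exists C => // s.
    by rewrite leqn0 => /nilP ->.
  have [C C0 hC] := tf_bounded tpsi.
  have /choice[D hD] : forall i, exists D, 0 <= D /\
      forall s : seq 'I_n, (size s <= k)%N ->
      forall x, `|partials s (partial i psi) x| <= D.
    by move=> i; have [D D0 hD] := IH _ (tf_partial i tpsi); exists D.
  exists (C + \sum_i D i).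
    by rewrite addr_ge0// sumr_ge0// => i _; exact: (hD i).1.
  (* The innermost derivative, last in the sequence, is absorbed into the test function, to which
     the induction hypothesis applies. *)
  move=> s; case/lastP: s => [_ x|s i]; rewrite ?size_rcons.
    apply: le_trans (hC x) _; rewrite lerDl.
    by rewrite sumr_ge0// => i _; exact: (hD i).1.
  rewrite ltnS => sk x; rewrite /partials -cats1 foldr_cat/= -/(partials s _).
  apply: le_trans ((hD i).2 _ sk x) _.
  rewrite (bigD1 i)//= addrCA lerDl addr_ge0// sumr_ge0// => j _.
  exact: (hD j).1.
have [C C0 hC] := H _ tphi.
have [M M0 hM] := tf_bs tphi.
apply: (@le_lt_trans _ _ ((1 + n%:R * M) ^+ m * C)%:E); last exact: ltry.
apply: ub_ereal_sup => _ [[x s] /= sm <-]; rewrite lee_fin.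
have [xM|xM] := leP `|x| M.
  apply: ler_pM => //; first by rewrite exprn_ge0// addr_ge0// enorm_ge0.
    rewrite lerXn2r ?nnegrE ?addr_ge0 ?enorm_ge0 ?mulr_ge0 ?(ltW M0)//.
    by rewrite lerD2l (le_trans (enorm_le _))// ler_wpM2l.
  exact: hC.
have -> : partials s phi x = 0.
  suff : bsupp M (partials s phi) by move=> /(_ x xM).
  elim: (s) => [|i u IH]; first exact: hM.
  exact: bs_partial.
by rewrite normr0 mulr0 mulr_ge0// exprn_ge0// addr_ge0// mulr_ge0// ltW.
Qed.

End test_functions.

Section bounded_integrable.
Context d (T : measurableType d) (R : realType).
Variable mu : {measure set T -> \bar R}.

Lemma bdd_integrable (A : set T) (h : T -> R) (C : R) :
  measurable A -> (mu A < +oo)%E -> measurable_fun setT h ->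
  (forall x, `|h x| <= C) -> (forall x, ~ A x -> h x = 0) ->
  mu.-integrable setT (EFin \o h).
Proof.
move=> mA Aoo mh hC hA.
apply: (@le_integrable _ _ _ _ _ _ _ (fun x => (C * \1_A x)%:E)) => //.
- exact/measurable_EFinP.
- move=> x _ /=; rewrite lee_fin indicE; have [xA|xA] := pselect (A x).
    by rewrite mem_set// mulr1 ler_normr hC.
  by rewrite hA// normr0 normr_ge0.
- under eq_fun do rewrite EFinM.
  apply: integrableZl => //.
  apply/integrableP; split; first exact/measurable_EFinP.
  under eq_integral do rewrite gee0_abs ?lee_fin//.
  by rewrite integral_indic// setIT.
Qed.

Lemma bdd_Rintegral (A : set T) (h : T -> R) (C : R) :
  measurable A -> (mu A < +oo)%E -> measurable_fun setT h ->
  (forall x, `|h x| <= C) -> (forall x, ~ A x -> h x = 0) ->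
  `|\int[mu]_x h x| <= C * fine (mu A).
Proof.
move=> mA Aoo mh hC hA.
have ih := bdd_integrable mA Aoo mh hC hA.
rewrite (le_trans (le_normr_Rintegral _ _))//.
rewrite -lee_fin EFinM /Rintegral [X in (_ * X)%E]fineK ?ge0_fin_numE//.
rewrite fineK; last first.
  by rewrite ge0_fin_numE ?integral_ge0//; case/integrableP : ih.
apply: (@le_trans _ _ (\int[mu]_x (C%:E * (\1_A x)%:E))%E).
  apply: ge0_le_integral => //.
  - exact/measurable_EFinP/measurableT_comp.
  - by apply/measurable_EFinP/measurable_funM.
  - move=> x _; rewrite -EFinM lee_fin indicE; have [xA|xA] := pselect (A x).
      by rewrite mem_set// mulr1 hC.
    by rewrite hA// memNset// mulr0 normr0.
rewrite ge0_integralZl//; last 2 first.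
- exact/measurable_EFinP.
- by rewrite lee_fin (le_trans _ (hC point)).
by rewrite integral_indic// setIT.
Qed.

Lemma Rintegral_sum (I : finType) (f : I -> T -> R) :
  (forall i, mu.-integrable setT (EFin \o f i)) ->
  \int[mu]_x (\sum_i f i x) = \sum_i \int[mu]_x f i x.
Proof.
move=> fi; rewrite /Rintegral.
rewrite sum_fine; last by move=> i _; exact: integral_fune_fin_num (fi i).
rewrite -integral_sum//; congr fine.
by apply: eq_integral => x _; rewrite sumEFin.
Qed.

End bounded_integrable.

(** * Integrals along lines *)

Section line_integral.
Context (R : realType) (n : nat).
Local Notation E := 'rV[R]_n.
Local Notation leb := (@lebesgue_rV R n).
Local Notation mu1 := (@lebesgue_measure R).
Implicit Types phi psi : E -> R.
Local Notation e_ i := (delta_mx 0 i : E).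

Variables (k : R -> R) (v : E).
Hypotheses (mk : measurable_fun setT k) (k1 : forall s, `|k s| <= 1) (v0 : v != 0).

(** Convolution along the direction [v] with a kernel on the line. The kernels in use are the
    constant 1, the indicator of a half-line, and indicators of segments. *)
Definition lint phi (x : E) : R := \int[mu1]_s (k s * phi (x - s *: v)).

Let v_gt0 : 0 < `|v|. Proof. by rewrite normr_gt0. Qed.

Lemma bs_line phi M x r s : bsupp M phi -> `|x| <= r -> (M + r) / `|v| < `|s| ->
  phi (x - s *: v) = 0.
Proof.
move=> hM xr; rewrite ltr_pdivrMr// -normrZ => h; apply: hM.
have : `|s *: v| <= `|x - s *: v| + `|x|.
  by rewrite -[in leLHS](subKr x (s *: v)) (le_trans (ler_normB _ _))// addrC.
lra.
Qed.

Lemma measurable_line phi x : continuous phi ->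
  measurable_fun setT (fun s : R => phi (x - s *: v)).
Proof.
move=> cphi; apply: (measurableT_comp (continuous_measurable_rV cphi)).
apply: measurable_rVB => //.
exact: measurable_rVZ.
Qed.

Definition itvL (L : R) : set R := `[- L, L]%classic.

Lemma lint_itv (L : R) : measurable (itvL L) /\
  (mu1 (itvL L) < +oo)%E.
Proof.
by split; rewrite /itvL//; rewrite lebesgue_measure_itv/=; case: ifP; rewrite ?ltry.
Qed.

Lemma fine_mu1 (L : R) : 0 <= L -> fine (mu1 (itvL L)) = 2 * L.
Proof.
move=> L0; rewrite /itvL lebesgue_measure_itv/= lte_fin.
by case: ltgtP => //= h; lra.
Qed.

Lemma lint_norm (h : R -> R) C L : measurable_fun setT h -> 0 <= L ->
  (forall s, `|h s| <= C) -> (forall s, L < `|s| -> h s = 0) ->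
  mu1.-integrable setT (EFin \o (fun s => k s * h s)) /\
  `|\int[mu1]_s (k s * h s)| <= C * (2 * L).
Proof.
move=> mh L0 hC hL; have [mA Aoo] := lint_itv L.
have m1 : measurable_fun setT (fun s => k s * h s) by exact: measurable_funM.
have b1 s : `|k s * h s| <= C.
  by rewrite normrM -[leRHS]mul1r ler_pM.
have z1 s : ~ (itvL L) s -> k s * h s = 0.
  move=> /= sL; rewrite hL ?mulr0// ltNge; apply/negP => h'; apply: sL.
  by rewrite /itvL /= in_itv/= -ler_norml.
split; first exact: (@bdd_integrable _ (measurableTypeR R) _ mu1 _ _ _ mA Aoo m1 b1 z1).
by rewrite -(fine_mu1 L0); exact: (@bdd_Rintegral _ (measurableTypeR R) _ mu1 _ _ _ mA Aoo m1 b1 z1).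
Qed.

Lemma lint_integrable phi x : continuous phi -> (exists M, bsupp M phi) ->
  mu1.-integrable setT (EFin \o (fun s => k s * phi (x - s *: v))).
Proof.
move=> cphi [M hM]; have [C C0 hC] := bs_bounded cphi hM.
have [|||s Ls|//] := @lint_norm (fun s => phi (x - s *: v)) C ((`|M| + `|x|) / `|v|).
- exact: measurable_line.
- by rewrite divr_ge0// addr_ge0.
- by move=> s; exact: hC.
- apply: (bs_line (M := `|M|) (r := `|x|)) Ls => //.
  by apply: bsuppW hM; exact: ler_norm.
Qed.

Lemma lint_sum (I : finType) (c : I -> R) (F : I -> E -> R) x :
  (forall i, continuous (F i)) -> (forall i, exists M, bsupp M (F i)) ->
  lint (fun y => \sum_i c i * F i y) x = \sum_i c i * lint (F i) x.
Proof.
move=> cF bF; rewrite /lint.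
under eq_Rintegral do rewrite mulr_sumr.
transitivity (\sum_i \int[mu1]_s (c i * (k s * F i (x - s *: v)))).
  rewrite -Rintegral_sum//.
    apply: eq_Rintegral => s _; apply: eq_bigr => i _; ring.
  move=> i; rewrite /comp; under eq_fun do rewrite EFinM.
  by apply: integrableZl => //; exact: lint_integrable.
apply: eq_bigr => i _; rewrite RintegralZl//.
exact: lint_integrable.
Qed.

(** The mean value theorem and a Lipschitz bound on the partial derivative give a quadratic
    remainder for each [s]. Outside a window of half-length [L], common to all [|t| <= 1], the
    integrand vanishes. *)
Lemma lint_taylor phi i x : tf phi -> exists C, forall t, `|t| <= 1 ->
  `|lint phi (x + t *: e_ i) - lint phi x - t * lint (partial i phi) x| <=
    C * t ^+ 2.
Proof.
move=> tphi; have tphi' := tf_partial i tphi.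
have [C C0 hC] := tf_lipschitz tphi'.
have [M M0 hM] := tf_bs tphi; have hM' := bs_partial i hM.
pose L := (M + (`|x| + `|e_ i|)) / `|v|.
have L0 : 0 <= L by rewrite divr_ge0// !addr_ge0// ltW.
exists (C * `|e_ i| * (2 * L)) => t t1.
have Lx y : `|y| <= `|x| + `|e_ i| -> forall s, L < `|s| ->
    phi (y - s *: v) = 0 /\ partial i phi (y - s *: v) = 0.
  by move=> yx s Ls; split; [apply: (bs_line hM yx)|apply: (bs_line hM' yx)].
have i1 := lint_integrable (x + t *: e_ i) (tf_continuous tphi) tphi.2.
have i2 := lint_integrable x (tf_continuous tphi) tphi.2.
have i3 := lint_integrable x (tf_continuous tphi') tphi'.2.
rewrite /lint -RintegralB// -RintegralZl// -RintegralB//; last 2 first.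
- by rewrite /comp; under eq_fun do rewrite EFinB; exact: integrableB.
- by rewrite /comp; under eq_fun do rewrite EFinM; exact: integrableZl.
pose h s := phi (x + t *: e_ i - s *: v) - phi (x - s *: v)
  - t * partial i phi (x - s *: v).
rewrite (_ : (fun s => _) = fun s => k s * h s); last first.
  by apply/funext => s; rewrite /h; ring.
have -> : C * `|e_ i| * (2 * L) * t ^+ 2 = C * `|e_ i| * t ^+ 2 * (2 * L) by ring.
apply: (proj2 (lint_norm _ L0 _ _)).
- apply: measurable_funB; last by apply: measurable_funM => //; exact: (measurable_line _ (tf_continuous tphi')).
  by apply: measurable_funB; exact: (measurable_line _ (tf_continuous tphi)).
- move=> s; rewrite /h.
  have [u|c c1] := @MVT0 R (fun u => phi (x - s *: v + u *: e_ i))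
     (fun u => partial i phi (x - s *: v + u *: e_ i)) t.
    have /is_derive_line h' := Mk_is_derive i (x - s *: v + u *: e_ i) (tphi.1 1%N).
    rewrite (_ : (fun _ => _) = fun w => phi (x - s *: v + u *: e_ i + (1 * w + - u) *: e_ i)).
      rewrite -[X in is_derive _ _ _ X]mul1r.
      by apply: (@is_derive_affine _ (fun w => phi (x - s *: v + u *: e_ i + w *: e_ i)));
        rewrite mul1r subrr.
    by apply/funext => w; rewrite mul1r scalerBl [w *: _ - _]addrC addrA addrK.
  rewrite scale0r addr0 [x + _ - _]addrAC => ->.
  rewrite [_ * t]mulrC -mulrBr normrM.
  have := hC (x - s *: v) (x - s *: v + c *: e_ i).
  rewrite [x - _ + _ - _]addrC addKr => h1.
  have -> : C * `|e_ i| * t ^+ 2 = `|t| * (C * `|e_ i| * `|t|).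
    by rewrite -[t ^+ 2]real_normK ?num_real//; ring.
  rewrite ler_wpM2l// (le_trans h1)// normrZ -mulrA ler_wpM2l// mulrC ler_wpM2l//.
- move=> s Ls; rewrite /h.
  have [|-> ->] := Lx x _ s Ls; first by rewrite lerDl.
  have [|-> _] := Lx (x + t *: e_ i) _ s Ls.
    rewrite (le_trans (ler_normD _ _))// lerD2l normrZ -[leRHS]mul1r.
    by rewrite ler_wpM2r.
  by rewrite mulr0 !subr0.
Qed.

Lemma lint_is_derive phi i x : tf phi ->
  is_derive x (e_ i) (lint phi) (lint (partial i phi) x).
Proof.
move=> tphi; apply/is_derive_line.
have [C hC] := lint_taylor i x tphi.
by apply: (@is_derive_taylor _ _ _ _ C) => t /hC; rewrite add0r scale0r addr0.
Qed.

Lemma lint_continuous phi : tf phi -> continuous (lint phi).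
Proof.
move=> tphi x; have [C C0 hC] := tf_lipschitz tphi.
have [M M0 hM] := tf_bs tphi.
pose L := (M + (`|x| + 1)) / `|v|.
have L0 : 0 <= L by rewrite divr_ge0// !addr_ge0// ltW.
have H y : `|y - x| <= 1 -> `|lint phi y - lint phi x| <= C * `|y - x| * (2 * L).
  move=> yx; have i1 := lint_integrable y (tf_continuous tphi) tphi.2.
  have i2 := lint_integrable x (tf_continuous tphi) tphi.2.
  rewrite /lint -RintegralB//.
  under eq_Rintegral do rewrite -mulrBr.
  apply: (proj2 (lint_norm _ L0 _ _)).
  - by apply: measurable_funB; exact: (measurable_line _ (tf_continuous tphi)).
  - move=> s; apply: le_trans (hC _ _) _.
    by rewrite opprB addrA subrK.
  - move=> s Ls; rewrite (bs_line hM _ Ls) ?(bs_line hM _ Ls) ?subrr//.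
      by rewrite lerDl.
    rewrite -[y](subrK x) addrC (le_trans (ler_normD _ _))// lerD2l//.
have D0 : 0 < C * (2 * L) + 1 by rewrite ltr_wpDl// mulr_ge0// mulr_ge0.
apply/(@cvgrPdist_le _ _ _ (nbhs (x : E)) _ (lint phi) (lint phi x)) => e e0.
near=> y; rewrite distrC; have yx : `|y - x| <= 1.
  by rewrite distrC; near: y; exact: cvgr_dist_le.
apply: le_trans (H y yx) _.
have yx2 : `|y - x| <= e / (C * (2 * L) + 1).
  rewrite distrC; near: y; apply: cvgr_dist_le => //.
  by rewrite divr_gt0.
apply: (@le_trans _ _ ((C * (2 * L) + 1) * `|y - x|)); last first.
  by rewrite mulrC -ler_pdivlMr.
by rewrite mulrAC ler_wpM2r// lerDl.
Unshelve. all: by end_near. Qed.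

Lemma Mk_lint k' phi : tf phi -> Mk k' (lint phi).
Proof.
elim: k' phi => [|k' IH] phi tphi; first exact: lint_continuous.
split; first exact: lint_continuous.
exists (fun i => lint (partial i phi)) => [i x|i]; first exact: lint_is_derive.
exact/IH/tf_partial.
Qed.

Definition dird phi (x : E) := \sum_i v ord0 i * partial i phi x.

Lemma dird_lint phi x : tf phi -> dird (lint phi) x = lint (dird phi) x.
Proof.
move=> tphi; rewrite [RHS]lint_sum => [|i|i].
- apply: eq_bigr => i _; congr (_ * _).
  by apply: derive_val; exact: lint_is_derive.
- exact/tf_continuous/tf_partial.
- exact: (tf_partial i tphi).2.
Qed.

End line_integral.

Section line_integral_dird.
Context (R : realType) (n : nat).
Local Notation E := 'rV[R]_n.
Local Notation mu1 := (@lebesgue_measure R).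
Implicit Types phi psi : E -> R.

Lemma tf_dird v phi : tf phi -> tf (dird v phi).
Proof. by move=> tphi; apply: tf_sum => i; exact/tfZ/tf_partial. Qed.

Lemma is_derive_ray v phi (x : E) (s : R) : tf phi ->
  is_derive s 1 (fun s : R => - phi (x - s *: v)) (dird v phi (x - s *: v)).
Proof.
move=> tphi.
have /is_derive_line h := Mk1_is_derive (x - s *: v) v (tphi.1 1%N).
have h1 : is_derive s 1 (fun t : R => phi (x - s *: v + (-1 * t + s) *: v))
    (- 1 * dird v phi (x - s *: v)).
  by apply: (@is_derive_affine _ (fun u => phi (x - s *: v + u *: v)));
    rewrite mulN1r addNr.
have := is_deriveN h1; rewrite mulN1r opprK; apply: near_eq_is_derive.
near=> t; congr (- phi _); rewrite mulN1r scalerDl scaleNr addrC.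
by rewrite addrACA subrr addr0 addrC.
Unshelve. all: by end_near. Qed.

(** The fundamental theorem of calculus on a segment; with [b] beyond the support it becomes the
    inversion formula [lint_dird_ray]. *)
Lemma lint_dird_itv v phi x (a b : R) : tf phi -> a < b ->
  lint (\1_(`[a, b]%classic : set R)) v (dird v phi) x = phi (x - a *: v) - phi (x - b *: v).
Proof.
move=> tphi ab; rewrite /lint.
have ct : continuous (fun s : R => dird v phi (x - s *: v)).
  move=> s.
  have c1 : (fun t : R => x - t *: v) @ s --> x - s *: v.
    by apply: cvgB; [exact: cvg_cst|apply: cvgZr_tmp; exact: cvg_id].
  have cD : {for x - s *: v, continuous (dird v phi)}.
    exact: tf_continuous (tf_dird v tphi) _.
  exact: (continuous_cvg _ cD c1).
have cF : continuous (fun s : R => - phi (x - s *: v)).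
  move=> s; apply/differentiable_continuous/derivable1_diffP.
  by have [] := is_derive_ray v x s tphi.
have h := @continuous_FTC2 R (fun s : R => dird v phi (x - s *: v))
  (fun s : R => - phi (x - s *: v)) a b ab (continuous_subspaceT ct).
have {}h := h _ _.
transitivity (\int[mu1]_(s in `[a, b]) dird v phi (x - s *: v))%R.
  rewrite [RHS]Rintegral_mkcond; apply: eq_Rintegral => s _.
  by rewrite patchE indicE; case: ifP; rewrite ?mul1r ?mul0r.
rewrite /Rintegral h/=; [by ring|split|].
- by move=> s _; have [] := is_derive_ray v x s tphi.
- by apply: cvg_at_right_filter; exact: cF.
- by apply: cvg_at_left_filter; exact: cF.
- move=> s _; rewrite derive1E; exact: (@derive_val _ _ _ _ _ _ _ (is_derive_ray v x s tphi)).
Qed.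

Lemma lint_dird_ray v phi x : v != 0 -> tf phi ->
  lint (\1_(`[0, +oo[%classic : set R)) v (dird v phi) x = phi x.
Proof.
move=> v0 tphi; have [M M0 hM] := tf_bs tphi.
have hM' : bsupp M (dird v phi).
  by move=> y My; rewrite /dird big1// => i _; rewrite (bs_partial i hM)// mulr0.
pose b := (M + `|x|) / `|v| + 1.
have b0 : 0 < b.
  by rewrite ltr_wpDl// divr_ge0// addr_ge0// ltW.
have bsupp_s s : b <= s -> (M + `|x|) / `|v| < `|s|.
  by move=> bs; rewrite (lt_le_trans _ (ler_norm s))// (lt_le_trans _ bs)// ltrDl.
rewrite -[RHS]subr0 -[X in _ = _ - X](bs_line v0 hM (lexx _) (bsupp_s b (lexx _))).
rewrite -{2}[x]subr0 -(scale0r v) -lint_dird_itv// /lint; apply: eq_Rintegral => s _.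
rewrite !indicE !mem_setE !in_itv/= andbT.
case: (leP 0 s) => //= s0; case: (leP s b) => // /ltW sb.
by rewrite (bs_line v0 hM' (lexx _) (bsupp_s s sb)) !mulr0.
Qed.

End line_integral_dird.

(** * Tonelli, Fubini and locally integrable functions *)

Section fubini_real.
Context d1 d2 (T1 : measurableType d1) (T2 : measurableType d2) (R : realType).
Variable m1 : {sigma_finite_measure set T1 -> \bar R}.
Variable m2 : {sigma_finite_measure set T2 -> \bar R}.
Variable f : T1 * T2 -> R.
Hypothesis mf : measurable_fun setT f.

Lemma measurable_Rintegral1 : measurable_fun setT (fun x => \int[m2]_y f (x, y)).
Proof.
have mfE : measurable_fun setT (EFin \o f) by exact/measurable_EFinP.
apply: (measurableT_comp (fine_measurable measurableT)).
rewrite (_ : (fun _ => _) = (fun x => \int[m2]_y ((EFin \o f)^\+ (x, y)) -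
   \int[m2]_y ((EFin \o f)^\- (x, y)))%E); last first.
  apply/funext => x; rewrite integralE; congr (_ - _)%E.
    by apply: eq_integral => y _; rewrite !funeposE.
  by apply: eq_integral => y _; rewrite !funenegE.
apply: emeasurable_funB.
- exact: (measurable_fun_fubini_tonelli_F _ (measurable_funepos mfE)).
- exact: (measurable_fun_fubini_tonelli_F _ (measurable_funeneg mfE)).
Qed.

Hypothesis fi : (\int[m1]_x \int[m2]_y `|f (x, y)|%:E < +oo)%E.

Lemma prod_integrable : (m1 \x m2)%E.-integrable setT (EFin \o f).
Proof. by apply/integrable12ltyP => //; exact/measurable_EFinP. Qed.

Lemma le_abs_Rintegral2 x :
  (`|\int[m2]_y f (x, y)|%:E <= \int[m2]_y `|f (x, y)|%:E)%E.
Proof.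
have [h|h] := pselect (m2.-integrable setT (EFin \o (fun y => f (x, y)))).
  rewrite EFin_normr_Rintegral//; apply: le_abse_integral => //.
  exact/measurable_EFinP/measurableT_comp.
(* If the slice is not integrable, [Rintegral] takes some default value, but the right-hand side is
   then infinite. *)
suff -> : (\int[m2]_y `|f (x, y)|%:E = +oo)%E by rewrite leey.
apply/eqP; rewrite -leye_eq leNgt; apply/negP => h'; apply: h.
apply/integrableP; split; last exact: h'.
exact/measurable_EFinP/measurableT_comp.
Qed.

Lemma RintegralE1 :
  (\int[m1]_x (\int[m2]_y f (x, y))%R%:E = \int[m1]_x \int[m2]_y (f (x, y))%:E)%E.
Proof.
apply: ae_eq_integral => //.
- exact/measurable_EFinP/measurable_Rintegral1.
- exact: (measurable_fubini_F prod_integrable).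
(* Almost every slice is integrable, and there [fine] loses nothing. *)
- have := ae_integrable1 prod_integrable.
  apply: filterS => x h _; rewrite /Rintegral fineK//.
  exact: (integrable_fin_num measurableT h).
Qed.

End fubini_real.

Section fubini_real_swap.
Context d1 d2 (T1 : measurableType d1) (T2 : measurableType d2) (R : realType).
Variable m1 : {sigma_finite_measure set T1 -> \bar R}.
Variable m2 : {sigma_finite_measure set T2 -> \bar R}.

Lemma Rfubini (f : T1 * T2 -> R) : measurable_fun setT f ->
  (\int[m1]_x \int[m2]_y `|f (x, y)|%:E < +oo)%E ->
  \int[m1]_x (\int[m2]_y f (x, y)) = \int[m2]_y (\int[m1]_x f (x, y)).
Proof.
move=> mf fi; rewrite /Rintegral; congr fine.
rewrite (RintegralE1 mf fi) (Fubini (prod_integrable mf fi)).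
apply/esym; apply: (@RintegralE1 _ _ _ _ _ m2 m1 (fun z => f (z.2, z.1))).
  by apply: (measurableT_comp mf); exact: measurable_swap.
rewrite -(fubini_tonelli (fun z => `|f z|%:E))//.
exact/measurable_EFinP/measurableT_comp.
Qed.

End fubini_real_swap.

Section tonelli_real.
Context d1 d2 (T1 : measurableType d1) (T2 : measurableType d2) (R : realType).
Variable m1 : {sigma_finite_measure set T1 -> \bar R}.
Variable m2 : {sigma_finite_measure set T2 -> \bar R}.

Lemma measurable_indic_comp (A : set T2) (f : T1 -> T2) : measurable A ->
  measurable_fun setT f -> measurable_fun setT (fun x => \1_A (f x) : R).
Proof.
move=> mA mf.
have mi : measurable_fun setT (\1_A : T2 -> R) by exact: measurable_indic.
exact: measurableT_comp mi mf.
Qed.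

Lemma measurable_integral1 (f : T1 -> T2 -> R) :
  measurable_fun setT (fun p : T1 * T2 => f p.1 p.2) ->
  (forall x y, 0 <= f x y) ->
  measurable_fun setT (fun x => (\int[m2]_y (f x y)%:E)%E).
Proof.
move=> mf f0.
apply: (@measurable_fun_fubini_tonelli_F _ _ _ _ _ m2
  (fun p : T1 * T2 => (f p.1 p.2)%:E)).
  exact/measurable_EFinP.
by move=> p; rewrite lee_fin.
Qed.

Lemma le_integral2 (f g : T1 -> T2 -> R) :
  measurable_fun setT (fun p : T1 * T2 => f p.1 p.2) ->
  measurable_fun setT (fun p : T1 * T2 => g p.1 p.2) ->
  (forall x y, 0 <= f x y <= g x y) ->
  (\int[m1]_x \int[m2]_y (f x y)%:E <= \int[m1]_x \int[m2]_y (g x y)%:E)%E.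
Proof.
move=> mf mg fg.
have f0 x y : 0 <= f x y by case/andP: (fg x y).
have g0 x y : 0 <= g x y by rewrite (le_trans (f0 x y))//; case/andP: (fg x y).
apply: ge0_le_integral => //.
- by move=> x _; apply: integral_ge0 => y _; rewrite lee_fin.
- exact: measurable_integral1.
- exact: measurable_integral1.
- move=> x _; apply: ge0_le_integral => //.
  + by move=> y _; rewrite lee_fin.
  + by apply/measurable_EFinP; exact: (measurableT_comp mf (pair1_measurable x)).
  + by apply/measurable_EFinP; exact: (measurableT_comp mg (pair1_measurable x)).
  + by move=> y _; rewrite lee_fin; case/andP: (fg x y).
Qed.

Lemma tonelli_real (f : T1 -> T2 -> R) :
  measurable_fun setT (fun p : T1 * T2 => f p.1 p.2) ->
  (forall x y, 0 <= f x y) ->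
  (\int[m1]_x \int[m2]_y (f x y)%:E = \int[m2]_y \int[m1]_x (f x y)%:E)%E.
Proof.
move=> mf f0.
rewrite (@fubini_tonelli _ _ _ _ _ m1 m2 (fun p : T1 * T2 => (f p.1 p.2)%:E))//.
  exact/measurable_EFinP.
by move=> p; rewrite lee_fin.
Qed.

End tonelli_real.

(** * Locally integrable functions *)

Section loc_integrable.
Context (R : realType) (n : nat).
Local Notation E := 'rV[R]_n.
Local Notation leb := (@lebesgue_rV R n).
Local Notation mu1 := (@lebesgue_measure R).
Implicit Types (g h phi : E -> R).

Lemma loc_measurable g : loc_integrable g -> measurable_fun setT g.
Proof. by case. Qed.

Lemma loc_cbox g (M : R) : loc_integrable g ->
  (\int[leb]_(x in cbox M) `|g x|%:E < +oo)%E.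
Proof. by case=> _; apply; exact: compact_box. Qed.

Lemma loc_integrable_cst (c : R) : loc_integrable (cst c : E -> R).
Proof.
apply/loc_integrableP; split => // M.
rewrite (integral_cst _ _ `|c|%:E)// leb_cbox// -EFinM ltry//.
Qed.

Lemma loc_integrableD g h : loc_integrable g -> loc_integrable h ->
  loc_integrable (fun x => g x + h x).
Proof.
move=> lg lh; have mg := loc_measurable lg; have mh := loc_measurable lh.
apply/loc_integrableP; split => [|M]; first exact: measurable_funD.
apply: (@le_lt_trans _ _ (\int[leb]_(x in cbox M%:R) (`|g x|%:E + `|h x|%:E))%E).
  apply: ge0_le_integral => //.
  - by apply/measurable_EFinP/measurable_funTS/measurableT_comp => //; exact: measurable_funD.
  - by apply/measurable_funTS/emeasurable_funD; exact/measurable_EFinP/measurableT_comp.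
  - by move=> x _; rewrite -EFinD lee_fin ler_normD.
rewrite ge0_integralD//.
- by rewrite lte_add_pinfty// loc_cbox.
- exact/measurable_funTS/measurable_EFinP/measurableT_comp.
- exact/measurable_funTS/measurable_EFinP/measurableT_comp.
Qed.

Lemma loc_integrableZ (c : R) g : loc_integrable g ->
  loc_integrable (fun x => c * g x).
Proof.
move=> lg; have mg := loc_measurable lg.
apply/loc_integrableP; split => [|M]; first exact: measurable_funM.
under eq_integral do rewrite normrM EFinM.
rewrite ge0_integralZl//; last exact/measurable_funTS/measurable_EFinP/measurableT_comp.
by rewrite lte_mul_pinfty// loc_cbox.
Qed.

Lemma loc_integrable_sum (I : Type) (s : seq I) (F : I -> E -> R) :
  (forall i, loc_integrable (F i)) ->
  loc_integrable (fun x => \sum_(i <- s) F i x).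
Proof.
move=> MF; elim: s => [|i s IH].
  by under eq_fun do rewrite big_nil; exact: loc_integrable_cst.
by under eq_fun do rewrite big_cons; exact: loc_integrableD.
Qed.

Lemma loc_int_ge0_bound g phi C M : measurable_fun setT g ->
  measurable_fun setT phi -> (forall x, `|phi x| <= C) -> bsupp M phi -> 0 <= M ->
  (\int[leb]_x `|g x * phi x|%:E <= C%:E * \int[leb]_(x in cbox M) `|g x|%:E)%E.
Proof.
move=> mg mphi hC hM M0.
have C0 : 0 <= C by rewrite (le_trans _ (hC 0)).
rewrite -ge0_integralZl//; last exact/measurable_funTS/measurable_EFinP/measurableT_comp.
rewrite [leRHS]integral_mkcond; apply: ge0_le_integral => //.
- exact/measurable_EFinP/measurableT_comp/measurable_funM.
- apply/(measurable_restrictT _ _).1 => //.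
  apply: measurable_funeM.
  exact/measurable_funTS/measurable_EFinP/measurableT_comp.
- move=> x _; rewrite patchE; case: ifPn => [_|].
    by rewrite -EFinM lee_fin normrM mulrC ler_wpM2r.
  rewrite notin_setE cboxE//= => /negP; rewrite -ltNge => xM.
  by rewrite hM// mulr0 normr0.
Qed.

Lemma loc_integrable_mul g phi C M : loc_integrable g ->
  measurable_fun setT phi -> (forall x, `|phi x| <= C) -> bsupp M phi ->
  leb.-integrable setT (EFin \o (fun x => g x * phi x)).
Proof.
move=> lg mphi hC hM; have mg := loc_measurable lg.
apply/integrableP; split; first exact/measurable_EFinP/measurable_funM.
have hM' : bsupp `|M| phi by apply: bsuppW hM; exact: ler_norm.
apply: le_lt_trans (loc_int_ge0_bound mg mphi hC hM' _) _ => //.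
by rewrite lte_mul_pinfty ?loc_cbox// lee_fin (le_trans _ (hC 0)).
Qed.

Lemma loc_integrable_tf g phi : loc_integrable g -> tf phi ->
  leb.-integrable setT (EFin \o (fun x => g x * phi x)).
Proof.
move=> lg tphi; have [C _ hC] := tf_bounded tphi; have [M _ hM] := tf_bs tphi.
apply: loc_integrable_mul hC hM => //.
exact: continuous_measurable_rV (tf_continuous tphi).
Qed.

Lemma continuous_loc_integrable g : continuous g -> loc_integrable g.
Proof.
move=> cg; have mg := continuous_measurable_rV cg.
split => // K cK.
have : compact (g @` K) by apply: continuous_compact => //; exact: continuous_subspaceT.
move=> /compact_bounded[C [_ /(_ (`|C| + 1))hC]].
have {}hC x : K x -> `|g x| <= `|C| + 1.
  move=> Kx; apply: hC; last by exists x.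
  by rewrite (le_lt_trans (ler_norm C))// ltrDl.
have [M KM _] := compact_cbox cK.
apply: (@le_lt_trans _ _ (\int[leb]_(x in K) (`|C| + 1)%:E)%E).
  apply: ge0_le_integral => //; first exact: compact_measurable_rV.
  - exact/measurable_funTS/measurable_EFinP/measurableT_comp.
rewrite integral_cst; last exact: compact_measurable_rV.
rewrite lte_mul_pinfty//.
apply: (@le_lt_trans _ _ (leb (cbox M%:R))); last by rewrite leb_cbox// ltry.
by rewrite le_measure ?inE//; exact: (compact_measurable_rV cK).
Qed.

End loc_integrable.

Section fubini_rV.
Context (R : realType) (n : nat).
Local Notation E := 'rV[R]_n.
Local Notation leb := (@lebesgue_rV R n).
Local Notation mu1 := (@lebesgue_measure R).

Lemma measurable_int_line (f : E -> R -> R) :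
  measurable_fun setT (fun p : E * R => f p.1 p.2) -> (forall x r, 0 <= f x r) ->
  measurable_fun setT (fun x => (\int[mu1]_r (f x r)%:E)%E).
Proof. exact: (@measurable_integral1 _ _ E (measurableTypeR R) R mu1). Qed.

Lemma measurable_int_rV d (T : measurableType d) (f : T -> E -> R) :
  measurable_fun setT (fun p : T * E => f p.1 p.2) -> (forall x y, 0 <= f x y) ->
  measurable_fun setT (fun x => (\int[leb]_y (f x y)%:E)%E).
Proof. exact: (@measurable_integral1 _ _ T E R (@lebs R n)). Qed.

Lemma measurable_Rint_line (f : E -> R -> R) :
  measurable_fun setT (fun p : E * R => f p.1 p.2) ->
  measurable_fun setT (fun x => \int[mu1]_r f x r).
Proof.
exact: (@measurable_Rintegral1 _ _ E (measurableTypeR R) R mu1 (fun p => f p.1 p.2)).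
Qed.

Lemma le_abs_Rint_line (f : E -> R -> R) x :
  measurable_fun setT (fun p : E * R => f p.1 p.2) ->
  (`|\int[mu1]_r f x r|%:E <= \int[mu1]_r `|f x r|%:E)%E.
Proof.
move=> mf.
exact: (@le_abs_Rintegral2 _ _ E (measurableTypeR R) R mu1 (fun p => f p.1 p.2)).
Qed.

Lemma le_integral_line (f g : E -> R -> R) :
  measurable_fun setT (fun p : E * R => f p.1 p.2) ->
  measurable_fun setT (fun p : E * R => g p.1 p.2) ->
  (forall x r, 0 <= f x r <= g x r) ->
  (\int[leb]_x \int[mu1]_r (f x r)%:E <= \int[leb]_x \int[mu1]_r (g x r)%:E)%E.
Proof. exact: (@le_integral2 _ _ E (measurableTypeR R) R (@lebs R n) mu1). Qed.

Lemma le_integral_rV (f g : E -> E -> R) :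
  measurable_fun setT (fun p : E * E => f p.1 p.2) ->
  measurable_fun setT (fun p : E * E => g p.1 p.2) ->
  (forall x y, 0 <= f x y <= g x y) ->
  (\int[leb]_x \int[leb]_y (f x y)%:E <= \int[leb]_x \int[leb]_y (g x y)%:E)%E.
Proof. exact: (@le_integral2 _ _ E E R (@lebs R n) (@lebs R n)). Qed.

Lemma tonelli_line (f : E -> R -> R) :
  measurable_fun setT (fun p : E * R => f p.1 p.2) -> (forall x r, 0 <= f x r) ->
  (\int[leb]_x \int[mu1]_r (f x r)%:E = \int[mu1]_r \int[leb]_x (f x r)%:E)%E.
Proof. exact: (@tonelli_real _ _ E (measurableTypeR R) R (@lebs R n) mu1). Qed.

Lemma tonelli_rV (f : E -> E -> R) :
  measurable_fun setT (fun p : E * E => f p.1 p.2) -> (forall x y, 0 <= f x y) ->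
  (\int[leb]_x \int[leb]_y (f x y)%:E = \int[leb]_y \int[leb]_x (f x y)%:E)%E.
Proof. exact: (@tonelli_real _ _ E E R (@lebs R n) (@lebs R n)). Qed.

Lemma Rfubini_line (f : E -> R -> R) :
  measurable_fun setT (fun p : E * R => f p.1 p.2) ->
  (\int[leb]_x \int[mu1]_r `|f x r|%:E < +oo)%E ->
  \int[leb]_x (\int[mu1]_r f x r) = \int[mu1]_r (\int[leb]_x f x r).
Proof.
exact: (@Rfubini _ _ E (measurableTypeR R) R (@lebs R n) mu1 (fun p => f p.1 p.2)).
Qed.

Lemma ae_integrable_line (f : E -> R -> R) :
  measurable_fun setT (fun p : E * R => f p.1 p.2) ->
  (\int[leb]_x \int[mu1]_r `|f x r|%:E < +oo)%E ->
  {ae leb, forall x, mu1.-integrable setT (EFin \o f x)}.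
Proof.
move=> mf fi; exact: (@ae_integrable1 _ _ E (measurableTypeR R) R (@lebs R n) mu1
  _ (@prod_integrable _ _ E (measurableTypeR R) R (@lebs R n) mu1
    (fun p => f p.1 p.2) mf fi)).
Qed.

End fubini_rV.

(** * Adjoints of line integrals *)

Section adjoint.
Context (R : realType) (n : nat).
Local Notation E := 'rV[R]_n.
Local Notation leb := (@lebesgue_rV R n).
Local Notation mu1 := (@lebesgue_measure R).
Implicit Types (g h phi : E -> R).

Variables (v : E) (v0 : v != 0) (kap : E * R -> R) (C : R).
Hypotheses (mk : measurable_fun setT kap) (kC : forall p, `|kap p| <= C).
Hypothesis ksupp : forall M : R, exists L : R,
  forall x r, `|x| <= M -> L < `|r| -> kap (x - r *: v, r) = 0.

Definition Kop phi (x : E) : R := \int[mu1]_r (kap (x, r) * phi (x + r *: v)).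

(** The transpose of [Kop] for the Lebesgue pairing, by the substitution [y = x + r *: v]. The
    hypothesis [ksupp] bounds the support of the transposed kernel in [r], uniformly for [y] in a
    cube; this is what lets [Kadj] act on locally integrable functions. *)
Definition Kadj g (y : E) : R :=
  \int[mu1]_r (kap (y - r *: v, r) * g (y - r *: v)).

Let C0 : 0 <= C. Proof. exact: le_trans (normr_ge0 (kap point)) (kC point). Qed.

Let msub : measurable_fun setT (fun p : E * R => p.1 - p.2 *: v).
Proof. by apply: measurable_rVB => //; exact: measurable_rVZ. Qed.

Let madd : measurable_fun setT (fun p : E * R => p.1 + p.2 *: v).
Proof. by apply: measurable_rVD => //; exact: measurable_rVZ. Qed.

Let mkg g : measurable_fun setT g -> measurable_fun setT
  (fun p : E * R => kap (p.1 - p.2 *: v, p.2) * g (p.1 - p.2 *: v)).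
Proof.
move=> mg; apply: measurable_funM; last exact: measurableT_comp.
by apply: (measurableT_comp mk); exact: measurable_fun_pair.
Qed.

(** For [y] in [cbox M] only [|r| <= L'] matters, so [y - r *: v] stays in the larger cube
    [cbox M']. Tonelli and translation invariance then leave a constant times the integral of [|g|]
    over [cbox M']. *)
Lemma Kadj_lty g M : loc_integrable g -> 0 <= M ->
  (\int[leb]_y \int[mu1]_r (\1_(cbox M : set E) y *
     `|kap (y - r *: v, r) * g (y - r *: v)|)%:E < +oo)%E.
Proof.
move=> lg M0; have mg := loc_measurable lg.
have [L hL] := ksupp M.
pose L' := `|L|; have L'0 : 0 <= L' by exact: normr_ge0.
pose M' := M + L' * `|v|.
pose B (p : E * R) : R := C * (\1_(itvL L') p.2 *
  (\1_(cbox M' : set E) (p.1 - p.2 *: v) * `|g (p.1 - p.2 *: v)|)).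
have mB : measurable_fun setT B.
  apply: measurable_funM => //; apply: measurable_funM.
    exact: (measurable_indic_comp (lint_itv _).1 measurable_snd).
  apply: measurable_funM.
    exact: (measurable_indic_comp (measurable_cbox _) msub).
  by apply: measurableT_comp => //; exact: (measurableT_comp mg msub).
have B0 p : 0 <= B p by rewrite !mulr_ge0.
have mK : measurable_fun setT (fun p : E * R => \1_(cbox M : set E) p.1 *
    `|kap (p.1 - p.2 *: v, p.2) * g (p.1 - p.2 *: v)|).
  apply: measurable_funM.
    exact: (measurable_indic_comp (measurable_cbox _) measurable_fst).
  by apply: measurableT_comp => //; exact: mkg.
apply: (@le_lt_trans _ _ (\int[leb]_y \int[mu1]_r (B (y, r))%:E)%E).
  apply: (@le_integral_line _ _ _ (fun y r => B (y, r)) mK) => [|y r].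
    by under eq_fun do rewrite -surjective_pairing.
  rewrite mulr_ge0//= indicE; case: (boolP (y \in _)) => [yM|_]; last first.
    by rewrite mul0r.
  have {}yM : `|y| <= M by move: yM; rewrite inE cboxE.
  have [rL|rL] := leP `|r| L'; last first.
    rewrite hL ?(le_lt_trans (ler_norm L))//.
    by rewrite mul0r normr0 mulr0.
  rewrite mul1r /B /= normrM ler_pM//.
  rewrite !indicE !mem_set ?mul1r//.
    rewrite cboxE ?addr_ge0 ?mulr_ge0//=.
    by rewrite (le_trans (ler_normB _ _))// lerD// normrZ ler_wpM2r.
  by rewrite /itvL /= in_itv/= -ler_norml.
rewrite (@tonelli_line _ _ (fun y r => B (y, r)))//.
pose I := (\int[leb]_(x in cbox M') `|g x|%:E)%E.
have Ioo : (I < +oo)%E by exact: loc_cbox.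
rewrite (_ : (\int[mu1]_r _)%E =
  (\int[mu1]_r ((C * \1_(itvL L') r)%:E * I))%E); last first.
  apply: eq_integral => r _.
  rewrite (_ : (\int[leb]_y _)%E =
    \int[leb]_y ((C * \1_(itvL L') r)%:E * (\1_(cbox M' : set E) (y + (- r *: v)) *
      `|g (y + (- r *: v))|)%:E)%E)%E; last first.
    apply: eq_integral => y _; rewrite -EFinM /B /= scaleNr; congr _%:E; ring.
  rewrite ge0_integralZl//; last 2 first.
  - apply/measurable_EFinP/measurable_funM.
      apply: measurable_indic_comp => //; exact: measurable_rVD.
    apply: measurableT_comp => //; apply: measurableT_comp => //.
    exact: measurable_rVD.
  - by rewrite lee_fin mulr_ge0.
  congr (_ * _)%E.
  rewrite (@ge0_integral_shift _ _ _ (fun y => (\1_(cbox M' : set E) y * `|g y|)%:E))//.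
  - rewrite /I [RHS]integral_mkcond; apply: eq_integral => y _.
    by rewrite patchE indicE; case: ifP; rewrite ?mul1r ?mul0r.
  - apply/measurable_EFinP/measurable_funM; first exact: measurable_indic.
    exact: measurableT_comp.
under eq_integral do rewrite EFinM -muleA [(_ * I)%E]muleC muleA.
rewrite ge0_integralZl//; last 2 first.
- apply/measurable_EFinP/measurable_indic; exact: (lint_itv L').1.
- by rewrite mule_ge0// integral_ge0.
rewrite integral_indic//; last exact: (lint_itv L').1.
rewrite setIT lte_mul_pinfty ?mule_ge0 ?integral_ge0//.
- rewrite fin_numM// ge0_fin_numE ?integral_ge0//.
- exact: (lint_itv L').2.
Qed.

Lemma loc_integrable_Kadj g : loc_integrable g -> loc_integrable (Kadj g).
Proof.
move=> lg; have mg := loc_measurable lg.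
have mKg : measurable_fun setT (Kadj g).
  exact: (measurable_Rint_line (f := fun y r => kap (y - r *: v, r) * g (y - r *: v)) (mkg mg)).
apply/loc_integrableP; split => // M.
apply: le_lt_trans (Kadj_lty lg (ler0n R M)).
rewrite integral_mkcond; apply: ge0_le_integral => //.
- by move=> y _; rewrite erestrict_ge0.
- apply/(measurable_restrictT _ _).1 => //.
  exact/measurable_funTS/measurable_EFinP/measurableT_comp.
- apply: measurable_int_line => [|y r].
    apply: measurable_funM.
      exact: (measurable_indic_comp (measurable_cbox _) measurable_fst).
    by apply: measurableT_comp => //; exact: mkg.
  by rewrite mulr_ge0.
- move=> y _; rewrite patchE indicE; case: ifPn => yM.
    under eq_integral do rewrite mul1r.
    exact: (le_abs_Rint_line (f := fun y r => kap (y - r *: v, r) * g (y - r *: v)) _ (mkg mg)).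
  by apply: integral_ge0 => r _; rewrite lee_fin mulr_ge0.
Qed.

(** Fubini, a translation of [x] by [- r *: v] for each fixed [r], and Fubini back. The
    integrability needed on both sides is that of [Kadj_lty], since [phi] is bounded with bounded
    support. *)
Lemma adjointP g phi : loc_integrable g -> continuous phi ->
  (exists M, bsupp M phi) ->
  \int[leb]_x (g x * Kop phi x) = \int[leb]_x (Kadj g x * phi x).
Proof.
move=> lg cphi [M hM]; have mg := loc_measurable lg.
have mphi := continuous_measurable_rV cphi.
have [D D0 hD] := bs_bounded cphi hM.
pose M' := `|M|; have M'0 : 0 <= M' by exact: normr_ge0.
have hM' : bsupp M' phi by apply: bsuppW hM; exact: ler_norm.
pose F (x : E) (r : R) := g x * (kap (x, r) * phi (x + r *: v)).
have mF : measurable_fun setT (fun p : E * R => F p.1 p.2).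
  apply: measurable_funM; first exact: (measurableT_comp mg measurable_fst).
  apply: measurable_funM; last exact: (measurableT_comp mphi madd).
  by under eq_fun do rewrite -surjective_pairing.
pose G (y : E) (r : R) := kap (y - r *: v, r) * g (y - r *: v).
have mG : measurable_fun setT (fun p : E * R => G p.1 p.2) by exact: mkg.
have FG y r : F (y + - r *: v) r = G y r * phi y.
  by rewrite /F /G scaleNr subrK; ring.
have mGp : measurable_fun setT (fun p : E * R => G p.1 p.2 * phi p.1).
  by apply: measurable_funM => //; exact: (measurableT_comp mphi measurable_fst).
have GG : (\int[leb]_y \int[mu1]_r `|G y r * phi y|%:E < +oo)%E.
  apply: (@le_lt_trans _ _ (\int[leb]_y \int[mu1]_r
      (D * (\1_(cbox M' : set E) y * `|G y r|))%:E)%E).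
    apply: le_integral_line.
    - exact: measurableT_comp.
    - apply: measurable_funM => //; apply: measurable_funM.
        exact: (measurable_indic_comp (measurable_cbox _) measurable_fst).
      exact: measurableT_comp.
    - move=> y r; rewrite normr_ge0/= normrM indicE.
      case: (boolP (y \in _)) => [_|]; first by rewrite mul1r mulrC ler_wpM2r.
      rewrite notin_setE cboxE// => /negP; rewrite -ltNge => yM.
      by rewrite hM'// normr0 mulr0 mul0r mulr0.
  under eq_integral => y _.
    under eq_integral do rewrite EFinM.
    rewrite ge0_integralZl//; last first.
      apply/measurable_EFinP/measurable_funM => //; apply: measurableT_comp => //.
      exact: (measurableT_comp mG (pair1_measurable y)).
    over.
  rewrite ge0_integralZl//; last 2 first.
  - apply: measurable_int_line => [|y r].
      apply: measurable_funM; last exact: measurableT_comp.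
      exact: (measurable_indic_comp (measurable_cbox _) measurable_fst).
    by rewrite mulr_ge0.
  - by move=> y _; apply: integral_ge0 => r _; rewrite lee_fin mulr_ge0.
  by rewrite lte_mul_pinfty//; exact: Kadj_lty.
have FF : (\int[leb]_x \int[mu1]_r `|F x r|%:E < +oo)%E.
  rewrite (tonelli_line (f := fun x r => `|F x r|))//; last exact: measurableT_comp.
  rewrite (_ : (\int[mu1]_r _)%E =
      \int[mu1]_r \int[leb]_x `|G x r * phi x|%:E)%E; last first.
    apply: eq_integral => r _.
    rewrite -(ge0_integral_shift (- r *: v) (f := fun x => `|F x r|%:E))//.
      by apply: eq_integral => y _; rewrite FG.
    apply/measurable_EFinP/measurableT_comp => //.
    exact: (measurableT_comp mF (pair2_measurable r)).
  rewrite -(tonelli_line (f := fun x r => `|G x r * phi x|))//.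
  exact: measurableT_comp.
transitivity (\int[leb]_x (\int[mu1]_r F x r)).
  apply: eq_Rintegral => x _; rewrite /F /Kop RintegralZl//.
  have mx : measurable_fun setT (fun r : R => kap (x, r) * phi (x + r *: v)).
    have mX : measurable_fun setT (fun p : E * R => kap p * phi (p.1 + p.2 *: v)).
      by apply: measurable_funM => //; exact: (measurableT_comp mphi madd).
    exact: (measurableT_comp mX (pair1_measurable x)).
  have [mA Aoo] := lint_itv ((M' + `|x|) / `|v|).
  apply: (@bdd_integrable _ (measurableTypeR R) _ mu1 _ _ (C * D) mA Aoo mx).
    by move=> r; rewrite normrM ler_pM.
  move=> r; rewrite /itvL /= in_itv/= -ler_norml => /negP; rewrite -ltNge => rx.
  rewrite -[r]opprK scaleNr (bs_line v0 hM' (lexx `|x|)) ?mulr0//.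
  by rewrite normrN.
rewrite (Rfubini_line (f := F))//.
transitivity (\int[mu1]_r (\int[leb]_y (G y r * phi y))).
  apply: eq_Rintegral => r _.
  rewrite -(integral_shift (- r *: v) (f := fun x => F x r)).
    by apply: eq_Rintegral => y _; rewrite FG.
  exact: (measurableT_comp mF (pair2_measurable r)).
rewrite -(Rfubini_line (f := fun y r => G y r * phi y))//.
congr fine; apply: ae_eq_integral => //.
- apply/measurable_EFinP.
  exact: (measurable_Rint_line (f := fun y r => G y r * phi y)).
- apply/measurable_EFinP/measurable_funM => //.
  exact: (measurable_Rint_line (f := G)).
have := ae_integrable_line (f := fun y r => G y r * phi y) mGp GG.
apply: filterS => y h _; congr EFin; rewrite /Kadj.
(* Integrability in [r] is known for [G y r * phi y] only; it passes to [G y r] where [phi y] is not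
   0, and elsewhere both sides vanish. *)
have [->|py] := eqVneq (phi y) 0.
  by rewrite mulr0; under eq_Rintegral do rewrite mulr0; rewrite Rintegral_cst ?mul0r.
under eq_Rintegral do rewrite mulrC.
rewrite RintegralZl// 1?mulrC//.
rewrite (_ : EFin \o G y = fun r => (((phi y)^-1)%:E * (G y r * phi y)%:E)%E).
  exact: integrableZl.
by apply/funext => r /=; rewrite -EFinM; congr EFin; field.
Qed.

End adjoint.

(** * The fundamental lemma of the calculus of variations *)

Section density_measure.
Context d (T : measurableType d) (R : realType).
Variables (mu : {measure set T -> \bar R}) (f : T -> \bar R).
Hypotheses (mf : measurable_fun setT f) (f0 : forall x, (0 <= f x)%E).

Definition density (A : set T) : \bar R := (\int[mu]_(x in A) f x)%E.

Let density0 : density set0 = 0%E.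
Proof. by rewrite /density integral_set0. Qed.

Let density_ge0 A : (0 <= density A)%E.
Proof. exact: integral_ge0. Qed.

Let density_sigma_additive : semi_sigma_additive density.
Proof.
move=> /= F mF tF mUF; rewrite /density; apply: cvg_toP.
  apply: ereal_nondecreasing_is_cvgn => m n mn.
  by apply: lee_sum_nneg_natr => // k _ _; exact: integral_ge0.
by rewrite ge0_integral_bigcup//=; exact: measurable_funTS.
Qed.

HB.instance Definition _ := isMeasure.Build _ _ _ density
  density0 density_ge0 density_sigma_additive.

Definition density_measure : {measure set T -> \bar R} := density.

End density_measure.

Section fundamental_lemma.
Context (R : realType) (n : nat).
Local Notation E := 'rV[R]_n.
Local Notation leb := (@lebesgue_rV R n).
Implicit Types (g h phi : E -> R).

(** The positive and the negative part of [h] are densities of two measures that agree on boxes,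
    hence on all measurable sets. *)
Lemma integral_boxes_eq0 (h : E -> \bar R) : leb.-integrable setT h ->
  (forall a b, (\int[leb]_(x in box a b) h x = 0)%E) ->
  {ae leb, forall x, h x = 0%E}.
Proof.
move=> ih h0; have mh := measurable_int _ ih.
have mp := measurable_funepos mh; have mn := measurable_funeneg mh.
pose mup := density_measure leb mp (funepos_ge0 h).
pose mun := density_measure leb mn (funeneg_ge0 h).
have fp A : measurable A -> (\int[leb]_(x in A) h^\+ x \is a fin_num)%E.
  by move=> mA; apply: integrable_pos_fin_num => //; exact: integrableS ih.
have fn A : measurable A -> (\int[leb]_(x in A) h^\- x \is a fin_num)%E.
  by move=> mA; apply: integrable_neg_fin_num => //; exact: integrableS ih.
have eqm A : measurable A -> mup A = mun A.
  apply: (measure_unique (@boxes R n) (fun k => box (fun=> - k%:R) (fun=> k%:R))).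
  - exact: measurable_boxes.
  - exact: box_setI.
  - by move=> k; do 2 eexists.
  - exact: box_cover.
  - move=> _ [a [b ->]]; have := h0 a b; rewrite integralE => /eqP.
    by rewrite sube_eq ?fp ?fin_num_adde_defl ?fn// add0e => /eqP.
  - move=> k; rewrite /mup /= /density ltey_eq.
    by apply/orP; left; exact: fp.
suff h' : ae_eq leb setT h (cst 0%E) by apply: filterS h' => x /(_ I).
apply: integral_ae_eq => // A _ mA; rewrite integral0 integralE.
by have := eqm A mA; rewrite /mup /mun /= /density => ->; rewrite subee// fn.
Qed.

Lemma cvg_prodr (I : Type) (s : seq I) (u : I -> nat -> R) (l : I -> R) :
  (forall i, u i k @[k --> \oo] --> l i) ->
  (\prod_(i <- s) u i k) @[k --> \oo] --> \prod_(i <- s) l i.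
Proof.
move=> ul; elim: s => [|i s IH].
  by under eq_fun do rewrite big_nil; rewrite big_nil; exact: cvg_cst.
by under eq_fun do rewrite big_cons; rewrite big_cons; exact: cvgM.
Qed.

(** Test functions converging pointwise to the indicator of a closed box, with values in [0, 1] and
    supports in one cube, as dominated convergence requires. *)
Definition plateau (a b : 'I_n -> R) (k : nat) (x : E) : R :=
  \prod_i (flat 0 (k%:R + k%:R ^+ 2 * (x ord0 i - a i)) *
           flat 0 (k%:R + k%:R ^+ 2 * (b i - x ord0 i))).

Lemma plateau_ge0 a b k x : 0 <= plateau a b k x.
Proof. by apply: prodr_ge0 => i _; rewrite mulr_ge0// flat_ge0. Qed.

Lemma plateau_le1 a b k x : plateau a b k x <= 1.
Proof.
apply: prodr_ile1 => i _; rewrite mulr_ge0 ?flat_ge0//=.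
by rewrite -[leRHS]mulr1 ler_pM// ?flat_ge0// flat_le1.
Qed.

Lemma cvg_plateau a b x :
  plateau a b k x @[k --> \oo] --> (\1_(box a b : set E) x : R).
Proof.
have -> : (\1_(box a b : set E) x : R) =
    \prod_i ((\1_[set s : R | 0 <= s] (x ord0 i - a i)) *
             (\1_[set s : R | 0 <= s] (b i - x ord0 i))).
  rewrite indicE; have [xab|/existsNP[i xi]] := pselect (forall i, a i <= x ord0 i <= b i).
    rewrite mem_set//= big1// => i _.
    by have /andP[? ?] := xab i; rewrite !indicE !mem_set ?mulr1//= subr_ge0.
  have -> : (x \in box a b) = false by apply: memNset => /(_ i).
  have ind0 t : t < 0 -> (\1_[set s : R | 0 <= s] t : R) = 0.
    by move=> t0; rewrite indicE memNset//=; apply/negP; rewrite -ltNge.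
  rewrite (bigD1 i)//=; move/negP : xi; rewrite negb_and -!ltNge => /orP[h|h].
    by rewrite ind0 ?subr_lt0// !mul0r.
  by rewrite [X in _ * X * _]ind0 ?subr_lt0// mulr0 mul0r.
apply: cvg_prodr => i; apply: cvgM; exact: cvg_flat.
Qed.

Lemma plateau_bs a b k : bsupp (\sum_i (`|a i| + `|b i|) + 1) (plateau a b k).
Proof.
move=> x xM; set M := \sum_i _ in xM.
have M0 : 0 <= M by apply: sumr_ge0 => i _; rewrite addr_ge0.
have [i xi] : exists i, M + 1 < `|x ord0 i|.
  apply: contrapT => /forallNP h; move: xM; apply/negP; rewrite -leNgt.
  by apply/rV_norm_leP => [|i]; [rewrite addr_ge0|rewrite leNgt; apply/negP/h].
have iM : `|a i| + `|b i| <= M.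
  by rewrite /M (bigD1 i)//= lerDl sumr_ge0// => j _; rewrite addr_ge0.
have neg (t : R) : t < -1 -> k%:R + k%:R ^+ 2 * t <= 0.
  move=> t1; case: k => [|k]; first by rewrite expr0n mul0r addr0.
  rewrite expr2 -mulrA -{1}[k.+1%:R]mulr1 -mulrDr mulr_ge0_le0//.
  have : k.+1%:R * t <= t by rewrite ger_nMl ?ler1n//; lra.
  lra.
rewrite /plateau (bigD1 i)//=.
have /orP[h|h] : (x ord0 i - a i < -1) || (b i - x ord0 i < -1).
- have := ler_norm (a i); have := ler_norm (- a i); rewrite normrN.
  have := ler_norm (b i); have := ler_norm (- b i); rewrite normrN.
  have [x0|x0] := leP 0 (x ord0 i).
    by rewrite ger0_norm// in xi => *; apply/orP; right; lra.
  by rewrite ltr0_norm// in xi => *; apply/orP; left; lra.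
- by rewrite (flat0 (neg _ h)) !mul0r.
- by rewrite (flat0 (neg _ h)) mulr0 !mul0r.
Qed.

Lemma tf_plateau a b k : tf (plateau a b k).
Proof.
split; last by eexists; exact: plateau_bs.
move=> m; apply: Mk_prod => i.
pose f (t : R) := flat 0 (k%:R ^+ 2 * t + (k%:R - k%:R ^+ 2 * a i)) *
  flat 0 (- k%:R ^+ 2 * t + (k%:R + k%:R ^+ 2 * b i)).
have Cf : Ck m.+1 f by apply: CkM; apply: Ck_affine; exact: Ck_flat.
have := Mk_coord i Cf; congr Mk; apply/funext => x; rewrite /f.
by congr (flat 0 _ * flat 0 _); ring.
Qed.

Lemma integral_box_eq0 h : loc_integrable h ->
  (forall phi, tf phi -> \int[leb]_x (h x * phi x) = 0) ->
  forall a b, \int[leb]_(x in box a b) h x = 0.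
Proof.
move=> lh h0 a b; have mh := loc_measurable lh.
pose M := \sum_i (`|a i| + `|b i|) + 1.
have mpl k : measurable_fun setT (plateau a b k).
  exact: continuous_measurable_rV (tf_continuous (tf_plateau a b k)).
have := @dominated_convergence _ E R leb setT measurableT
  (fun k x => (h x * plateau a b k x)%:E)
  (fun x => (h x * \1_(box a b : set E) x)%:E) (fun x => (`|h x| * \1_(cbox M : set E) x)%:E).
case.
- by move=> k; apply/measurable_EFinP/measurable_funM.
- by apply/measurable_EFinP/measurable_funM => //; exact: measurable_indic.
- apply: aeW => x _; apply: cvg_EFin; first exact: nearW.
  by apply: cvgM; [exact: cvg_cst|exact: cvg_plateau].
- apply/integrableP; split.
    apply/measurable_EFinP/measurable_funM; last exact: measurable_indic.
    exact: measurableT_comp.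
  under eq_integral do rewrite gee0_abs ?lee_fin ?mulr_ge0//.
  rewrite (_ : (\int[leb]_x _)%E = \int[leb]_(x in cbox M) `|h x|%:E)%E.
    exact: loc_cbox.
  rewrite [RHS]integral_mkcond; apply: eq_integral => x _.
  by rewrite patchE indicE; case: ifP; rewrite ?mulr1 ?mulr0.
- apply: aeW => x k _; rewrite /= lee_fin normrM ler_wpM2l//.
  rewrite ger0_norm ?plateau_ge0// indicE.
  case: (boolP (x \in _)) => xM; first exact: plateau_le1.
  rewrite plateau_bs//; move: xM; rewrite notin_setE cboxE.
    by move=> /negP; rewrite -ltNge.
  by rewrite addr_ge0// sumr_ge0// => i _; rewrite addr_ge0.
move=> _ _; under eq_fun.
  move=> k; rewrite (_ : (\int[leb]_x _)%E = 0%E); first over.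
  have itp := loc_integrable_tf lh (tf_plateau a b k).
  by rewrite -[LHS]fineK ?(integrable_fin_num measurableT itp)// -/(Rintegral _ _ _) h0//; exact: tf_plateau.
move=> /(cvg_unique _ (cvg_cst 0%E)) => e0.
rewrite Rintegral_mkcond /Rintegral.
rewrite (_ : (\int[leb]_x _)%E = 0%E)// [in RHS]e0//.
by apply: eq_integral => x _; rewrite patchE indicE; case: ifP; rewrite ?mulr1 ?mulr0.
Qed.

(** Since [h] is only locally integrable, boxes are compared for its restriction to each cube
    [cbox M], and the countably many null sets are collected. *)
Lemma fundamental_lemma h : loc_integrable h ->
  (forall phi, tf phi -> \int[leb]_x (h x * phi x) = 0) ->
  {ae leb, forall x, h x = 0}.
Proof.
move=> lh h0; have mh := loc_measurable lh.
have hb := integral_box_eq0 lh h0.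
have H (M : nat) : {ae leb, forall x, ((EFin \o h) \_ (cbox M%:R)) x = 0%E}.
  apply: integral_boxes_eq0.
    apply/(integrable_mkcond _ _).1 => //; apply/integrableP; split.
      exact/measurable_funTS/measurable_EFinP.
    exact: loc_cbox.
  move=> a b; rewrite -integral_mkcondr.
  have [c [d' ->]] : boxes (box a b `&` (cbox M%:R : set E)).
    by apply: box_setI; do 2 eexists.
  have ib : leb.-integrable (box c d') (EFin \o h).
    apply/integrableP; split; first exact/measurable_funTS/measurable_EFinP.
    by case: lh => _; apply; exact: compact_box.
  rewrite -[LHS]fineK ?(integrable_fin_num _ ib)//.
  by congr EFin; exact: hb.
have : {ae leb, forall x, forall M : nat, ((EFin \o h) \_ (cbox M%:R)) x = 0%E}.
  exact: ae_foralln.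
apply: filterS => x hx; have [k kx] := archi_coord x.
have := hx k; rewrite patchE mem_set => [[]//|].
by move=> i; rewrite -ler_norml.
Qed.

End fundamental_lemma.

(** * Distributions with a locally integrable gradient *)

Section lebesgue1.
Context (R : realType).
Local Notation mu1 := (@lebesgue_measure R).

Definition refl1 (c s : R) (r : R) : R := c + s * r.

Lemma measurable_refl1 c s : measurable_fun setT (refl1 c s).
Proof. by apply: measurable_funD => //; exact: measurable_funM. Qed.

Lemma ge0_integral_refl1 (c s : R) (f : R -> \bar R) : s = 1 \/ s = -1 ->
  measurable_fun setT f -> (forall x, (0 <= f x)%E) ->
  (\int[mu1]_r f (c + s * r)%R = \int[mu1]_r f r)%E.
Proof.
move=> s1 mf f0.
pose m : {measure set (measurableTypeR R) -> \bar R} :=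
  @measure_function_pushforward__canonical__measure_function_Measure _ _
  (measurableTypeR R) (measurableTypeR R) R mu1 (refl1 c s) (measurable_refl1 c s).
transitivity (\int[m]_x f x)%E.
  by rewrite (@ge0_integral_pushforward _ _ (measurableTypeR R) (measurableTypeR R)
    _ _ (measurable_refl1 c s) mu1).
apply: eq_measure_integral => A mA _; apply/esym.
apply: lebesgue_measure_unique => // X [[a b] _ <-] /=.
rewrite /pushforward.
case: s1 => s1; rewrite /m s1.
- rewrite (_ : _ @^-1` _ = `](a - c), (b - c)]%classic); last first.
    apply/seteqP; split=> r /=; rewrite !in_itv/= /refl1 mul1r => /andP[? ?];
    by apply/andP; split; lra.
  rewrite !lebesgue_measure_itv/= !lte_fin ltrD2r.
  by case: ifP => // _; rewrite -!EFinD; congr EFin; lra.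
- rewrite (_ : _ @^-1` _ = `[(c - b), (c - a)[%classic); last first.
    apply/seteqP; split=> r /=; rewrite !in_itv/= /refl1 mulN1r => /andP[? ?];
    by apply/andP; split; lra.
  rewrite !lebesgue_measure_itv/= !lte_fin ltrD2l ltrN2.
  by case: ifP => // _; rewrite -!EFinD; congr EFin; lra.
Qed.

Lemma Rintegral_refl1 (c s : R) (f : R -> R) : s = 1 \/ s = -1 ->
  measurable_fun setT f ->
  \int[mu1]_r f (c + s * r) = \int[mu1]_r f r.
Proof.
move=> s1 mf; rewrite /Rintegral; congr fine.
have mfE : measurable_fun setT (EFin \o f) by exact/measurable_EFinP.
rewrite [LHS]integralE [RHS]integralE; congr (_ - _)%E.
- rewrite -(ge0_integral_refl1 c s1 (measurable_funepos mfE)) => [|x].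
    by apply: eq_integral => x _; rewrite !funeposE.
  exact: funepos_ge0.
- rewrite -(ge0_integral_refl1 c s1 (measurable_funeneg mfE)) => [|x].
    by apply: eq_integral => x _; rewrite !funenegE.
  exact: funeneg_ge0.
Qed.

Definition bump0 (t : R) : R := flat 0 (-1 * t + 1) * flat 0 (1 * t + 1).

Lemma Ck_bump0 k : Ck k bump0.
Proof. by apply: CkM; apply: Ck_affine; exact: Ck_flat. Qed.

Lemma bump0_ge0 t : 0 <= bump0 t.
Proof. by rewrite mulr_ge0// flat_ge0. Qed.

Lemma bump0_le1 t : bump0 t <= 1.
Proof. by rewrite /bump0 -[leRHS]mulr1 ler_pM// ?flat_ge0// flat_le1. Qed.

Lemma bump0_supp t : 1 < `|t| -> bump0 t = 0.
Proof.
rewrite /bump0 lter_normr => /orP[h|h].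
  by rewrite flat0 ?mul0r//; lra.
by rewrite [X in _ * X]flat0 ?mulr0//; lra.
Qed.

Lemma bump0_gt0 t : `|t| < 1 -> 0 < bump0 t.
Proof.
by rewrite ltr_norml => /andP[? ?]; rewrite mulr_gt0// flat_gt0//; lra.
Qed.

Lemma Ck_measurable (h : R -> R) : Ck 1 h -> measurable_fun setT h.
Proof.
move=> [h' hh' _]; apply: continuous_measurable_fun => t.
by apply/differentiable_continuous/derivable1_diffP/ex_derive.
Qed.

Lemma integral_supp1 (h : R -> R) : measurable_fun setT h ->
  (forall t, `|h t| <= 1) -> (forall t, 1 < `|t| -> h t = 0) ->
  mu1.-integrable setT (EFin \o h).
Proof.
move=> mh h1 h0; have [mA Aoo] := lint_itv (1 : R).
apply: (@bdd_integrable _ (measurableTypeR R) _ mu1 _ _ 1 mA Aoo mh h1).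
move=> r; rewrite /itvL /= in_itv/= -ler_norml => /negP; rewrite -ltNge => rx.
exact: h0.
Qed.

Lemma int_bump0_gt0 : 0 < \int[mu1]_t bump0 t.
Proof.
have mb := Ck_measurable (Ck_bump0 1).
have ib : mu1.-integrable setT (EFin \o bump0).
  apply: integral_supp1 => // t; last exact: bump0_supp.
  by rewrite ger0_norm ?bump0_ge0// bump0_le1.
rewrite lt0r Rintegral_ge0 ?andbT => [|t _]; last exact: bump0_ge0.
apply/eqP => h.
have : ae_eq mu1 setT (EFin \o bump0) (cst 0%E).
  apply/(ae_eq_integral_abs mu1) => //; first exact/measurable_EFinP.
  under eq_integral do rewrite gee0_abs ?lee_fin ?bump0_ge0//.
  by rewrite -[LHS]fineK ?(integrable_fin_num measurableT ib)// -[fine _]/(Rintegral _ _ _) h.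
move=> [A [mA A0 sA]].
have : (mu1 `](-1)%R, 1%R[%classic <= mu1 A)%E.
  rewrite le_measure ?inE//; move=> t /=; rewrite in_itv/= => t1; apply: sA => /=.
  move=> /(_ I)[] /eqP; rewrite gt_eqF// bump0_gt0// ltr_norml//.
rewrite A0 lebesgue_measure_itv/= lte_fin ifT; last lra.
by rewrite -EFinD lee_fin; lra.
Qed.

Definition bump (t : R) : R := (\int[mu1]_t bump0 t)^-1 * bump0 t.

Lemma Ck_bump k : Ck k bump.
Proof. by apply: CkZ; exact: Ck_bump0. Qed.

Lemma bump_ge0 t : 0 <= bump t.
Proof. by rewrite mulr_ge0 ?bump0_ge0// invr_ge0 ltW// int_bump0_gt0. Qed.

Lemma bump_gt0 : 0 < bump 0.
Proof. by rewrite mulr_gt0 ?invr_gt0 ?int_bump0_gt0// bump0_gt0// normr0. Qed.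

Lemma bump_supp t : 1 < `|t| -> bump t = 0.
Proof. by move=> t1; rewrite /bump bump0_supp// mulr0. Qed.

Lemma measurable_bump : measurable_fun setT bump.
Proof. exact: Ck_measurable (Ck_bump 1). Qed.

Definition bumpC : R := (\int[mu1]_t bump0 t)^-1.

Lemma bump_le t : `|bump t| <= bumpC.
Proof.
rewrite ger0_norm ?bump_ge0// /bump -[leRHS]mulr1 ler_wpM2l ?bump0_le1//.
by rewrite invr_ge0 ltW// int_bump0_gt0.
Qed.

Lemma integrable_bump (c s : R) : s = 1 \/ s = -1 ->
  mu1.-integrable setT (EFin \o (fun r => bump (c + s * r))).
Proof.
move=> s1; have [mA Aoo] := lint_itv (1 + `|c|).
have mh : measurable_fun setT (fun r => bump (c + s * r)).
  exact: (measurableT_comp measurable_bump (measurable_refl1 c s)).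
apply: (@bdd_integrable _ (measurableTypeR R) _ mu1 _ _ bumpC mA Aoo mh).
  by move=> t; exact: bump_le.
move=> r; rewrite /itvL /= in_itv/= -ler_norml => /negP; rewrite -ltNge => rx.
apply: bump_supp.
have : `|r| = `|s * r| by case: s1 => ->; rewrite ?mul1r ?mulN1r ?normrN.
have := ler_normB (c + s * r) c; rewrite addrAC subrr add0r; lra.
Qed.

Lemma int_bump (c s : R) : s = 1 \/ s = -1 -> \int[mu1]_r bump (c + s * r) = 1.
Proof.
move=> s1; rewrite Rintegral_refl1//; last exact: measurable_bump.
rewrite /bump RintegralZl ?mulVf ?gt_eqF ?int_bump0_gt0//.
apply: integral_supp1; first exact: Ck_measurable (Ck_bump0 1).
  by move=> t; rewrite ger0_norm ?bump0_ge0// bump0_le1.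
exact: bump0_supp.
Qed.

End lebesgue1.

Section primitive_kernel.
Context (R : realType).
Local Notation mu1 := (@lebesgue_measure R).

Definition step (s : R) : R := \1_(`[0, +oo[%classic : set R) s.

Lemma measurable_step : measurable_fun setT step.
Proof. by apply: measurable_indic; exact: measurable_itv. Qed.

Lemma step_le1 s : `|step s| <= 1.
Proof. by rewrite /step indicE; case: (_ \in _); rewrite ?normr1 ?normr0. Qed.

Lemma step1 s : 0 <= s -> step s = 1.
Proof. by move=> s0; rewrite /step indicE mem_set//= in_itv/= s0. Qed.

Lemma step0 s : s < 0 -> step s = 0.
Proof.
by move=> s0; rewrite /step indicE memNset//= in_itv/= andbT; apply/negP; rewrite -ltNge.
Qed.

(** The primitive of [bump] vanishing at minus infinity, written as a convolution with [step]
    because it arises in this form when [Aop] is integrated along a half-line. *)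
Definition bumpint (t : R) : R := \int[mu1]_s (step s * bump (t - s)).

Let m2 : measurable_fun setT (fun p : R * R => step p.2 * bump (p.1 - p.2)).
Proof.
apply: measurable_funM; first exact: (measurableT_comp measurable_step measurable_snd).
by apply: (measurableT_comp (@measurable_bump R)); exact: measurable_funB.
Qed.

Lemma measurable_bumpint : measurable_fun setT bumpint.
Proof.
exact: (@measurable_Rintegral1 _ _ (measurableTypeR R) (measurableTypeR R) R mu1
  (fun p => step p.2 * bump (p.1 - p.2)) m2).
Qed.

Lemma integrable_bumpint (t : R) :
  mu1.-integrable setT (EFin \o (fun s => step s * bump (t - s))).
Proof.
apply: (le_integrable measurableT _ _ (integrable_bump t (or_intror erefl))).
  by apply/measurable_EFinP; exact: (measurableT_comp m2 (pair1_measurable t)).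
move=> s _ /=; rewrite lee_fin normrM mulN1r -[leRHS]mul1r ler_wpM2r//.
exact: step_le1.
Qed.

Lemma int_bumpB (t : R) : \int[mu1]_s bump (t - s) = 1.
Proof.
rewrite -(int_bump t (or_intror erefl)).
by apply: eq_Rintegral => s _; rewrite mulN1r.
Qed.

Lemma bumpint_norm t : `|bumpint t| <= 1.
Proof.
rewrite -(int_bumpB t) /bumpint.
apply: le_trans (le_normr_Rintegral _ (integrable_bumpint t)) _ => //.
apply: le_Rintegral => //.
- apply: (le_integrable measurableT _ _ (integrable_bumpint t)).
    apply/measurable_EFinP; apply: measurableT_comp => //.
    exact: (measurableT_comp m2 (pair1_measurable t)).
  by move=> s _ /=; rewrite normr_id.
- have := integrable_bump t (or_intror erefl); congr (mu1.-integrable _).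
  by apply/funext => s /=; rewrite mulN1r.
- move=> s _; rewrite normrM -[leRHS]mul1r ler_pM ?step_le1//.
  by rewrite ger0_norm ?bump_ge0.
Qed.

Lemma bumpint0 t : t < -1 -> bumpint t = 0.
Proof.
move=> t1; rewrite /bumpint (eq_Rintegral _ (g := cst 0)) ?Rintegral_cst ?mul0r// => s _.
have [s0|s0] := ltP s 0; first by rewrite step0 ?mul0r.
by rewrite bump_supp ?mulr0// lter_normr; apply/orP; right; lra.
Qed.

Lemma bumpint1 t : 1 < t -> bumpint t = 1.
Proof.
move=> t1; rewrite /bumpint -(int_bumpB t); apply: eq_Rintegral => s _.
have [s0|s0] := ltP s 0; last by rewrite step1 ?mul1r.
by rewrite bump_supp ?mulr0// lter_normr; apply/orP; left; lra.
Qed.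

End primitive_kernel.

(** * Averages and primitives along a coordinate axis *)

Section coordinate_operators.
Context (R : realType) (n : nat).
Local Notation E := 'rV[R]_n.
Local Notation leb := (@lebesgue_rV R n).
Local Notation mu1 := (@lebesgue_measure R).
Implicit Types (g h phi : E -> R).
Variable i : 'I_n.
Let e : E := delta_mx 0 i.

Let ei : e ord0 i = 1. Proof. by rewrite mxE !eqxx. Qed.

Let ej j : j != i -> e ord0 j = 0.
Proof. by move=> ji; rewrite mxE (negbTE ji) andbF. Qed.

Let e0 : e != 0.
Proof. by apply/eqP => /rowP/(_ i); rewrite ei mxE => /eqP; rewrite oner_eq0. Qed.

Let Ne0 : - e != 0. Proof. by rewrite oppr_eq0. Qed.

Let coordi x s : (x - s *: e) ord0 i = x ord0 i - s.
Proof. by rewrite [LHS]mxE mxE mxE ei mulr1. Qed.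

Let coordj x s j : j != i -> (x - s *: e) ord0 j = x ord0 j.
Proof. by move=> ji; rewrite [LHS]mxE mxE mxE ej// mulr0 subr0. Qed.

Lemma dird_delta phi x : dird e phi x = partial i phi x.
Proof.
rewrite /dird (bigD1 i)//= ei mul1r big1 ?addr0// => j ji.
by rewrite ej// mul0r.
Qed.

Let cst1 (s : R) : `|cst 1 s : R| <= 1. Proof. by rewrite normr1. Qed.
Let mcst : measurable_fun setT (cst 1 : R -> R). Proof. exact: measurable_cst. Qed.

Definition Iop phi (x : E) : R := lint (cst 1) e phi x.

Lemma IopE phi x : Iop phi x = \int[mu1]_s phi (x - s *: e).
Proof. by apply: eq_Rintegral => s _; rewrite mul1r. Qed.

Lemma Iop_integrable phi x : tf phi ->
  mu1.-integrable setT (EFin \o (fun s => phi (x - s *: e))).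
Proof.
move=> tphi.
have := lint_integrable mcst cst1 e0 x (tf_continuous tphi) tphi.2.
congr (mu1.-integrable _); apply/funext => s /=.
by rewrite mul1r.
Qed.

Lemma Iop_shift phi x t : tf phi -> Iop phi (x - t *: e) = Iop phi x.
Proof.
move=> tphi; rewrite !IopE.
rewrite -[RHS](Rintegral_refl1 t (or_introl erefl)); last first.
  exact: measurable_line (tf_continuous tphi).
by apply: eq_Rintegral => s _; rewrite mul1r scalerDl opprD addrA.
Qed.

Lemma bs_off phi M (x : E) j s : bsupp M phi -> j != i -> M < `|x ord0 j| ->
  phi (x - s *: e) = 0.
Proof.
move=> hM ji xM; apply: hM; apply: lt_le_trans xM _.
by rewrite -(coordj x s ji) coord_le_norm.
Qed.

Lemma Iop_off phi M (x : E) j : bsupp M phi -> j != i -> M < `|x ord0 j| -> Iop phi x = 0.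
Proof.
move=> hM ji xM; rewrite IopE (eq_Rintegral _ (g := cst 0)) ?Rintegral_cst ?mul0r// => s _.
by rewrite (bs_off _ hM ji xM).
Qed.

Lemma bs_coord phi M : 0 <= M -> (forall (x : E) j, M < `|x ord0 j| -> phi x = 0) -> bsupp M phi.
Proof.
move=> M0 h x xM; have [j] : exists j, M < `|x ord0 j|; last exact: h.
apply: contrapT => /forallNP h'; move: xM; apply/negP; rewrite -leNgt.
by apply/rV_norm_leP => // j; rewrite leNgt; apply/negP/h'.
Qed.

Definition Aop phi (x : E) : R := bump (x ord0 i) * Iop phi x.

Lemma tf_Aop phi : tf phi -> tf (Aop phi).
Proof.
move=> tphi; have [M M0 hM] := tf_bs tphi; split.
  move=> k; apply: MkM; first exact/Mk_coord/Ck_bump.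
  exact: Mk_lint.
exists (Num.max M 1); apply: bs_coord; first by rewrite le_max (ltW M0).
move=> x j; rewrite gt_max => /andP[xM x1]; rewrite /Aop.
have [ji|ji] := eqVneq j i; first by rewrite bump_supp ?mul0r// -ji.
by rewrite (Iop_off hM ji xM) mulr0.
Qed.

Lemma Iop_Aop phi x : tf phi -> Iop (Aop phi) x = Iop phi x.
Proof.
move=> tphi; rewrite IopE /Aop.
under eq_Rintegral do rewrite Iop_shift// coordi mulrC.
rewrite RintegralZl ?int_bumpB ?mulr1//.
have := integrable_bump (x ord0 i) (or_intror erefl).
by congr (mu1.-integrable _); apply/funext => s /=; rewrite mulN1r.
Qed.

Lemma IopB phi psi x : tf phi -> tf psi ->
  Iop (fun y => phi y - psi y) x = Iop phi x - Iop psi x.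
Proof.
by move=> tp tq; rewrite !IopE RintegralB//; exact: Iop_integrable.
Qed.

Lemma tfB phi psi : tf phi -> tf psi -> tf (fun y => phi y - psi y).
Proof.
move=> tp tq; rewrite (_ : (fun _ => _) = phi \+ (fun x => -1 * psi x)).
  by apply: tfD => //; exact: tfZ.
by apply/funext => x /=; rewrite mulN1r.
Qed.

Definition Pop phi : E -> R := lint (@step R) e (fun y => phi y - Aop phi y).

Lemma tf_Pop phi : tf phi -> tf (Pop phi).
Proof.
move=> tphi; have tchi := tfB tphi (tf_Aop tphi).
have [M M0 hM] := tf_bs tchi; split.
  by move=> k; apply: Mk_lint => //; [exact: measurable_step|exact: step_le1].
exists M; apply: bs_coord; first exact: ltW.
move=> x j xM; rewrite /Pop /lint.
have [ji|ji] := eqVneq j i; last first.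
  rewrite (eq_Rintegral _ (g := cst 0)) ?Rintegral_cst ?mul0r// => s _.
  by rewrite (bs_off _ hM ji xM) mulr0.
rewrite ji in xM.
have big s : M < `|x ord0 i - s| -> phi (x - s *: e) - Aop phi (x - s *: e) = 0.
  by rewrite -coordi => h; apply: hM; exact: lt_le_trans h (coord_le_norm _ _).
have [x0|x0] := leP (x ord0 i) 0.
  rewrite ler0_norm// in xM.
  rewrite (eq_Rintegral _ (g := cst 0)) ?Rintegral_cst ?mul0r// => s _.
  have [s0|s0] := ltP s 0; first by rewrite step0 ?mul0r.
  by rewrite big ?mulr0// lter_normr; apply/orP; right; lra.
rewrite gtr0_norm// in xM.
(* To the right of the support the half-line integral equals the integral over the whole line, which
   is 0 because [phi] and [Aop phi] have the same integral along the axis. Subtracting [Aop phi]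
   serves exactly this bounded support. *)
transitivity (Iop (fun y => phi y - Aop phi y) x).
  rewrite IopE; apply: eq_Rintegral => s _.
  have [s0|s0] := ltP s 0; last by rewrite step1 ?mul1r.
  by rewrite big ?mulr0// lter_normr; apply/orP; left; lra.
by rewrite IopB//; [rewrite Iop_Aop// subrr|exact: tf_Aop].
Qed.

Lemma partial_Pop phi x : tf phi -> partial i (Pop phi) x = phi x - Aop phi x.
Proof.
move=> tphi; have tchi := tfB tphi (tf_Aop tphi).
rewrite -dird_delta dird_lint//.
- exact: (lint_dird_ray x e0 tchi).
- exact: measurable_step.
- exact: step_le1.
Qed.

Definition kapA (p : E * R) : R := bump (p.1 ord0 i).

(** The kernel of [Pop]: [step] comes from the primitive of [phi], and [bumpint] from that of
    [Aop phi], where the factor [Iop phi] is constant along the axis. After the transposition both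
    terms are 1 for large positive [r] and 0 for large negative [r], whence [kapP_supp]. *)
Definition kapP (p : E * R) : R := step p.2 - bumpint (p.1 ord0 i).

Let mcoord : measurable_fun setT (fun p : E * R => p.1 ord0 i).
Proof. exact: (measurableT_comp (measurable_rV_coord i) measurable_fst). Qed.

Lemma measurable_kapA : measurable_fun setT kapA.
Proof. exact: (measurableT_comp (@measurable_bump R) mcoord). Qed.

Lemma measurable_kapP : measurable_fun setT kapP.
Proof.
apply: measurable_funB.
  exact: (measurableT_comp (@measurable_step R) measurable_snd).
exact: (measurableT_comp (@measurable_bumpint R) mcoord).
Qed.

Lemma kapA_le p : `|kapA p| <= bumpC R.
Proof. exact: bump_le. Qed.

Lemma kapP_le p : `|kapP p| <= 2.
Proof.
rewrite (le_trans (ler_normB _ _))//.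
have := step_le1 p.2; have := bumpint_norm (p.1 ord0 i); lra.
Qed.

Let coordN x (r : R) : (x - r *: - e) ord0 i = x ord0 i + r.
Proof. by rewrite scalerN -scaleNr coordi opprK. Qed.

Lemma kapA_supp (M : R) : exists L : R,
  forall (x : E) (r : R), `|x| <= M -> L < `|r| -> kapA (x - r *: - e, r) = 0.
Proof.
exists (M + 1) => x r xM rM; rewrite /kapA coordN bump_supp//.
have := coord_le_norm x i; have := ler_normB (x ord0 i + r) (x ord0 i).
by rewrite addrAC subrr add0r; lra.
Qed.

Lemma kapP_supp (M : R) : exists L : R,
  forall (x : E) (r : R), `|x| <= M -> L < `|r| -> kapP (x - r *: - e, r) = 0.
Proof.
exists (M + 1) => x r xM rM; rewrite /kapP /= coordN.
have := le_trans (coord_le_norm x i) xM; rewrite ler_norml => /andP[x1 x2].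
move: rM; rewrite lter_normr => /orP[rM|rM].
  by rewrite step1 ?bumpint1 ?subrr//; lra.
by rewrite step0 ?bumpint0 ?subrr//; lra.
Qed.

Lemma Aop_Kop phi x : tf phi -> Aop phi x = Kop (- e) kapA phi x.
Proof.
move=> tphi; rewrite /Aop IopE /Kop -RintegralZl//; last exact: Iop_integrable.
by apply: eq_Rintegral => s _; rewrite scalerN.
Qed.

Lemma Pop_Kop phi x : tf phi -> Pop phi x = Kop (- e) kapP phi x.
Proof.
move=> tphi.
have i1 := lint_integrable (@measurable_step R) (@step_le1 R) e0 x (tf_continuous tphi) tphi.2.
have i2 := Iop_integrable x tphi.
have i3 := integrable_bumpint (x ord0 i).
transitivity (\int[mu1]_s (step s * phi (x - s *: e)) - Iop phi x * bumpint (x ord0 i)).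
  rewrite /bumpint -RintegralZl// -RintegralB//; last first.
    by rewrite /comp; under eq_fun do rewrite EFinM; exact: integrableZl.
  apply: eq_Rintegral => s _.
  by rewrite /Aop Iop_shift// coordi; ring.
rewrite mulrC IopE -RintegralZl// -RintegralB//; last first.
  by rewrite /comp; under eq_fun do rewrite EFinM; exact: integrableZl.
by apply: eq_Rintegral => s _; rewrite /kapP scalerN /=; ring.
Qed.

Lemma Aop_adj g : loc_integrable g -> exists2 g', loc_integrable g' &
  forall phi, tf phi -> \int[leb]_x (g x * Aop phi x) = \int[leb]_x (g' x * phi x).
Proof.
move=> lg; exists (Kadj (- e) kapA g).
  exact: (loc_integrable_Kadj measurable_kapA kapA_le kapA_supp).
move=> phi tphi; under eq_Rintegral do rewrite Aop_Kop//.
apply: (adjointP Ne0 measurable_kapA kapA_le kapA_supp lg) => //.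
  exact: tf_continuous.
exact: tphi.2.
Qed.

Lemma Pop_adj g : loc_integrable g -> exists2 g', loc_integrable g' &
  forall phi, tf phi -> \int[leb]_x (g x * Pop phi x) = \int[leb]_x (g' x * phi x).
Proof.
move=> lg; exists (Kadj (- e) kapP g).
  exact: (loc_integrable_Kadj measurable_kapP kapP_le kapP_supp).
move=> phi tphi; under eq_Rintegral do rewrite Pop_Kop//.
apply: (adjointP Ne0 measurable_kapP kapP_le kapP_supp lg) => //.
  exact: tf_continuous.
exact: tphi.2.
Qed.

(** The transpose of [Aop] fixes the constant 1, because [bump] has integral 1. *)
Lemma integral_Aop phi : tf phi -> \int[leb]_x Aop phi x = \int[leb]_x phi x.
Proof.
move=> tphi.
have := adjointP Ne0 measurable_kapA kapA_le kapA_supp (loc_integrable_cst n (1 : R))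
  (tf_continuous tphi) tphi.2.
under eq_Rintegral do rewrite mul1r -Aop_Kop//.
move=> ->; apply: eq_Rintegral => x _.
rewrite /Kadj; under eq_Rintegral do rewrite mulr1 /kapA coordN -[X in _ + X]mul1r.
by rewrite int_bump ?mul1r//; left.
Qed.

(** The identity says that [phi] is a multiple of [bump] on each line parallel to the [j]-th axis;
    it is cross-multiplied because [bump] has zeros. [Aop i] creates this property for [j = i] and
    preserves it for the other axes. *)
Lemma Aop_prop phi j : tf phi ->
  (j == i \/ forall x t, phi (x + t *: delta_mx 0 j) * bump (x ord0 j) =
                phi x * bump (x ord0 j + t)) ->
  forall x t, Aop phi (x + t *: delta_mx 0 j) * bump (x ord0 j) =
              Aop phi x * bump (x ord0 j + t).
Proof.
move=> tphi; have [-> _ x t|ji [//|h] x t] := eqVneq j i.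
  rewrite /Aop -/e -[t]opprK scaleNr Iop_shift// coordi.
  by rewrite opprK; ring.
rewrite /Aop.
have -> : (x + t *: delta_mx 0 j) ord0 i = x ord0 i.
  by rewrite !mxE eqxx/= eq_sym (negbTE ji) mulr0 addr0.
rewrite -[LHS]mulrA -[RHS]mulrA; congr (_ * _).
rewrite !IopE [LHS]mulrC [RHS]mulrC -RintegralZl//; last exact: Iop_integrable.
rewrite -RintegralZl//; last exact: Iop_integrable.
apply: eq_Rintegral => s _; rewrite addrAC [LHS]mulrC.
by have := h (x - s *: e) t; rewrite coordj// => ->; rewrite mulrC.
Qed.

End coordinate_operators.

(** * The representing function and its increments *)

Section representation.
Context (R : realType) (n : nat).
Local Notation E := 'rV[R]_n.
Local Notation leb := (@lebesgue_rV R n).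
Local Notation mu1 := (@lebesgue_measure R).
Implicit Types (F g h phi : E -> R).

Definition Aseq (s : seq 'I_n) phi : E -> R := foldl (fun psi i => Aop i psi) phi s.

Lemma integral_Aseq s phi : tf phi -> \int[leb]_x Aseq s phi x = \int[leb]_x phi x.
Proof.
elim: s phi => [|i s IH] phi tphi //=.
by rewrite IH ?integral_Aop//; exact: tf_Aop.
Qed.

Lemma Aseq_prop s j phi : tf phi ->
  (j \in s \/ forall x t, phi (x + t *: delta_mx 0 j) * bump (x ord0 j) =
                phi x * bump (x ord0 j + t)) ->
  forall x t, Aseq s phi (x + t *: delta_mx 0 j) * bump (x ord0 j) =
              Aseq s phi x * bump (x ord0 j + t).
Proof.
elim: s phi => [|i s IH] phi tphi /=; first by case.
rewrite inE => h; apply: IH; first exact: tf_Aop.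
case: h => [/orP[ji|js]|h]; [|by left|].
  by right; apply: Aop_prop => //; left.
by right; apply: Aop_prop => //; right.
Qed.

Definition tensor (x : E) : R := \prod_i bump (x ord0 i).

Lemma tf_tensor : tf tensor.
Proof.
split; first by move=> k; apply: Mk_prod => i; exact/Mk_coord/Ck_bump.
exists 1; apply: bs_coord => // x j xj.
by rewrite /tensor (bigD1 j)//= bump_supp// mul0r.
Qed.

(** Starting at the origin, the coordinates of [x] are switched on one at a time; by [Aseq_prop] the
    [i]-th of them replaces a factor [bump 0] by [bump (x ord0 i)]. *)
Lemma Aseq_enum phi x : tf phi ->
  Aseq (enum 'I_n) phi x = Aseq (enum 'I_n) phi 0 / bump (0 : R) ^+ n * tensor x.
Proof.
move=> tphi; set chi := Aseq _ _.
have b0 : bump (0 : R) != 0 by rewrite gt_eqF// bump_gt0.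
have H (s : seq 'I_n) : uniq s ->
    chi (\sum_(i <- s) x ord0 i *: delta_mx 0 i) * bump (0 : R) ^+ size s =
    chi 0 * \prod_(i <- s) bump (x ord0 i).
  elim: s => [|i s IH] /=; first by rewrite !big_nil expr0 !mulr1.
  move=> /andP[iS us]; rewrite !big_cons exprS.
  set y := \sum_(_ <- s) _ in IH *.
  have yi : y ord0 i = 0.
    rewrite /y summxE big_seq big1// => j js.
    have /negbTE ij : i != j by apply: contraNneq iS => ->.
    by rewrite !mxE ij andbF mulr0.
  have := @Aseq_prop (enum 'I_n) i phi tphi (or_introl (mem_enum _ i)) y (x ord0 i).
  rewrite yi add0r -/chi addrC => h.
  by rewrite mulrA h mulrAC (IH us) -mulrA [_ * bump _]mulrC.
have := H (index_enum _) (index_enum_uniq _).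
rewrite -row_sum_delta -/(tensor x) => h.
rewrite mulrAC -h -mulrA /index_enum -enumT size_enum_ord divff ?mulr1//.
exact: expf_neq0.
Qed.

(** Otherwise every test function would have integral 0, since averaging over all axes keeps the
    integral and ends in a multiple of [tensor]. This contradicts the fundamental lemma for the
    constant 1. *)
Lemma integral_tensor_neq0 : \int[leb]_x tensor x != 0.
Proof.
apply/eqP => i0.
have H phi : tf phi -> \int[leb]_x (cst 1 x * phi x) = 0.
  move=> tphi; under eq_Rintegral do rewrite mul1r.
  rewrite -(integral_Aseq (enum 'I_n) tphi).
  under eq_Rintegral do rewrite Aseq_enum//.
  rewrite RintegralZl ?i0 ?mulr0//.
  have := loc_integrable_tf (loc_integrable_cst n (1 : R)) tf_tensor.
  by congr (leb.-integrable _); apply/funext => x /=; rewrite mul1r.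
have [A [mA A0 sA]] := fundamental_lemma (loc_integrable_cst n (1 : R)) H.
have : (leb (cbox 1) <= leb A)%E.
  rewrite le_measure ?inE// => x _; apply: sA => /=.
  by apply/eqP; rewrite oner_eq0.
by rewrite A0 leb_cbox// mulr1 lee_fin leNgt exprn_gt0.
Qed.

(* [phi - Aop i phi] is the [i]-th partial derivative of [Pop i phi], on which [f] is
   given by [g i]; iterating over the coordinates turns [phi] into a multiple of [tensor]. *)
Lemma linear_representation (f : (E -> R) -> R) (g : 'I_n -> E -> R) :
  (forall c phi psi, tf phi -> tf psi ->
     f (fun x => c * phi x + psi x) = c * f phi + f psi) ->
  (forall i, loc_integrable (g i)) ->
  (forall i phi, tf phi -> f (partial i phi) = - \int[leb]_x (g i x * phi x)) ->
  exists2 F, loc_integrable F &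
    forall phi, tf phi -> f phi = \int[leb]_x (F x * phi x).
Proof.
move=> flin lg fg.
have step1 i phi : tf phi ->
    f phi = f (Aop i phi) - \int[leb]_x (g i x * Pop i phi x).
  move=> tphi; have tA := tf_Aop i tphi; have tP := tf_Pop i tphi.
  rewrite -(fg i _ tP) -[f (Aop i phi)]mul1r -flin//; last exact: tf_partial.
  by congr f; apply/funext => x; rewrite partial_Pop//; ring.
have stepS (s : seq 'I_n) : exists2 F, loc_integrable F & forall phi, tf phi ->
    f phi = \int[leb]_x (F x * phi x) + f (Aseq s phi).
  elim: s => [|i s [F lF hF]].
    exists (cst 0); first exact: loc_integrable_cst.
    move=> phi _ /=; under eq_Rintegral do rewrite mul0r.
    by rewrite Rintegral_cst ?mul0r ?add0r.
  have [F1 lF1 hF1] := Aop_adj i lF; have [F2 lF2 hF2] := Pop_adj i (lg i).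
  exists (fun x => F1 x + -1 * F2 x).
    by apply: loc_integrableD => //; exact: loc_integrableZ.
  move=> phi tphi; rewrite (step1 i)// (hF _ (tf_Aop i tphi)) hF1// hF2//.
  rewrite addrAC; congr (_ + _).
  rewrite -RintegralB//; try exact: loc_integrable_tf.
  by apply: eq_Rintegral => x _; ring.
have [F lF hF] := stepS (enum 'I_n).
(* Averaging all axes turns [phi] into [a * tensor] with the same integral, so [a] is the integral
   of [phi] over that of [tensor], and [f] contributes the constant density [c]. *)
pose c := f tensor / \int[leb]_x tensor x.
exists (fun x => F x + c).
  by apply: loc_integrableD => //; exact: loc_integrable_cst.
move=> phi tphi; rewrite hF//.
have -> : \int[leb]_x ((F x + c) * phi x) =
    \int[leb]_x (F x * phi x) + c * \int[leb]_x phi x.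
  have i1 := loc_integrable_tf (loc_integrable_cst n (1 : R)) tphi.
  have i2 : leb.-integrable setT (EFin \o phi).
    by move: i1; congr (leb.-integrable _); apply/funext => x /=; rewrite mul1r.
  rewrite -RintegralZl// -RintegralD//.
  - by apply: eq_Rintegral => x _; rewrite mulrDl.
  - exact: loc_integrable_tf.
  - by rewrite /comp; under eq_fun do rewrite EFinM; exact: integrableZl.
congr (_ + _).
have := integral_Aseq (enum 'I_n) tphi.
under eq_Rintegral do rewrite Aseq_enum//.
set a := _ / _; rewrite RintegralZl//; last first.
  have := loc_integrable_tf (loc_integrable_cst n (1 : R)) tf_tensor.
  by congr (leb.-integrable _); apply/funext => x /=; rewrite mul1r.
move=> <-; have -> : f (Aseq (enum 'I_n) phi) = a * f tensor.
  have t0 : tf (cst 0 : E -> R).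
    by split=> [k|]; [exact: Mk_cst|exists 0].
  have f0 : f (cst 0) = 0.
    have := flin (-1) _ _ t0 t0; rewrite mulN1r addNr.
    suff -> : (fun x : E => -1 * (cst 0 x : R) + cst 0 x) = cst 0 by [].
    by apply/funext => x /=; rewrite mulr0 addr0.
  rewrite -[RHS]addr0 -{1}f0 -flin//; last exact: tf_tensor.
  by congr f; apply/funext => x; rewrite Aseq_enum// addr0.
by rewrite /c; field; exact: integral_tensor_neq0.
Qed.

Lemma loc_integrable_shift g (v : E) : loc_integrable g ->
  loc_integrable (fun x : E => g (x + v)).
Proof.
move=> lg; have mg := loc_measurable lg.
have ms : measurable_fun setT (fun x : E => x + v) by exact: measurable_rVD.
have mgs : measurable_fun setT (fun x : E => g (x + v)) by exact: measurableT_comp mg ms.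
apply/loc_integrableP; split => // M.
pose M' := M%:R + `|v|.
apply: (@le_lt_trans _ _ (\int[leb]_x (\1_(cbox M' : set E) (x + v) * `|g (x + v)|)%:E)%E).
  rewrite integral_mkcond; apply: ge0_le_integral => //.
  - by move=> x _; rewrite erestrict_ge0.
  - apply/(measurable_restrictT _ _).1 => //.
    exact/measurable_funTS/measurable_EFinP/measurableT_comp.
  - apply/measurable_EFinP/measurable_funM; last exact: measurableT_comp.
    exact: (measurable_indic_comp (measurable_cbox _) ms).
  - move=> x _; rewrite patchE; case: ifPn => [|_]; last by rewrite lee_fin mulr_ge0.
    rewrite inE cboxE//= => xM; rewrite lee_fin indicE mem_set ?mul1r//.
    rewrite cboxE ?addr_ge0//= (le_trans (ler_normD _ _))// lerD2r//.
rewrite (ge0_integral_shift v (f := fun x => (\1_(cbox M' : set E) x * `|g x|)%:E)).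
- rewrite (_ : (\int[leb]_x _)%E = \int[leb]_(x in cbox M') `|g x|%:E)%E.
    exact: loc_cbox.
  rewrite [RHS]integral_mkcond; apply: eq_integral => x _.
  by rewrite patchE indicE; case: ifP; rewrite ?mul1r ?mul0r.
- apply/measurable_EFinP/measurable_funM; first exact: measurable_indic.
  exact: measurableT_comp.
- by move=> x; rewrite lee_fin mulr_ge0.
Qed.

Definition unitI : R -> R := \1_(`[0, 1]%classic : set R).

Lemma measurable_unitI : measurable_fun setT unitI.
Proof. by apply: measurable_indic; exact: measurable_itv. Qed.

Lemma unitI_ge0 s : 0 <= unitI s.
Proof. by rewrite /unitI indicE. Qed.

Lemma unitI_le1 s : `|unitI s| <= 1.
Proof. by rewrite /unitI indicE; case: (_ \in _); rewrite ?normr1 ?normr0. Qed.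

Lemma unitI_supp s : 1 < `|s| -> unitI s = 0.
Proof.
move=> s1; rewrite /unitI indicE memNset//= in_itv/= => /andP[s0 s1'].
by move: s1; rewrite ger0_norm// ltNge s1'.
Qed.

Definition weak_gradient F (g : 'I_n -> E -> R) : Prop :=
  [/\ loc_integrable F, (forall i, loc_integrable (g i)) &
  forall i phi, tf phi ->
    \int[leb]_x (F x * partial i phi x) = - \int[leb]_x (g i x * phi x)].

(** The null set may depend on [v]. This is enough, because the double integrals below are taken
    over [x] for fixed [v] first. *)
Definition line_identity F (g : 'I_n -> E -> R) : Prop :=
  forall v, {ae leb, forall x, F (x + v) - F x =
    \int[mu1]_s (unitI s * \sum_j v ord0 j * g j (x + s *: v))}.

Lemma weak_gradient_dird F (g : 'I_n -> E -> R) v psi : weak_gradient F g -> tf psi ->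
  \int[leb]_x (F x * dird v psi x) =
  - \int[leb]_x ((\sum_j v ord0 j * g j x) * psi x).
Proof.
move=> [lF lg Fg] tpsi.
transitivity (\sum_j v ord0 j * \int[leb]_x (F x * partial j psi x)).
  under [in RHS]eq_bigr => j _.
    rewrite -RintegralZl//; last exact/loc_integrable_tf/tf_partial.
    over.
  rewrite -Rintegral_sum => [|j].
    apply: eq_Rintegral => x _; rewrite /dird mulr_sumr.
    by apply: eq_bigr => j _; ring.
  rewrite /comp; under eq_fun do rewrite EFinM.
  by apply: integrableZl => //; exact/loc_integrable_tf/tf_partial.
under eq_bigr do rewrite Fg// mulrN.
rewrite sumrN; congr (- _).
under eq_bigr => j _.
  rewrite -RintegralZl//; last exact: loc_integrable_tf.
  over.
rewrite -Rintegral_sum => [|j].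
  apply: eq_Rintegral => x _; rewrite mulr_suml.
  by apply: eq_bigr => j _; ring.
rewrite /comp; under eq_fun do rewrite EFinM.
by apply: integrableZl => //; exact: loc_integrable_tf.
Qed.

(* Test against [psi = lint unitI v phi], whose derivative along [v] is
   [phi - phi (_ - v)]. *)
Lemma weak_gradient_line F (g : 'I_n -> E -> R) : weak_gradient F g -> line_identity F g.
Proof.
move=> [lF lg Fg] v; have [->|v0] := eqVneq v 0.
  apply: aeW => x; rewrite addr0 subrr; apply/esym.
  rewrite (eq_Rintegral _ (g := cst 0)) ?Rintegral_cst ?mul0r// => s _.
  by rewrite big1 ?mulr0// => j _; rewrite mxE mul0r.
have Nv0 : - v != 0 by rewrite oppr_eq0.
pose G (x : E) := \sum_j v ord0 j * g j x.
have lG : loc_integrable G by apply: loc_integrable_sum => j; exact: loc_integrableZ.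
pose kap (p : E * R) := unitI p.2.
have mkap : measurable_fun setT kap.
  exact: (measurableT_comp measurable_unitI measurable_snd).
have kap1 p : `|kap p| <= 1 by exact: unitI_le1.
have ksupp (M : R) : exists L : R, forall (x : E) (r : R), `|x| <= M -> L < `|r| ->
    kap (x - r *: - v, r) = 0.
  by exists 1 => x r _ r1; exact: unitI_supp.
have KG x : Kadj (- v) kap G x =
    \int[mu1]_s (unitI s * \sum_j v ord0 j * g j (x + s *: v)).
  by apply: eq_Rintegral => s _; rewrite /kap /= scalerN opprK.
have lK : loc_integrable (Kadj (- v) kap G) by exact: (loc_integrable_Kadj mkap kap1 ksupp).
have lFv := loc_integrable_shift v lF.
have := @fundamental_lemma _ _ (fun x => (F (x + v) + -1 * F x) + -1 * Kadj (- v) kap G x).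
case.
- by apply: loc_integrableD; [apply: loc_integrableD => //|]; exact: loc_integrableZ.
- move=> phi tphi.
  have tphiv : tf (fun x => phi (x - v)) by exact: tf_shift.
  pose psi := lint unitI v phi.
  have tpsi : tf psi.
    split; first by move=> k; apply: Mk_lint => //; [exact: measurable_unitI|exact: unitI_le1].
    have [M M0 hM] := tf_bs tphi; exists (M + `|v|) => x xM.
    rewrite /psi /lint (eq_Rintegral _ (g := cst 0)) ?Rintegral_cst ?mul0r// => s _.
    have [s1|s1] := ltP 1 `|s|; first by rewrite unitI_supp ?mul0r.
    rewrite hM ?mulr0//.
    have : `|s *: v| <= `|v| by rewrite normrZ -[leRHS]mul1r ler_wpM2r.
    have := ler_normD (x - s *: v) (s *: v); rewrite subrK; lra.
  have psiK x : psi x = Kop (- v) kap phi x.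
    by apply: eq_Rintegral => s _; rewrite /kap /= scalerN.
  have dpsi x : dird v psi x = phi x - phi (x - v).
    rewrite dird_lint//; [|exact: measurable_unitI|exact: unitI_le1].
    have := @lint_dird_itv R n v phi x 0 1 tphi ltr01.
    by rewrite scale0r subr0 scale1r.
  have e1 : \int[leb]_x (F x * dird v psi x) = - \int[leb]_x (G x * psi x).
    exact: (weak_gradient_dird v (And3 lF lg Fg)).
  have e2 : \int[leb]_x (G x * psi x) = \int[leb]_x (Kadj (- v) kap G x * phi x).
    under eq_Rintegral do rewrite psiK.
    exact: (adjointP Nv0 mkap kap1 ksupp lG (tf_continuous tphi) tphi.2).
  have e3 : \int[leb]_x (F x * dird v psi x) =
      \int[leb]_x (F x * phi x) - \int[leb]_x (F (x + v) * phi x).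
    transitivity (\int[leb]_x (F x * phi x) - \int[leb]_x (F x * phi (x - v))).
      rewrite -RintegralB//; try exact: loc_integrable_tf.
      by apply: eq_Rintegral => x _; rewrite dpsi; ring.
    congr (_ - _).
    rewrite -(integral_shift v (f := fun x => F x * phi (x - v))).
      by apply: eq_Rintegral => x _; rewrite addrK.
    have [/measurable_EFinP mm _] := integrableP _ _ _ (loc_integrable_tf lF tphiv).
    exact: mm.
  have i1 := loc_integrable_tf lFv tphi.
  have i2 := loc_integrable_tf lF tphi.
  have i3 := loc_integrable_tf lK tphi.
  transitivity (\int[leb]_x (F (x + v) * phi x) - \int[leb]_x (F x * phi x) -
      \int[leb]_x (Kadj (- v) kap G x * phi x)).
    rewrite -RintegralB// -RintegralB//; last first.
      by rewrite /comp; under eq_fun do rewrite EFinB; exact: integrableB.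
    by apply: eq_Rintegral => x _; ring.
  by move: e1; rewrite e3 e2; lra.
- move=> A [mA A0 sA]; exists A; split => // x /= h; apply: sA => /= h'; apply: h.
  by rewrite -KG; lra.
Qed.

End representation.

(** * Poincare inequality *)

Lemma le_integralT d (T : measurableType d) (R : realType)
  (mu : {measure set T -> \bar R}) (f g : T -> R) :
  measurable_fun setT f -> measurable_fun setT g ->
  (forall x, 0 <= f x <= g x) -> (\int[mu]_x (f x)%:E <= \int[mu]_x (g x)%:E)%E.
Proof.
move=> mf mg fg; apply: ge0_le_integral => //.
- by move=> x _; rewrite lee_fin; case/andP: (fg x).
- exact/measurable_EFinP.
- exact/measurable_EFinP.
- by move=> x _; rewrite lee_fin; case/andP: (fg x).
Qed.

Section poincare.
Context (R : realType) (n : nat).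
Local Notation E := 'rV[R]_n.
Local Notation leb := (@lebesgue_rV R n).
Local Notation mu1 := (@lebesgue_measure R).
Implicit Types (F h m : E -> R) (A B : set E).

(* [m] is an upper gradient of [F] along almost every translate of a segment. *)
Definition line_bound F m : Prop :=
  forall v, {ae leb, forall x, (`|F (x + v) - F x|%:E <=
    `|v|%:E * \int[mu1]_s (unitI s * m (x + s *: v))%:E)%E}.

Lemma line_identity_bound F (g : 'I_n -> E -> R) :
  (forall j, measurable_fun setT (g j)) -> line_identity F g ->
  line_bound F (fun x => \sum_j `|g j x|).
Proof.
move=> mg Fg v; move: (Fg v); apply: filterS => x ->.
have mxs : measurable_fun setT (fun p : E * R => p.1 + p.2 *: v).
  apply: measurable_rVD; first exact: measurable_fst.
  by apply: measurable_rVZ; [exact: measurable_snd|].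
have mu : measurable_fun setT (fun p : E * R => unitI p.2).
  exact: (measurableT_comp (@measurable_unitI R) measurable_snd).
have mG : measurable_fun setT
    (fun p : E * R => unitI p.2 * \sum_j v ord0 j * g j (p.1 + p.2 *: v)).
  apply: measurable_funM => //; apply: measurable_sum => j.
  by apply: measurable_funM => //; exact: (measurableT_comp (mg j) mxs).
have mA : measurable_fun setT
    (fun p : E * R => unitI p.2 * \sum_j `|g j (p.1 + p.2 *: v)|).
  apply: measurable_funM => //; apply: measurable_sum => j.
  by apply: (measurableT_comp (@normr_measurable R setT)); exact: (measurableT_comp (mg j) mxs).
apply: le_trans (le_abs_Rint_line (f := fun x s => unitI s *
  \sum_j v ord0 j * g j (x + s *: v)) x mG) _.
have mx1 : measurable_fun setT (fun s : R => unitI s * \sum_j `|g j (x + s *: v)|).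
  exact: (measurableT_comp mA (@pair1_measurable _ _ E (measurableTypeR R) x)).
rewrite -ge0_integralZl//; first last.
- by move=> s _; rewrite lee_fin mulr_ge0 ?unitI_ge0// sumr_ge0.
- exact/measurable_EFinP.
apply: ge0_le_integral => //.
- apply/measurable_EFinP; apply: measurableT_comp => //.
  exact: (measurableT_comp mG (@pair1_measurable _ _ E (measurableTypeR R) x)).
- by apply/measurable_EFinP; apply: measurable_funM.
- move=> s _; rewrite -EFinM lee_fin normrM ger0_norm ?unitI_ge0// mulrCA.
  rewrite ler_wpM2l ?unitI_ge0// mulr_sumr (le_trans (ler_norm_sum _ _ _))//.
  by apply: ler_sum => j _; rewrite normrM ler_wpM2r// coord_le_norm.
Qed.

(** Free of averages, hence easy to split, translate and mollify; [mean_osc_double] leads back to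
    the mean oscillation. *)
Definition double_osc A h : \bar R :=
  (\int[leb]_x \int[leb]_y (\1_A x * \1_A y * `|h y - h x|)%:E)%E.

Definition convex_rV B : Prop := forall (x y : E) (s : R),
  B x -> B y -> 0 <= s <= 1 -> B (x + s *: (y - x)).

Lemma integral_indicE A : measurable A -> (\int[leb]_x (\1_A x : R)%:E = leb A)%E.
Proof. by move=> mA; rewrite integral_indic// setIT. Qed.

(** For fixed [x] the map from [v] to [x + c *: v] is a translated dilation, so the two integrals
    decouple. *)
Lemma integral_shear B m (c : R) : measurable B -> measurable_fun setT m ->
  (forall x, 0 <= m x) -> c != 0 ->
  (\int[leb]_x \int[leb]_v (\1_B x * m (x + c *: v))%:E =
   leb B * ((`|c| ^- n)%:E * \int[leb]_x (m x)%:E))%E.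
Proof.
move=> mB mm m0 c0.
have im0 : (0 <= \int[leb]_x (m x)%:E)%E by apply: integral_ge0 => x _; rewrite lee_fin.
have c0' : (0 <= (`|c| ^- n)%:E :> \bar R)%E by rewrite lee_fin invr_ge0 exprn_ge0.
transitivity (\int[leb]_x ((\1_B x : R)%:E *
    ((`|c| ^- n)%:E * \int[leb]_x (m x)%:E)))%E.
  apply: eq_integral => x _; rewrite -(ge0_integral_affine x c0 (f := fun y => (m y)%:E))//;
    last exact/measurable_EFinP.
  rewrite -ge0_integralZl//; first last.
  - by move=> v _; rewrite lee_fin.
  - apply/measurable_EFinP; apply: measurableT_comp => //.
    by apply: measurable_rVD => //; exact: measurable_rVZ.
rewrite ge0_integralZr//.
- by rewrite integral_indicE.
- exact/measurable_EFinP/measurable_indic.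
- exact: mule_ge0.
Qed.

(* One of the substitutions [x + s *: v] (for [1 / 2 <= s]) and [x + (s - 1) *: v] has
   Jacobian at most [2 ^+ n]. *)
Lemma poincare_slice B m (s : R) : measurable B -> measurable_fun setT m ->
  (forall x, 0 <= m x) -> 0 <= s <= 1 ->
  (\int[leb]_v \int[leb]_x (\1_B x * \1_B (x + v) * m (x + s *: v))%:E <=
   (2 ^+ n)%:E * (leb B * \int[leb]_x (m x)%:E))%E.
Proof.
move=> mB mm m0 /andP[s0 s1].
have B0 x : 0 <= (\1_B x : R) <= 1.
  by rewrite indicE; case: (_ \in _); rewrite ?lexx ?ler01.
have im0 : (0 <= \int[leb]_x (m x)%:E)%E by apply: integral_ge0 => x _; rewrite lee_fin.
have main (c : R) : 2^-1 <= `|c| ->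
    (\int[leb]_v \int[leb]_x (\1_B x * m (x + c *: v))%:E <=
      (2 ^+ n)%:E * (leb B * \int[leb]_x (m x)%:E))%E.
  move=> c2; have c0 : 0 < `|c| by rewrite (lt_le_trans _ c2)// invr_gt0.
  rewrite (tonelli_rV (f := fun v x => \1_B x * m (x + c *: v))); first last.
  - by move=> v x; rewrite mulr_ge0.
  - apply: measurable_funM; first exact: (measurableT_comp (measurable_indic mB) measurable_snd).
    apply: (measurableT_comp mm); apply: measurable_rVD; first exact: measurable_snd.
    by apply: measurable_rVZ => //; exact: measurable_fst.
  rewrite integral_shear -?normr_gt0// muleCA lee_wpmul2r ?mule_ge0//.
  rewrite lee_fin -exprVn lerXn2r ?nnegrE ?invr_ge0//.
  by rewrite -[leRHS]invrK lef_pV2 ?posrE ?invr_gt0.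
have mJ d (T : measurableType d) (f : T -> E) : measurable_fun setT f ->
    measurable_fun setT (fun t => \1_B (f t) : R).
  exact: measurableT_comp (measurable_indic mB).
have mK : measurable_fun setT (fun p : E * E => \1_B p.2 * \1_B (p.2 + p.1) * m (p.2 + s *: p.1)).
  apply: measurable_funM; last first.
    apply: (measurableT_comp mm); apply: measurable_rVD; first exact: measurable_snd.
    by apply: measurable_rVZ => //; exact: measurable_fst.
  apply: measurable_funM; apply: mJ; first exact: measurable_snd.
  by apply: measurable_rVD; [exact: measurable_snd|exact: measurable_fst].
have [s2|s2] := leP 2^-1 s.
  apply: le_trans (main s _); last by rewrite ger0_norm.
  apply: (le_integral_rV (f := fun v x => \1_B x * \1_B (x + v) * m (x + s *: v))
    (g := fun v x => \1_B x * m (x + s *: v))) => //.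
    apply: measurable_funM; first by apply: mJ; exact: measurable_snd.
    apply: (measurableT_comp mm); apply: measurable_rVD; first exact: measurable_snd.
    by apply: measurable_rVZ => //; exact: measurable_fst.
  move=> v x; have /andP[a0 a1] := B0 x; have /andP[b0 b1] := B0 (x + v).
  by rewrite !mulr_ge0//= ler_wpM2r// ler_piMr.
(* For [s < 1 / 2] the indicator at [x + v] is kept instead of the one at [x]; moving [x] by [- v]
   gives the coefficient [s - 1], of modulus above [1 / 2]. *)
apply: le_trans (main (s - 1) _); last first.
  by rewrite ler0_norm; lra.
apply: (@le_trans _ _ (\int[leb]_v \int[leb]_x (\1_B (x + v) * m (x + s *: v))%:E)%E).
  apply: (le_integral_rV (f := fun v x => \1_B x * \1_B (x + v) * m (x + s *: v))
    (g := fun v x => \1_B (x + v) * m (x + s *: v))) => //.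
    apply: measurable_funM.
      by apply: mJ; apply: measurable_rVD; [exact: measurable_snd|exact: measurable_fst].
    apply: (measurableT_comp mm); apply: measurable_rVD; first exact: measurable_snd.
    by apply: measurable_rVZ => //; exact: measurable_fst.
  move=> v x; have /andP[a0 a1] := B0 x; have /andP[b0 b1] := B0 (x + v).
  by rewrite !mulr_ge0//= ler_wpM2r// ler_piMl.
rewrite le_eqVlt; apply/orP; left; apply/eqP; apply: eq_integral => v _.
rewrite -(ge0_integral_shift v (f := fun x => (\1_B x * m (x + (s - 1) *: v))%:E)).
- apply: eq_integral => x _; congr (_ * m _)%:E.
  by apply/rowP => i; rewrite !mxE; ring.
- apply/measurable_EFinP; apply: measurable_funM; first exact: measurable_indic.
  by apply: (measurableT_comp mm); exact: measurable_rVD.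
- by move=> x; rewrite lee_fin mulr_ge0//; case/andP: (B0 x).
Qed.

Lemma integral_unitI : (\int[mu1]_s (unitI s)%:E = 1)%E.
Proof.
rewrite /unitI integral_indic// setIT [LHS](lebesgue_measure_itv `[0, 1])/= lte_fin ltr01.
by rewrite oppr0 adde0.
Qed.

Lemma double_osc_poincare F m B (D : R) : measurable B -> convex_rV B ->
  (forall x y, B x -> B y -> `|y - x| <= D) ->
  measurable_fun setT F -> measurable_fun setT m -> (forall x, 0 <= m x) ->
  line_bound F m ->
  (double_osc B F <= D%:E * ((2 ^+ n)%:E * (leb B * \int[leb]_x (\1_B x * m x)%:E)))%E.
Proof.
move=> mB cB BD mF mm m0 FB.
have [B_eq0|/set0P[b Bb]] := eqVneq B set0.
  rewrite /double_osc B_eq0 measure0 mul0e !mule0.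
  under eq_integral do under eq_integral do rewrite indic0 /= !mul0r.
  by under eq_integral do rewrite integral0; rewrite integral0.
have D0 : 0 <= D by exact: le_trans (BD b b Bb Bb).
(* By convexity the segment from [x] to [x + v] stays in [B] when its ends do, so [m] may be cut off
   to [B]. This keeps the final integral local. *)
pose M (x : E) : R := \1_B x * m x.
have J0 x : 0 <= (\1_B x : R) by rewrite indicE.
have M0 x : 0 <= M x by rewrite mulr_ge0.
have mJ : measurable_fun setT (\1_B : E -> R) by exact: measurable_indic.
have mM : measurable_fun setT M by exact: measurable_funM.
have mJf d (T : measurableType d) (f : T -> E) : measurable_fun setT f ->
    measurable_fun setT (fun t => \1_B (f t) : R).
  exact: measurableT_comp.
have mD : measurable_fun setT (fun p : E * E => p.2 + p.1).
  by apply: measurable_rVD; [exact: measurable_snd|exact: measurable_fst].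
have mfs (p : E * E -> E) : measurable_fun setT p -> measurable_fun setT (F \o p).
  exact: measurableT_comp.
pose G (v x : E) (s : R) : R := \1_B x * \1_B (x + v) * M (x + s *: v).
pose K (v x : E) (s : R) : R := unitI s * (D * G v x s).
have G0 v x s : 0 <= G v x s by rewrite !mulr_ge0.
have K0 v x s : 0 <= K v x s by rewrite mulr_ge0 ?unitI_ge0// mulr_ge0.
have mG3 : measurable_fun setT (fun p : E * R * E => G p.1.1 p.2 p.1.2).
  have m1 : measurable_fun setT (fun p : E * R * E => p.1.1).
    exact: measurableT_comp measurable_fst measurable_fst.
  have m2 : measurable_fun setT (fun p : E * R * E => p.1.2).
    exact: measurableT_comp measurable_snd measurable_fst.
  have m3 : measurable_fun setT (fun p : E * R * E => p.2) by exact: measurable_snd.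
  apply: measurable_funM.
    by apply: measurable_funM; apply: mJf => //; exact: measurable_rVD.
  by apply: (measurableT_comp mM); apply: measurable_rVD => //; exact: measurable_rVZ.
have mK3 : measurable_fun setT (fun p : E * R * E => K p.1.1 p.2 p.1.2).
  apply: measurable_funM; last exact: measurable_funM.
  apply: (measurableT_comp (@measurable_unitI R)).
  exact: measurableT_comp measurable_snd measurable_fst.
have mKv v : measurable_fun setT (fun p : E * R => K v p.1 p.2).
  have mq : measurable_fun setT (fun p : E * R => ((v, p.2), p.1) : E * R * E).
    apply/measurable_fun_pairP; split; last exact: measurable_fst.
    apply/measurable_fun_pairP; split; first exact: measurable_cst.
    exact: measurable_snd.
  exact: (measurableT_comp mK3 mq).
have mGs s : measurable_fun setT (fun p : E * E => G p.1 p.2 s).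
  have mq : measurable_fun setT (fun p : E * E => ((p.1, s), p.2) : E * R * E).
    apply/measurable_fun_pairP; split; last exact: measurable_snd.
    apply/measurable_fun_pairP; split; last exact: measurable_cst.
    exact: measurable_fst.
  exact: (measurableT_comp mG3 mq).
have mKx v x : measurable_fun setT (fun s : R => K v x s).
  exact: (measurableT_comp (mKv v) (@pair1_measurable _ _ E (measurableTypeR R) x)).
have mV d (T : measurableType d) (p q : T -> E) : measurable_fun setT p ->
    measurable_fun setT q ->
    measurable_fun setT (fun t => \1_B (p t) * \1_B (p t + q t) * `|F (p t + q t) - F (p t)|).
  move=> mp mq; have mpq := measurable_rVD mp mq.
  apply: measurable_funM; first by apply: measurable_funM; exact: mJf.
  apply: measurableT_comp => //; apply: measurable_funB; first exact: (measurableT_comp mF mpq).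
  exact: (measurableT_comp mF mp).
have -> : double_osc B F = (\int[leb]_v \int[leb]_x
    (\1_B x * \1_B (x + v) * `|F (x + v) - F x|)%:E)%E.
  rewrite -(tonelli_rV (f := fun x v => \1_B x * \1_B (x + v) * `|F (x + v) - F x|)); first last.
  - by move=> x v; rewrite !mulr_ge0.
  - by apply: mV; [exact: measurable_fst|exact: measurable_snd].
  apply: eq_integral => x _.
  rewrite -(ge0_integral_shift x (f := fun y => (\1_B x * \1_B y * `|F y - F x|)%:E)).
  - by apply: eq_integral => v _; rewrite [v + x]addrC.
  - apply/measurable_EFinP; apply: measurable_funM; first exact: measurable_funM.
    by apply: measurableT_comp => //; exact: measurable_funB.
  - by move=> y; rewrite lee_fin !mulr_ge0.
have KE v : (\int[leb]_x \int[mu1]_s (K v x s)%:E = \int[mu1]_s \int[leb]_x (K v x s)%:E)%E.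
  by apply: tonelli_line => //; exact: mKv.
have mKE : measurable_fun setT (fun p : E * R => (\int[leb]_x (K p.1 x p.2)%:E)%E).
  exact: (measurable_int_rV (f := fun (p : E * R) x => K p.1 x p.2)).
have KE0 (p : E * R) : (0 <= \int[leb]_x (K p.1 x p.2)%:E)%E.
  by apply: integral_ge0 => x _; rewrite lee_fin.
(* The variable [v] is outermost, since [line_bound] discards a null set of [x] for each [v]. *)
apply: (@le_trans _ _ (\int[leb]_v \int[mu1]_s \int[leb]_x (K v x s)%:E)%E).
  apply: ge0_le_integral => //.
  - by move=> v _; apply: integral_ge0 => x _; rewrite lee_fin !mulr_ge0.
  - apply: (measurable_int_rV (f := fun v x => \1_B x * \1_B (x + v) * `|F (x + v) - F x|)).
      by apply: mV; [exact: measurable_snd|exact: measurable_fst].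
    by move=> x v; rewrite !mulr_ge0.
  - exact: (@measurable_fun_fubini_tonelli_F _ _ E (measurableTypeR R) R mu1
      (fun p : E * R => (\int[leb]_x (K p.1 x p.2)%:E)%E)).
  move=> v _; rewrite -KE; apply: ae_ge0_le_integral => //.
  - by apply/measurable_EFinP; apply: mV.
  - by move=> x _; apply: integral_ge0 => s _; rewrite lee_fin.
  - by apply: (measurable_int_line (f := K v)).
  move: (FB v); apply: filterS => x hx _.
  have [Bx|nBx] := pselect (B x); last first.
    rewrite indicE memNset// !mul0r; apply: integral_ge0 => s _.
    by rewrite lee_fin.
  have [By|nBy] := pselect (B (x + v)); last first.
    rewrite [\1_B (x + v)]indicE memNset// mulr0 mul0r; apply: integral_ge0 => s _.
    by rewrite lee_fin.
  rewrite !indicE !mem_set// !mul1r; apply: le_trans hx _.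
  have vD : `|v| <= D by have := BD _ _ Bx By; rewrite addrAC subrr add0r.
  rewrite -ge0_integralZl//; first last.
  - by move=> s _; rewrite lee_fin mulr_ge0// unitI_ge0.
  - apply/measurable_EFinP; apply: measurable_funM; first exact: measurable_unitI.
    by apply: (measurableT_comp mm); apply: measurable_rVD => //; exact: measurable_rVZ.
  apply: le_integralT => //.
  - apply: measurable_funM => //; apply: measurable_funM; first exact: measurable_unitI.
    by apply: (measurableT_comp mm); apply: measurable_rVD => //; exact: measurable_rVZ.
  - exact: mKx.
  move=> s; rewrite !mulr_ge0 ?unitI_ge0//= mulrCA /K.
  have [s01|s01] := boolP (s \in `[0, 1]); last first.
    by rewrite /unitI indicE memNset ?mul0r//; exact/negP.
  rewrite ler_wpM2l ?unitI_ge0//; apply: ler_pM => //.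
  have Bs : B (x + s *: v).
    have := cB _ _ s Bx By; rewrite addrAC subrr add0r; apply.
    by move: s01; rewrite in_itv.
  by rewrite /G /M !indicE !mem_set// !mul1r.
rewrite (@fubini_tonelli _ _ E (measurableTypeR R) R (@lebs R n) mu1
  (fun p : E * R => (\int[leb]_x (K p.1 x p.2)%:E)%E) mKE KE0).
have mUI : measurable_fun [set: measurableTypeR R] (fun s : measurableTypeR R => (unitI s)%:E).
  apply: (@measurableT_comp _ _ _ _ _ _ EFin) => //; exact: measurable_unitI.
set C := (D%:E * _)%E.
have C0 : (0 <= C)%E.
  rewrite !mule_ge0// ?lee_fin ?exprn_ge0//.
  by apply: integral_ge0 => x _; rewrite lee_fin M0.
apply: (@le_trans _ _ (\int[mu1]_s ((unitI s)%:E * C))%E).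
  apply: ge0_le_integral => //.
  - by move=> s _; apply: integral_ge0 => v _; exact: (KE0 (v, s)).
  - exact: (@measurable_fun_fubini_tonelli_G _ _ E (measurableTypeR R) R (@lebs R n)
      (fun p : E * R => (\int[leb]_x (K p.1 x p.2)%:E)%E)).
  - apply: emeasurable_funM; last exact: measurable_cst.
    exact: mUI.
  move=> s _; have [s01|s01] := boolP (s \in `[0, 1]); last first.
    have us : unitI s = 0 by rewrite /unitI indicE memNset//; exact/negP.
    have Kz v x : K v x s = 0 by rewrite /K us mul0r.
    rewrite us mul0e (eq_integral (cst 0%E)) ?integral0// => v _.
    by rewrite (eq_integral (cst 0%E)) ?integral0// => x _; rewrite /= Kz.
  have us : unitI s = 1 by rewrite /unitI indicE mem_set.
  have K1 v x : K v x s = D * G v x s by rewrite /K us mul1r.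
  rewrite us mul1e; under eq_integral do under eq_integral do rewrite /= K1 EFinM.
  have mGv v : measurable_fun setT (fun x => (G v x s)%:E).
    by apply/measurable_EFinP; exact: (measurableT_comp (mGs s) (@pair1_measurable _ _ E E v)).
  rewrite (eq_integral (fun v => D%:E * \int[leb]_x (G v x s)%:E)%E); last first.
    by move=> v _; rewrite ge0_integralZl// => x _; rewrite lee_fin.
  rewrite ge0_integralZl//; first last.
  - by move=> v _; apply: integral_ge0 => x _; rewrite lee_fin.
  - exact: (measurable_int_rV (f := fun v x => G v x s)).
  rewrite /C; apply: lee_wpmul2l; first by rewrite lee_fin.
  by apply: (@poincare_slice B M s) => //; move: s01; rewrite in_itv.
rewrite ge0_integralZr//.
- by rewrite integral_unitI mul1e.
- by move=> s _; rewrite lee_fin unitI_ge0.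
Qed.

End poincare.

(** * Double oscillation and mean oscillation *)

Section oscillation.
Context (R : realType) (n : nat).
Local Notation E := 'rV[R]_n.
Local Notation leb := (@lebesgue_rV R n).
Implicit Types (F h m : E -> R) (A B : set E).

Lemma integral_indicM A h :
  (\int[leb]_(x in A) (h x)%:E = \int[leb]_x (\1_A x * h x)%:E)%E.
Proof.
rewrite integral_mkcond; apply: eq_integral => x _.
by rewrite patchE indicE; case: ifP; rewrite ?mul1r ?mul0r.
Qed.

Lemma Rintegral_indicM A h :
  \int[leb]_(x in A) h x = \int[leb]_x (\1_A x * h x).
Proof. by rewrite /Rintegral integral_indicM. Qed.

Lemma measurable_double_osc A h : measurable A -> measurable_fun setT h ->
  measurable_fun setT (fun p : E * E => \1_A p.1 * \1_A p.2 * `|h p.2 - h p.1|).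
Proof.
move=> mA mh; apply: measurable_funM.
  by apply: measurable_funM; [exact: (measurableT_comp (measurable_indic mA) measurable_fst)|
    exact: (measurableT_comp (measurable_indic mA) measurable_snd)].
apply: measurableT_comp => //; apply: measurable_funB.
  exact: (measurableT_comp mh measurable_snd).
exact: (measurableT_comp mh measurable_fst).
Qed.

Lemma integral_rV2D (f g : E -> E -> R) :
  measurable_fun setT (fun p : E * E => f p.1 p.2) ->
  measurable_fun setT (fun p : E * E => g p.1 p.2) ->
  (forall x y, 0 <= f x y) -> (forall x y, 0 <= g x y) ->
  (\int[leb]_x \int[leb]_y (f x y + g x y)%:E =
   \int[leb]_x \int[leb]_y (f x y)%:E + \int[leb]_x \int[leb]_y (g x y)%:E)%E.
Proof.
move=> mf mg f0 g0; rewrite -ge0_integralD//; first last.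
- exact: measurable_int_rV.
- by move=> x _; apply: integral_ge0 => y _; rewrite lee_fin.
- exact: measurable_int_rV.
- by move=> x _; apply: integral_ge0 => y _; rewrite lee_fin.
apply: eq_integral => x _; rewrite -ge0_integralD//.
- by move=> y _; rewrite lee_fin.
- by apply/measurable_EFinP; exact: (measurableT_comp mf (@pair1_measurable _ _ E E x)).
- by move=> y _; rewrite lee_fin.
- by apply/measurable_EFinP; exact: (measurableT_comp mg (@pair1_measurable _ _ E E x)).
Qed.

Lemma le_double_oscD A F h : measurable A -> measurable_fun setT F -> measurable_fun setT h ->
  (double_osc A (fun x => F x + h x)%R <= double_osc A F + double_osc A h)%E.
Proof.
move=> mA mF mh.
have f0 (f : E -> R) x y : 0 <= \1_A x * \1_A y * `|f y - f x| by rewrite !mulr_ge0.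
have mf := measurable_double_osc mA mF; have mg := measurable_double_osc mA mh.
rewrite /double_osc -(integral_rV2D mf mg (f0 F) (f0 h)).
apply: (le_integral_rV (f := fun x y => \1_A x * \1_A y * `|F y + h y - (F x + h x)|)
  (g := fun x y => \1_A x * \1_A y * `|F y - F x| + \1_A x * \1_A y * `|h y - h x|)).
- by apply: (@measurable_double_osc A (fun x => F x + h x)) => //; exact: measurable_funD.
- exact: measurable_funD.
- move=> x y; rewrite !mulr_ge0//= -mulrDr ler_wpM2l ?mulr_ge0//.
  by rewrite opprD addrACA ler_normD.
Qed.

Lemma double_oscN A h : double_osc A (fun x => - h x) = double_osc A h.
Proof.
rewrite /double_osc; apply: eq_integral => x _; apply: eq_integral => y _.
by rewrite -opprD normrN.
Qed.

Lemma double_osc_le_norm A h : measurable A -> measurable_fun setT h ->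
  (double_osc A h <= (2 : R)%:E * (leb A * \int[leb]_x (\1_A x * `|h x|)%:E))%E.
Proof.
move=> mA mh.
have mJ : measurable_fun setT (\1_A : E -> R) by exact: measurable_indic.
pose f x y : R := \1_A x * (\1_A y * `|h y|).
have f0 x y : 0 <= f x y by rewrite !mulr_ge0.
have mJh : measurable_fun setT (fun y => \1_A y * `|h y|).
  by apply: measurable_funM => //; exact: measurableT_comp.
have mf : measurable_fun setT (fun p : E * E => f p.1 p.2).
  apply: measurable_funM; first exact: (measurableT_comp mJ measurable_fst).
  exact: (measurableT_comp mJh measurable_snd).
have mf' : measurable_fun setT (fun p : E * E => f p.2 p.1).
  exact: (measurableT_comp mf (@measurable_swap _ _ E E)).
have fE : (\int[leb]_x \int[leb]_y (f x y)%:E = leb A * \int[leb]_x (\1_A x * `|h x|)%:E)%E.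
  rewrite -integral_indicE// -ge0_integralZr//; first last.
  - by apply: integral_ge0 => x _; rewrite lee_fin mulr_ge0.
  - exact/measurable_EFinP.
  apply: eq_integral => x _; rewrite -ge0_integralZl//.
  exact/measurable_EFinP.
have f0' x y : 0 <= f y x by [].
apply: (@le_trans _ _ (\int[leb]_x \int[leb]_y (f x y + f y x)%:E)%E).
  apply: (le_integral_rV (f := fun x y => \1_A x * \1_A y * `|h y - h x|)
     (g := fun x y => f x y + f y x)).
  - exact: measurable_double_osc.
  - exact: measurable_funD.
  - move=> x y; rewrite !mulr_ge0//= /f !mulrA [\1_A y * _]mulrC -mulrDr.
    by rewrite ler_wpM2l ?mulr_ge0// ler_normB.
rewrite (integral_rV2D mf mf' f0 f0').
rewrite [X in (_ + X)%E](tonelli_rV (f := fun x y => f y x))//.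
by rewrite fE -mule2n -mule_natl.
Qed.

Lemma integrable_indicM A h (M : R) : measurable A -> 0 <= M -> A `<=` cbox M ->
  loc_integrable h -> leb.-integrable setT (fun x => (\1_A x * h x)%:E).
Proof.
move=> mA M0 AM lh; under eq_fun do rewrite mulrC.
apply: (@loc_integrable_mul R n _ \1_A 1 M lh (measurable_indic mA)).
  by move=> x; rewrite indicE; case: (_ \in _); rewrite ?normr1 ?normr0.
move=> x xM; rewrite indicE memNset// => /AM; rewrite cboxE//= => xM'.
by move: xM; rewrite ltNge xM'.
Qed.

Lemma leb_cbox_fin A (M : R) : measurable A -> 0 <= M -> A `<=` cbox M -> (leb A < +oo)%E.
Proof.
move=> mA M0 AM; apply: (@le_lt_trans _ _ (leb (cbox M))); last by rewrite leb_cbox// ltry.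
by rewrite le_measure ?inE.
Qed.

(** The difference [h x - avg A h] is the average of [h x - h y] over [y] in [A]. *)
Lemma mean_osc_double A h (M : R) : measurable A -> 0 <= M -> A `<=` cbox M ->
  (0 < leb A)%E -> loc_integrable h ->
  ((mean_osc A h)%:E <= ((fine (leb A)) ^- 2)%:E * double_osc A h)%E.
Proof.
move=> mA M0 AM A0 lh; have mh := loc_measurable lh.
have Afin := leb_cbox_fin mA M0 AM.
set a := fine (leb A).
have aE : leb A = a%:E by rewrite /a fineK// ge0_fin_numE.
have a0 : 0 < a by rewrite -lte_fin -aE.
have ai0 : 0 <= a^-1 by rewrite invr_ge0 ltW.
have mJ : measurable_fun setT (\1_A : E -> R) by exact: measurable_indic.
have iA := integrable_indicM mA M0 AM lh.
have i1 : leb.-integrable setT (fun x => (\1_A x)%:E : \bar R).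
  have := integrable_indicM mA M0 AM (loc_integrable_cst n (1 : R)).
  by under eq_fun do rewrite mulr1.
have ic (c : R) : leb.-integrable setT (fun x => (\1_A x * (h x - c))%:E).
  exact: (integrable_indicM mA M0 AM (loc_integrableD lh (loc_integrable_cst n (- c)))).
have key x : (`|h x - avg A h|%:E <=
    (a^-1)%:E * \int[leb]_y (\1_A y * `|h y - h x|)%:E)%E.
  have -> : h x - avg A h = - (a^-1 * \int[leb]_y (\1_A y * (h y - h x))).
    have -> : \int[leb]_y (\1_A y * (h y - h x)) =
       \int[leb]_y (\1_A y * h y) - h x * a.
      have -> : h x * a = \int[leb]_y (h x * \1_A y).
        by rewrite RintegralZl// /Rintegral integral_indicE.
      rewrite -RintegralB//.
      - by apply: eq_Rintegral => y _; rewrite mulrBr [h x * _]mulrC.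
      - by rewrite /comp; under eq_fun do rewrite EFinM; exact: integrableZl.
    rewrite /avg -/a Rintegral_indicM.
    by rewrite mulrBr [a^-1 * (h x * a)]mulrCA mulVf ?gt_eqF// mulr1 opprB.
  rewrite normrN normrM (ger0_norm ai0) EFinM.
  rewrite lee_wpmul2l ?lee_fin// EFin_normr_Rintegral//; last exact: ic.
  apply: le_trans (le_abse_integral _ _ _) _ => //.
    by have /integrableP[] := ic (h x).
  rewrite le_eqVlt; apply/orP; left; apply/eqP; apply: eq_integral => y _.
  by rewrite /= normrM ger0_norm.
rewrite /mean_osc /avg -/a Rintegral_indicM EFinM.
have -> : (\int[leb]_x (\1_A x * `|h x - a^-1 * \int[leb]_(x0 in A) h x0|))%:E =
    (\int[leb]_x (\1_A x * `|h x - avg A h|)%:E)%E.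
  rewrite /Rintegral fineK//; apply: (integrable_fin_num measurableT).
  have := ic (avg A h) => /integrable_abse; apply: eq_integrable => // x _ /=.
  by rewrite normrM ger0_norm.
rewrite expr2 invfM EFinM -muleA lee_wpmul2l ?lee_fin//.
rewrite /double_osc -ge0_integralZl//; first last.
- by move=> x _; apply: integral_ge0 => y _; rewrite lee_fin !mulr_ge0.
- apply: (measurable_int_rV (f := fun x y => \1_A x * \1_A y * `|h y - h x|)).
    exact: measurable_double_osc.
  by move=> x y; rewrite !mulr_ge0.
have mhx x : measurable_fun setT (fun y => (\1_A y * `|h y - h x|)%:E).
  apply/measurable_EFinP/measurable_funM => //; apply: measurableT_comp => //.
  exact: measurable_funB.
apply: ge0_le_integral => //.
- apply/measurable_EFinP/measurable_funM => //; apply: measurableT_comp => //.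
  exact: measurable_funB.
- apply: emeasurable_funM => //.
  apply: (measurable_int_rV (f := fun x y => \1_A x * \1_A y * `|h y - h x|)).
    exact: measurable_double_osc.
  by move=> x y; rewrite !mulr_ge0.
move=> x _; under [in leRHS]eq_integral do rewrite -mulrA EFinM.
rewrite ge0_integralZl//.
by rewrite EFinM muleCA lee_wpmul2l// ?lee_fin.
Qed.

(* Splitting [m] at height [J / l]: this is Hoelder's inequality up to the factor 2. *)
Lemma power_mean A m (J l : R) : (0 < n)%N -> measurable A ->
  measurable_fun setT m -> (forall x, 0 <= m x) -> 0 < J -> 0 < l ->
  (leb A <= (l ^+ n)%:E)%E ->
  (\int[leb]_x (\1_A x * m x ^+ n)%:E <= (J ^+ n)%:E)%E ->
  (\int[leb]_x (\1_A x * m x)%:E <= (2 * J * l ^+ n.-1)%:E)%E.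
Proof.
move=> n0 mA mm m0 J0 l0 Al mJ.
pose a := J / l; have a0 : 0 < a by rewrite divr_gt0.
have ai0 : 0 <= a ^- n.-1 by rewrite invr_ge0 exprn_ge0// ltW.
have mI : measurable_fun setT (\1_A : E -> R) by exact: measurable_indic.
have mmn : measurable_fun setT (fun x => \1_A x * m x ^+ n).
  by apply: measurable_funM => //; exact: measurable_funX.
apply: (@le_trans _ _ (\int[leb]_x ((a ^- n.-1)%:E * (\1_A x * m x ^+ n)%:E +
    a%:E * (\1_A x)%:E))%E).
  apply: ge0_le_integral => //.
  - by move=> x _; rewrite lee_fin mulr_ge0.
  - exact/measurable_EFinP/measurable_funM.
  - apply/measurable_EFinP; apply: measurable_funD; exact: measurable_funM.
  move=> x _; rewrite -!EFinM -EFinD lee_fin.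
  rewrite [a * _]mulrC mulrCA -mulrDr ler_wpM2l//.
  have [ma|ma] := leP (m x) a; first by rewrite ler_wpDl// mulr_ge0// exprn_ge0.
  rewrite ler_wpDr ?(ltW a0)// -[n in leRHS]prednK// exprS mulrCA ler_peMr//.
  by rewrite mulrC ler_pdivlMr ?exprn_gt0// mul1r lerXn2r ?nnegrE// ltW.
rewrite ge0_integralD//; first last.
- exact/measurable_EFinP/measurable_funM.
- by move=> x _; rewrite -EFinM lee_fin mulr_ge0// ltW.
- exact/measurable_EFinP/measurable_funM.
- by move=> x _; rewrite -EFinM lee_fin !mulr_ge0// exprn_ge0.
rewrite !ge0_integralZl//; first last.
- by move=> x _; rewrite lee_fin mulr_ge0// exprn_ge0.
- exact/measurable_EFinP.
- by rewrite lee_fin ltW.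
- exact/measurable_EFinP.
rewrite integral_indicE//.
apply: (@le_trans _ _ ((a ^- n.-1)%:E * (J ^+ n)%:E + a%:E * (l ^+ n)%:E)%E).
  by rewrite leeD// lee_wpmul2l ?lee_fin// ltW.
rewrite -!EFinM -EFinD lee_fin -[n in J ^+ n]prednK// -[n in l ^+ n]prednK//.
rewrite !exprS /a expr_div_n invf_div.
have -> : l ^+ n.-1 / J ^+ n.-1 * (J * J ^+ n.-1) = J * l ^+ n.-1.
  by field; rewrite expf_neq0 ?gt_eqF.
have -> : J / l * (l * l ^+ n.-1) = J * l ^+ n.-1 by field; rewrite gt_eqF.
by rewrite -mulrA mulr_natl mulr2n.
Qed.

End oscillation.

Section poincare_osc.
Context (R : realType) (n : nat).
Local Notation E := 'rV[R]_n.
Local Notation leb := (@lebesgue_rV R n).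
Implicit Types (F h m : E -> R) (A B : set E).

Lemma LN_norm_poweR A h : (0 < n)%N -> (forall x, 0 <= h x) ->
  (LN_norm A h `^ n%:R = \int[leb]_x (\1_A x * h x ^+ n)%:E)%E.
Proof.
move=> n0 h0; rewrite /LN_norm poweR_Lnorm ?pnatr_eq0 -?lt0n//.
apply: eq_integral => x _; rewrite /= ger0_norm ?mulr_ge0//.
rewrite powR_mulrn ?mulr_ge0// exprMn; congr (_ * _)%:E.
by rewrite indicE; case: (_ \in _); rewrite ?expr1n ?expr0n ?eqn0Ngt ?n0.
Qed.

Lemma LN_norm_integral A h (J : R) : (0 < n)%N -> (forall x, 0 <= h x) -> 0 <= J ->
  LN_norm A h = J%:E -> (\int[leb]_x (\1_A x * h x ^+ n)%:E = (J ^+ n)%:E)%E.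
Proof.
by move=> n0 h0 J0 hJ; rewrite -LN_norm_poweR// hJ poweR_EFin powR_mulrn.
Qed.

Lemma LN_norm_ge0 A h : (0 <= LN_norm A h)%E.
Proof. exact: Lnorm_ge0. Qed.

Lemma LN_norm_fin A h : (0 < n)%N -> measurable A -> measurable_fun setT h ->
  (forall x, 0 <= h x) -> (LN_norm setT h < +oo)%E -> exists2 J, 0 <= J & LN_norm A h = J%:E.
Proof.
move=> n0 mA mh h0 hoo.
have mhn : measurable_fun setT (fun x => h x ^+ n) by exact: measurable_funX.
have Aoo : (LN_norm A h `^ n%:R < +oo)%E.
  rewrite LN_norm_poweR//.
  apply: (@le_lt_trans _ _ (LN_norm setT h `^ n%:R)%E); last exact: poweR_lty.
  rewrite LN_norm_poweR//; apply: le_integralT.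
  - by apply: measurable_funM => //; exact: measurable_indic.
  - by apply: measurable_funM => //; exact: measurable_indic.
  - move=> x; rewrite !indicE in_setT mul1r mulr_ge0 ?exprn_ge0//=.
    by rewrite ler_piMl ?exprn_ge0//; case: (_ \in _).
move: Aoo (LN_norm_ge0 A h); case: (LN_norm A h) => [J _|/=|//].
  by rewrite lee_fin => J0; exists J.
by rewrite pnatr_eq0 eqn0Ngt n0.
Qed.

(** Here [l] bounds the diameter of [B] in the sup norm, and [k] is the fraction of a cube of side
    [l] that [B] fills at least: 1 for cubes, [(2 * n) ^- n] for balls. Scale invariance shows in
    that [l] cancels. *)
Lemma leb_avg_poincare F m B (l k M J : R) : (0 < n)%N -> measurable B -> convex_rV B ->
  0 <= M -> B `<=` cbox M ->
  (forall x y, B x -> B y -> `|y - x| <= l) -> 0 < l -> 0 < k ->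
  (leb B <= (l ^+ n)%:E)%E -> ((k * l ^+ n)%:E <= leb B)%E ->
  loc_integrable F -> measurable_fun setT m -> (forall x, 0 <= m x) ->
  line_bound F m -> 0 < J -> (\int[leb]_x (\1_B x * m x ^+ n)%:E <= (J ^+ n)%:E)%E ->
  (((fine (leb B)) ^- 2)%:E * double_osc B F <= (k^-1 * 2 ^+ n.+1 * J)%:E)%E.
Proof.
move=> n0 mB cB M0 BM Bl l0 k0 Bu Bd lF mm m0 FB J0 mJ.
have ln0 : 0 < l ^+ n by rewrite exprn_gt0.
have Boo := leb_cbox_fin mB M0 BM.
have B0 : (0 < leb B)%E by apply: lt_le_trans Bd; rewrite lte_fin mulr_gt0.
set b := fine (leb B).
have bE : leb B = b%:E by rewrite /b fineK// ge0_fin_numE// ltW.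
have b0 : 0 < b by rewrite -lte_fin -bE.
apply: (@le_trans _ _ ((b ^- 2)%:E *
  (l%:E * ((2 ^+ n)%:E * (leb B * (2 * J * l ^+ n.-1)%:E))))%E).
  rewrite lee_wpmul2l ?lee_fin ?invr_ge0 ?exprn_ge0 ?(ltW b0)//.
  apply: le_trans (double_osc_poincare mB cB Bl (loc_measurable lF) mm m0 FB) _.
  rewrite lee_wpmul2l ?lee_fin ?(ltW l0)// lee_wpmul2l ?lee_fin//.
  by rewrite lee_wpmul2l//; exact: power_mean.
rewrite bE -!EFinM lee_fin.
have -> : b ^- 2 * (l * (2 ^+ n * (b * (2 * J * l ^+ n.-1)))) =
    b^-1 * (2 ^+ n.+1 * J * l ^+ n).
  rewrite [2 ^+ n.+1]exprS -(prednK n0) /= [l ^+ _.+1]exprS; move: (l ^+ _) (2 ^+ _) => u w.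
  by field; rewrite gt_eqF.
have -> : k^-1 * 2 ^+ n.+1 * J = (k * l ^+ n)^-1 * (2 ^+ n.+1 * J * l ^+ n).
  by field; rewrite !gt_eqF.
rewrite ler_wpM2r ?mulr_ge0 ?exprn_ge0 ?(ltW J0) ?(ltW l0)//.
by rewrite lef_pV2 ?posrE ?mulr_gt0// -lee_fin -bE.
Qed.

(** The splitting in [power_mean] happens at a positive height, so [J = 0] is reached by replacing
    [J] with [J + e / c] and letting [e] tend to 0. *)
Lemma mean_osc_poincare F m B (l k M J : R) : (0 < n)%N -> measurable B -> convex_rV B ->
  0 <= M -> B `<=` cbox M ->
  (forall x y, B x -> B y -> `|y - x| <= l) -> 0 < l -> 0 < k ->
  (leb B <= (l ^+ n)%:E)%E -> ((k * l ^+ n)%:E <= leb B)%E ->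
  loc_integrable F -> measurable_fun setT m -> (forall x, 0 <= m x) ->
  line_bound F m -> 0 <= J -> (\int[leb]_x (\1_B x * m x ^+ n)%:E <= (J ^+ n)%:E)%E ->
  mean_osc B F <= k^-1 * 2 ^+ n.+1 * J.
Proof.
move=> n0 mB cB M0 BM Bl l0 k0 Bu Bd lF mm m0 FB J0 JE.
apply/ler_addgt0Pr => e e0.
pose c := k^-1 * 2 ^+ n.+1; have c0 : 0 < c by rewrite mulr_gt0 ?invr_gt0 ?exprn_gt0.
have B0 : (0 < leb B)%E by apply: lt_le_trans Bd; rewrite lte_fin mulr_gt0 ?exprn_gt0.
have J'0 : 0 < J + e / c by rewrite ltr_wpDl ?divr_gt0.
have -> : k^-1 * 2 ^+ n.+1 * J + e = k^-1 * 2 ^+ n.+1 * (J + e / c).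
  by rewrite -/c mulrDr [c * (e / c)]mulrC divfK// gt_eqF.
rewrite -lee_fin; apply: le_trans (mean_osc_double mB M0 BM B0 lF) _.
apply: (leb_avg_poincare n0 mB cB M0 BM Bl l0 k0 Bu Bd lF mm m0 FB J'0).
apply: le_trans JE _; rewrite lee_fin lerXn2r ?nnegrE ?(ltW J'0)//.
by rewrite lerDl divr_ge0// ltW.
Qed.

Lemma cube_box (a : E) (l : R) : cube a l = box (fun i => a ord0 i) (fun i => a ord0 i + l).
Proof. by []. Qed.

Lemma measurable_cube (a : E) (l : R) : measurable (cube a l).
Proof. exact: measurable_box. Qed.

Lemma leb_cube (a : E) (l : R) : 0 <= l -> leb (cube a l) = (l ^+ n)%:E.
Proof.
move=> l0; rewrite cube_box leb_box => [|i]; last by rewrite lerDl.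
congr _%:E; rewrite -[X in _ ^+ X](card_ord n) -prodr_const.
by apply: eq_bigr => i _; rewrite addrAC subrr add0r.
Qed.

Lemma cube_cbox (a : E) (l : R) : 0 <= l -> cube a l `<=` cbox (`|a| + l).
Proof.
move=> l0 x xQ; rewrite cboxE ?addr_ge0//= rV_norm_leP ?addr_ge0// => i.
have := xQ i; have := coord_le_norm a i; rewrite !ler_norml; lra.
Qed.

Lemma cube_diam (a : E) (l : R) x y : 0 <= l -> cube a l x -> cube a l y -> `|y - x| <= l.
Proof.
move=> l0 xQ yQ; apply/rV_norm_leP => // i; rewrite !mxE ler_norml.
have := xQ i; have := yQ i; lra.
Qed.

Lemma cube_convex (a : E) (l : R) : convex_rV (cube a l).
Proof.
move=> x y s xQ yQ /andP[s0 s1] i; rewrite !mxE; have := xQ i; have := yQ i.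
by move=> /andP[? ?] /andP[? ?]; apply/andP; split; nra.
Qed.

Lemma mean_osc_cube F m (a : E) (l J : R) : (0 < n)%N -> 0 < l ->
  loc_integrable F -> measurable_fun setT m -> (forall x, 0 <= m x) ->
  line_bound F m -> 0 <= J ->
  (\int[leb]_x (\1_(cube a l) x * m x ^+ n)%:E <= (J ^+ n)%:E)%E ->
  mean_osc (cube a l) F <= 2 ^+ n.+1 * J.
Proof.
move=> n0 l0 lF mm m0 FB J0 JE; have l0' := ltW l0.
have := @mean_osc_poincare F m (cube a l) l 1 (`|a| + l) J n0 (measurable_cube a l)
  (@cube_convex a l) (addr_ge0 (normr_ge0 a) l0') (cube_cbox l0')
  (fun x y => cube_diam l0') l0 ltr01.
by rewrite leb_cube// mul1r invr1 mul1r; apply.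
Qed.

Lemma enorm_lt (z : E) (r : R) : 0 < r -> (enorm z < r) = (\sum_(i < n) z ord0 i ^+ 2 < r ^+ 2).
Proof.
move=> r0; rewrite /enorm -{1}[r](ger0_norm (ltW r0)) -sqrtr_sqr.
by rewrite ltr_sqrt// exprn_gt0.
Qed.

Lemma measurable_enorm d (T : measurableType d) (f : T -> E) : measurable_fun setT f ->
  measurable_fun setT (fun t => enorm (f t)).
Proof.
move=> mf; apply: (measurableT_comp (continuous_measurable_fun (@sqrt_continuous R))).
apply: measurable_sum => i; apply: measurable_funX.
exact: (measurableT_comp (@measurable_rV_coord R n i) mf).
Qed.

Lemma measurable_eball (x0 : E) (r : R) : measurable (eball x0 r).
Proof.
rewrite (_ : eball x0 r = (fun x : E => enorm (x - x0)) @^-1` `]-oo, r[%classic).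
  rewrite -[X in measurable X]setTI; apply: measurable_enorm => //.
  exact: measurable_rVB.
by apply/seteqP; split=> x /=; rewrite in_itv.
Qed.

Lemma eball_cube (x0 : E) (r : R) : eball x0 r `<=` cube (x0 - const_mx r) (2 * r).
Proof.
move=> x /= xr i; rewrite !mxE.
have := le_lt_trans (coord_le_enorm (x - x0) i) xr; rewrite !mxE ltr_norml; lra.
Qed.

Lemma cube_eball (x0 : E) (r : R) : (0 < n)%N -> 0 < r ->
  cube (x0 - const_mx (r / (2 * n%:R))) (r / n%:R) `<=` eball x0 r.
Proof.
move=> n0 r0 x xQ; have n0' : 0 < n%:R :> R by rewrite ltr0n.
apply: le_lt_trans (enorm_le _) _.
have h : `|x - x0| <= r / (2 * n%:R).
  apply/rV_norm_leP; first by rewrite divr_ge0 ?mulr_ge0 ?(ltW r0).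
  move=> i; have := xQ i; rewrite !mxE ler_norml.
  have -> : r / n%:R = 2 * (r / (2 * n%:R)) by field; rewrite gt_eqF.
  lra.
apply: le_lt_trans (ler_wpM2l (ltW n0') h) _.
have -> : n%:R * (r / (2 * n%:R)) = r / 2 by field; rewrite gt_eqF.
lra.
Qed.

Lemma eball_convex (x0 : E) (r : R) : 0 < r -> convex_rV (eball x0 r).
Proof.
move=> r0 x y s; rewrite /eball /= !enorm_lt// => xr yr /andP[s0 s1].
set u := \sum_i _ in xr; set w := \sum_i _ in yr.
apply: (@le_lt_trans _ _ ((1 - s) * u + s * w)).
  (* Coordinatewise convexity of the square: the gap is [s * (1 - s) * (y_i - x_i) ^ 2]. *)
  rewrite !mulr_sumr -big_split/=; apply: ler_sum => i _; rewrite !mxE.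
  have := sqr_ge0 (y ord0 i - x ord0 i); rewrite -subr_ge0 => h.
  have : 0 <= s * (1 - s) * (y ord0 i - x ord0 i) ^+ 2 by apply: mulr_ge0 h; rewrite mulr_ge0// subr_ge0.
  move=> {}h; rewrite (_ : _ - _ = s * (1 - s) * (y ord0 i - x ord0 i) ^+ 2)//.
  by ring.
by move: s0; rewrite le_eqVlt => /predU1P[<-|s0]; nra.
Qed.

(** The ball lies in a cube of side [2 * r] and contains one of side [r / n], since [enorm] is at
    most [n] times the sup norm; their volume ratio is [(2 * n) ^+ n]. *)
Lemma mean_osc_eball F m (x0 : E) (r J : R) : (0 < n)%N -> 0 < r ->
  loc_integrable F -> measurable_fun setT m -> (forall x, 0 <= m x) ->
  line_bound F m -> 0 <= J ->
  (\int[leb]_x (\1_(eball x0 r) x * m x ^+ n)%:E <= (J ^+ n)%:E)%E ->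
  mean_osc (eball x0 r) F <= ((2 * n%:R) ^- n)^-1 * 2 ^+ n.+1 * J.
Proof.
move=> n0 r0 lF mm m0 FB J0 JE; have n0' : 0 < n%:R :> R by rewrite ltr0n.
have l0 : 0 < 2 * r by rewrite mulr_gt0.
have BQ := @eball_cube x0 r; have l0' := ltW l0.
apply: (@mean_osc_poincare F m _ _ _ _ J n0 (measurable_eball x0 r) (eball_convex r0)
  (addr_ge0 (normr_ge0 (x0 - const_mx r)) l0') (subset_trans BQ (cube_cbox l0')) _ l0) => //.
- by move=> x y /BQ xQ /BQ yQ; exact: cube_diam xQ yQ.
- by rewrite invr_gt0 exprn_gt0// mulr_gt0.
- rewrite -(leb_cube (x0 - const_mx r) l0') le_measure ?inE//.
    exact: measurable_eball.
- rewrite -exprVn -exprMn.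
  have -> : (2 * n%:R)^-1 * (2 * r) = r / n%:R by field; rewrite gt_eqF.
  rewrite -(leb_cube (x0 - const_mx (r / (2 * n%:R))) (divr_ge0 (ltW r0) (ltW n0'))).
  rewrite le_measure ?inE//; [exact: measurable_eball|].
  exact: cube_eball.
Qed.

End poincare_osc.

(** * Oscillation estimates for the Sobolev space *)

Section sobolev.
Context (R : realType) (n : nat).
Local Notation E := 'rV[R]_n.
Local Notation leb := (@lebesgue_rV R n).
Implicit Types (F h m : E -> R) (A B : set E).

(** Membership in [W1N] provides a gradient, so the choice in [gradient] does not fall back on its
    default 0. *)
Lemma gradientP (f : functional R n) : W1N f -> is_gradient f (gradient f).
Proof. by move=> [_ fg _]; exact: (xgetPex (fun=> 0) fg). Qed.

Lemma loc_integrable_gradient (f : functional R n) i : W1N f ->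
  loc_integrable (fun x => gradient f x ord0 i).
Proof. by move=> /gradientP /(_ i)[]. Qed.

Lemma measurable_norm_gradient (f : functional R n) : W1N f ->
  measurable_fun setT (norm_gradient f).
Proof.
move=> Wf; apply: measurable_enorm; apply/measurable_fun_rVP => i.
exact: loc_measurable (loc_integrable_gradient i Wf).
Qed.

Lemma W1N_function (f : functional R n) : W1N f ->
  exists2 F, represents f F & weak_gradient F (fun i x => gradient f x ord0 i).
Proof.
move=> Wf; have gP := gradientP Wf; have [[flin _] _ _] := Wf.
have lg i := loc_integrable_gradient i Wf.
have fg i phi : tf phi ->
    f (partial i phi) = - \int[leb]_x (gradient f x ord0 i * phi x).
  move=> tphi; have [_ /(_ phi)] := gP i.
  by rewrite /dist_partial /dist_of => <-; [rewrite opprK|exact/test_functionP].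
have [|F lF hF] := linear_representation _ lg fg.
  by move=> c phi psi tphi tpsi; apply: flin; exact: tf_schwartz.
exists F; first by split => // phi /test_functionP tphi; exact: hF.
split => // i phi tphi.
by rewrite -hF ?fg//; exact: tf_partial.
Qed.

(** Increments are measured by the sup norm of [v], whose dual is the sum norm on gradients; the
    factor [n] passes from there to the Euclidean norm. *)
Lemma line_bound_norm_gradient F (g : E -> E) :
  (forall i, measurable_fun setT (fun x => g x ord0 i)) ->
  line_identity F (fun i x => g x ord0 i) ->
  line_bound F (fun x => n%:R * enorm (g x)).
Proof.
move=> mg Fg v; have := line_identity_bound mg Fg v; apply: filterS => x hx.
apply: le_trans hx _; rewrite lee_wpmul2l ?lee_fin//.
have mxs : measurable_fun setT (fun s : R => x + s *: v).
  by apply: measurable_rVD => //; exact: measurable_rVZ.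
have mgg : measurable_fun setT g by exact/measurable_fun_rVP.
apply: le_integralT.
- apply: measurable_funM; first exact: measurable_unitI.
  apply: measurable_sum => i; apply: measurableT_comp => //.
  exact: (measurableT_comp (mg i) mxs).
- apply: measurable_funM; first exact: measurable_unitI.
  apply: measurable_funM => //; apply: measurable_enorm.
  exact: (measurableT_comp mgg mxs).
- move=> s; rewrite mulr_ge0 ?unitI_ge0 ?sumr_ge0//= ler_wpM2l ?unitI_ge0//.
  rewrite -[X in X%:R * _](card_ord n) -sumr_const mulr_suml.
  by apply: ler_sum => i _; rewrite mul1r coord_le_enorm.
Qed.

Lemma LN_norm_scale A h (J : R) : (0 < n)%N -> measurable A ->
  measurable_fun setT h -> (forall x, 0 <= h x) -> 0 <= J ->
  LN_norm A h = J%:E ->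
  (\int[leb]_x (\1_A x * (n%:R * h x) ^+ n)%:E = ((n%:R * J) ^+ n)%:E)%E.
Proof.
move=> n0 mA mh h0 J0 JE.
under eq_integral do rewrite exprMn mulrCA EFinM.
rewrite ge0_integralZl//.
- by rewrite (LN_norm_integral n0 h0 J0 JE) -EFinM exprMn.
- apply/measurable_EFinP/measurable_funM; first exact: measurable_indic.
  exact: measurable_funX.
- by move=> x _; rewrite lee_fin mulr_ge0// exprn_ge0.
Qed.

Lemma bmo_W1N F (f : functional R n) : (0 < n)%N -> W1N f ->
  weak_gradient F (fun i x => gradient f x ord0 i) ->
  (bmo_norm F <= (2 ^+ n.+1 * n%:R)%:E * W1N_norm f)%E.
Proof.
move=> n0 Wf Fg; have lF := (let: And3 a _ _ := Fg in a).
have mg := measurable_norm_gradient Wf.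
have g0 x : 0 <= norm_gradient f x by exact: enorm_ge0.
have [J J0 JE] : exists2 J, 0 <= J & LN_norm setT (norm_gradient f) = J%:E.
  by apply: LN_norm_fin => //; case: Wf.
apply: ub_ereal_sup => _ [[a l] /= l0 <-].
rewrite /W1N_norm JE -EFinM lee_fin -mulrA.
apply: (@mean_osc_cube R n F (fun x => n%:R * norm_gradient f x)) => //.
- exact: measurable_funM.
- by move=> x; rewrite mulr_ge0.
- apply: line_bound_norm_gradient.
    by move=> i; exact: loc_measurable (loc_integrable_gradient i Wf).
  exact: weak_gradient_line.
- by rewrite mulr_ge0.
rewrite -(LN_norm_scale n0 measurableT mg g0 J0 JE).
have mn : measurable_fun setT (fun x => (n%:R * norm_gradient f x) ^+ n).
  by apply: measurable_funX; exact: measurable_funM.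
apply: le_integralT.
- by apply: measurable_funM => //; apply: measurable_indic; exact: measurable_cube.
- by apply: measurable_funM => //; exact: measurable_indic.
- move=> x; have h0 : 0 <= (n%:R * norm_gradient f x) ^+ n by rewrite exprn_ge0// mulr_ge0.
  by rewrite !indicE in_setT mul1r mulr_ge0//= ler_piMl//; case: (_ \in _).
Qed.

Lemma eball_W1N F (f : functional R n) (x0 : E) (r : R) : (0 < n)%N -> W1N f -> 0 < r ->
  weak_gradient F (fun i x => gradient f x ord0 i) ->
  ((mean_osc (eball x0 r) F)%:E <=
    (((2 * n%:R) ^- n)^-1 * 2 ^+ n.+1 * n%:R)%:E * LN_norm (eball x0 r) (norm_gradient f))%E.
Proof.
move=> n0 Wf r0 Fg; have lF := (let: And3 a _ _ := Fg in a).
have mg := measurable_norm_gradient Wf.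
have g0 x : 0 <= norm_gradient f x by exact: enorm_ge0.
have mB := @measurable_eball R n x0 r.
have [J J0 JE] : exists2 J, 0 <= J & LN_norm (eball x0 r) (norm_gradient f) = J%:E.
  by apply: LN_norm_fin => //; case: Wf.
rewrite JE -EFinM lee_fin -[_ * n%:R * J]mulrA.
apply: (@mean_osc_eball R n F (fun x => n%:R * norm_gradient f x)) => //.
- exact: measurable_funM.
- by move=> x; rewrite mulr_ge0.
- apply: line_bound_norm_gradient.
    by move=> i; exact: loc_measurable (loc_integrable_gradient i Wf).
  exact: weak_gradient_line.
- by rewrite mulr_ge0.
- by rewrite -(LN_norm_scale n0 mB mg g0 J0 JE).
Qed.

End sobolev.

(** * Mollification *)

Section convolution.
Context (R : realType) (n : nat).
Local Notation E := 'rV[R]_n.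
Local Notation leb := (@lebesgue_rV R n).
Implicit Types (F g h m rho : E -> R) (A B : set E).

(** Convolution with the reflected kernel: with [rho (y - x)], the value at [x] is the average of
    [g (x + w)] with weight [rho w] ([convE]). *)
Definition conv g rho (x : E) : R := \int[leb]_y (g y * rho (y - x)).

(** The integral of [|g|] over [cbox M] serves for all kernels supported there, which turns uniform
    bounds on kernels into bounds on integrals. *)
Lemma Rintegral_bs_le g (M : R) : loc_integrable g -> 0 <= M ->
  exists2 C, 0 <= C & forall (k : E -> R) c, measurable_fun setT k -> bsupp M k ->
    (forall x, `|k x| <= c) -> `|\int[leb]_x (g x * k x)| <= c * C.
Proof.
move=> lg M0; exists (fine (\int[leb]_(x in cbox M) `|g x|%:E)).
  by apply: fine_ge0; apply: integral_ge0 => x _; rewrite lee_fin.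
move=> k c mk kM kc; have ik := loc_integrable_mul lg mk kc kM.
rewrite -lee_fin EFinM fineK; last first.
  by rewrite ge0_fin_numE ?loc_cbox//; apply: integral_ge0 => x _; rewrite lee_fin.
apply: le_trans (loc_int_ge0_bound (loc_measurable lg) mk kc kM M0).
rewrite EFin_normr_Rintegral//; apply: (le_trans (le_abse_integral _ _ _)) => //.
by have /integrableP[] := ik.
Qed.

Lemma bs_shift rho (M : R) (x w : E) : bsupp M rho -> `|w| <= 1 ->
  bsupp (M + (`|x| + 1)) (fun y => rho (y - (x + w))).
Proof.
move=> hM w1 y My; apply: hM.
have := ler_normD (y - (x + w)) (x + w); rewrite subrK.
have := ler_normD x w; lra.
Qed.

Lemma conv_continuous g rho : loc_integrable g -> tf rho -> continuous (conv g rho).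
Proof.
move=> lg trho x; have [L L0 hL] := tf_lipschitz trho.
have [M M0 hM] := tf_bs trho.
have M'0 : 0 <= M + (`|x| + 1) by rewrite addr_ge0 ?(ltW M0)// addr_ge0.
have [C C0 hC] := Rintegral_bs_le lg M'0.
have H (w : E) : `|w| <= 1 -> `|conv g rho (x + w) - conv g rho x| <= L * `|w| * C.
  move=> w1; have t1 : tf (fun y => rho (y - (x + w))) by exact: tf_shift.
  have t2 : tf (fun y => rho (y - x)) by exact: tf_shift.
  rewrite /conv -RintegralB//; [|exact: loc_integrable_tf..].
  under eq_Rintegral do rewrite -mulrBr.
  apply: hC.
  - by apply: measurable_funB; exact: continuous_measurable_rV (tf_continuous _).
  - move=> y My; rewrite (bs_shift hM w1 My).
    have := @bs_shift rho M x 0 hM; rewrite normr0 ler01 addr0 => /(_ isT y My) ->.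
    by rewrite subr0.
  - move=> y; rewrite (le_trans (hL _ _))//.
    have -> : y - (x + w) - (y - x) = - w by apply/rowP => i; rewrite !mxE; ring.
    by rewrite normrN.
have D0 : 0 < L * C + 1 by rewrite ltr_wpDl// mulr_ge0.
apply/(@cvgrPdist_le _ _ _ (nbhs (x : E)) _ (conv g rho) (conv g rho x)) => e e0.
near=> y; rewrite distrC.
have yx : `|y - x| <= 1 by rewrite distrC; near: y; exact: cvgr_dist_le.
have := H (y - x) yx; rewrite [x + _]addrC subrK => /le_trans; apply.
have yx2 : `|y - x| <= e / (L * C + 1).
  by rewrite distrC; near: y; apply: cvgr_dist_le => //; rewrite divr_gt0.
apply: (@le_trans _ _ ((L * C + 1) * `|y - x|)); last first.
  by rewrite mulrC -ler_pdivlMr.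
by rewrite mulrAC ler_wpM2r// lerDl.
Unshelve. all: by end_near. Qed.

Lemma is_derive_along (phi : E -> R) (x v : E) (t d : R) :
  is_derive (x + t *: v) v phi d -> is_derive t 1 (fun u : R => phi (x + u *: v)) d.
Proof.
move=> /is_derive_line h.
have : is_derive t 1 (fun u : R => phi (x + t *: v + (1 * u + - t) *: v)) (1 * d).
  by apply: (@is_derive_affine _ (fun u => phi (x + t *: v + u *: v)));
    rewrite mul1r subrr.
rewrite mul1r; congr (is_derive t 1 _ d); apply/funext => u; congr (phi _).
by apply/rowP => i; rewrite !mxE; ring.
Qed.

(** Uniform in [y], so that the remainder can be integrated against a locally integrable
    function. *)
Lemma tf_taylor rho (v : E) : tf rho -> exists2 C, 0 <= C &
  forall (y : E) (h : R), `|rho (y + h *: v) - rho y - h * dird v rho y| <= C * h ^+ 2.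
Proof.
move=> trho; have [L L0 hL] := tf_lipschitz (tf_dird v trho).
exists (L * `|v|); first by rewrite mulr_ge0.
move=> y h.
have d (t : R) : is_derive t 1 (fun t : R => rho (y + t *: v)) (dird v rho (y + t *: v)).
  exact/is_derive_along/(Mk1_is_derive _ _ (trho.1 1%N)).
have [c ch e] := MVT0 h d.
move: e; rewrite scale0r addr0 => ->.
rewrite [_ * h]mulrC -mulrBr normrM expr2 mulrCA.
apply: (@le_trans _ _ (`|h| * (L * `|c *: v|))).
  by rewrite ler_wpM2l// (le_trans (hL _ _))// addrAC subrr add0r.
have -> : h * (L * `|v| * h) = `|h| * (L * (`|h| * `|v|)).
  rewrite (_ : h * _ = h ^+ 2 * (L * `|v|)); last by ring.
  by rewrite -[h ^+ 2]real_normK ?num_real//; ring.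
rewrite normrZ.
by rewrite ler_wpM2l// ler_wpM2l// ler_wpM2r.
Qed.

(** Moving [x] along [v] differentiates the kernel along [- v]; as a function of [y] this is minus
    its derivative along [v], which the weak gradient transfers to [F]. *)
Lemma conv_is_derive F (g : 'I_n -> E -> R) rho (x v : E) : weak_gradient F g -> tf rho ->
  is_derive x v (conv F rho) (\sum_j v ord0 j * conv (g j) rho x).
Proof.
move=> Fg trho; have [lF lg _] := Fg.
have [L L0 hL] := tf_taylor (- v) trho.
have [M M0 hM] := tf_bs trho.
pose M' := M + (`|x| + `|v|).
have M'0 : 0 <= M' by rewrite addr_ge0 ?(ltW M0)// addr_ge0.
have [C C0 hC] := Rintegral_bs_le lF M'0.
have tx : tf (fun y => rho (y - x)) by exact: tf_shift.
have dE y : dird v (fun y => rho (y - x)) y = - dird (- v) rho (y - x).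
  rewrite /dird -sumrN; apply: eq_bigr => i _; rewrite mxE mulNr opprK; congr (_ * _).
  apply: derive_val; apply: is_derive_shift.
  exact: Mk_is_derive (trho.1 1%N).
have -> : \sum_j v ord0 j * conv (g j) rho x =
    \int[leb]_y (F y * dird (- v) rho (y - x)).
  have -> : \int[leb]_y (F y * dird (- v) rho (y - x)) =
      - \int[leb]_y (F y * dird v (fun y => rho (y - x)) y).
    rewrite -mulN1r -RintegralZl//; last exact: loc_integrable_tf lF (tf_dird v tx).
    by apply: eq_Rintegral => y _; rewrite dE; ring.
  rewrite (weak_gradient_dird v Fg tx) opprK.
  under eq_bigr => j _.
    rewrite /conv -RintegralZl//; last exact: loc_integrable_tf.
    over.
  rewrite -Rintegral_sum => [|j].
    apply: eq_Rintegral => y _; rewrite mulr_suml.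
    by apply: eq_bigr => j _; ring.
  rewrite /comp; under eq_fun do rewrite EFinM.
  by apply: integrableZl => //; exact: loc_integrable_tf.
apply/is_derive_line; apply: (@is_derive_taylor _ _ _ _ (L * C)) => t t1.
rewrite add0r scale0r addr0 mulrAC /conv.
have t2 : tf (fun y => rho (y - (x + t *: v))) by exact: tf_shift.
have t3 : tf (fun y => dird (- v) rho (y - x)) by apply: tf_shift; exact: tf_dird.
have i1 := loc_integrable_tf lF t2.
have i2 := loc_integrable_tf lF tx.
have i3 := loc_integrable_tf lF t3.
rewrite -[t * _]RintegralZl// -RintegralB// -RintegralB//; first last.
- by rewrite /comp; under eq_fun do rewrite EFinM; exact: integrableZl.
- by rewrite /comp; under eq_fun do rewrite EFinB; exact: integrableB.
rewrite (eq_Rintegral _ (g := fun y => F y *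
  (rho (y - (x + t *: v)) - rho (y - x) - t * dird (- v) rho (y - x)))); last first.
  by move=> y _; ring.
apply: hC.
- apply: measurable_funB; first by apply: measurable_funB; exact: continuous_measurable_rV (tf_continuous _).
  by apply: measurable_funM => //; exact: continuous_measurable_rV (tf_continuous _).
- move=> y My.
  have tv : `|t *: v| <= `|v| by rewrite normrZ -[leRHS]mul1r ler_wpM2r.
  have hy w : `|w| <= `|v| -> M < `|y - (x + w)|.
    move=> wv; have := ler_normD (y - (x + w)) (x + w); rewrite subrK.
    have := ler_normD x w; move: My; rewrite /M'; lra.
  have hx : M < `|y - x| by have := hy 0; rewrite normr0 addr0; exact.
  have -> : dird (- v) rho (y - x) = 0.
    by apply: big1 => i _; rewrite (bs_partial i hM)// mulr0.
  by rewrite (hM _ (hy _ tv)) (hM _ hx) mulr0 !subr0.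
- move=> y; have := hL (y - x) t; rewrite scalerN.
  by rewrite opprD addrA.
Qed.

End convolution.

Section mollifier.
Context (R : realType) (n : nat).
Local Notation E := 'rV[R]_n.
Local Notation leb := (@lebesgue_rV R n).
Local Notation mu1 := (@lebesgue_measure R).
Implicit Types (F g h m rho : E -> R) (A B : set E).

Definition mollifier (e : R) rho : Prop :=
  [/\ tf rho, forall x, 0 <= rho x, bsupp e rho & \int[leb]_x rho x = 1].

Lemma tf_integrable rho : tf rho -> leb.-integrable setT (EFin \o rho).
Proof.
move=> trho; have := loc_integrable_tf (loc_integrable_cst n (1 : R)) trho.
by congr (leb.-integrable _); apply/funext => x /=; rewrite mul1r.
Qed.

Lemma tensor_ge0 (x : E) : 0 <= tensor x.
Proof. by apply: prodr_ge0 => i _; exact: bump_ge0. Qed.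

Lemma mollifier_exists (e : R) : 0 < e -> exists rho, mollifier e rho.
Proof.
move=> e0; have ei0 : 0 < e^-1 by rewrite invr_gt0.
(* The function [tensor] shrunk to [cbox e], to be normalised below; its integral is positive
   because that of [tensor] is. The summand 0 matches the form of [Ck_affine]. *)
pose r0 (x : E) : R := \prod_i bump (e^-1 * x ord0 i + 0).
have r00 x : 0 <= r0 x by apply: prodr_ge0 => i _; exact: bump_ge0.
have b0 : bsupp e r0.
  apply: bs_coord => [|x j xj]; first exact: ltW.
  rewrite /r0 (bigD1 j)//= bump_supp ?mul0r//.
  rewrite addr0 normrM gtr0_norm// mulrC ltr_pdivlMr// mul1r//.
have t0 : tf r0.
  split; last by exists e.
  move=> k; apply: Mk_prod => i; apply: (@Mk_coord _ _ k (fun t : R => bump (e^-1 * t + 0))).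
  exact/Ck_affine/Ck_bump.
have i0 : 0 < \int[leb]_x r0 x.
  have tI : (\int[leb]_x (tensor x)%:E = (\int[leb]_x tensor x)%:E)%E.
    rewrite /Rintegral fineK// (integrable_fin_num measurableT)//.
    exact: (tf_integrable (@tf_tensor R n)).
  have tI0 : 0 < \int[leb]_x tensor x.
    rewrite lt_def integral_tensor_neq0/=; apply: Rintegral_ge0 => x _.
    exact: tensor_ge0.
  have : (\int[leb]_x (r0 x)%:E = (`|e^-1| ^- n)%:E * (\int[leb]_x tensor x)%:E)%E.
    have mt : measurable_fun setT (fun x : E => (tensor x)%:E).
      by apply/measurable_EFinP; exact: continuous_measurable_rV (tf_continuous (@tf_tensor R n)).
    have t0' x : (0 <= (tensor (x : E))%:E)%E by rewrite lee_fin tensor_ge0.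
    rewrite -tI -(ge0_integral_affine 0 (lt0r_neq0 ei0) mt t0').
    by apply: eq_integral => x _; congr _%:E; apply: eq_bigr => i _; rewrite !mxE addr0 add0r.
  rewrite /Rintegral => ->; rewrite -EFinM /= mulr_gt0// invr_gt0 exprn_gt0// normr_gt0 gt_eqF//.
exists (fun x => (\int[leb]_x r0 x)^-1 * r0 x); split.
- exact: tfZ.
- by move=> x; rewrite mulr_ge0// invr_ge0 ltW.
- by move=> x /b0 ->; rewrite mulr0.
- by rewrite RintegralZl ?mulVf ?gt_eqF//; exact: tf_integrable.
Qed.

Context (e : R) (rho : E -> R) (Hrho : mollifier e rho).
Let trho : tf rho. Proof. by case: Hrho. Qed.
Let rho0 x : 0 <= rho x. Proof. by case: Hrho. Qed.
Let mrho : measurable_fun setT rho.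
Proof. exact: continuous_measurable_rV (tf_continuous trho). Qed.

Lemma integral_mollifier : (\int[leb]_x (rho x)%:E = 1)%E.
Proof.
case: Hrho => _ _ _ i1; rewrite -[RHS]/(1%:E) -i1 /Rintegral fineK//.
by apply: (integrable_fin_num measurableT); exact: tf_integrable.
Qed.

Lemma convE g x : loc_integrable g -> conv g rho x = \int[leb]_w (g (x + w) * rho w).
Proof.
move=> lg; rewrite /conv -(integral_shift x (f := fun y => g y * rho (y - x))).
  by apply: eq_Rintegral => w _; rewrite addrK addrC.
apply: measurable_funM; first exact: loc_measurable.
by apply: measurableT_comp => //; exact: measurable_rVB.
Qed.

Lemma loc_integrable_shiftl g x : loc_integrable g -> loc_integrable (fun w => g (x + w)).
Proof. by move=> /(loc_integrable_shift x); under eq_fun do rewrite addrC. Qed.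

Lemma mollify_le h : loc_integrable h ->
  (`|\int[leb]_w (h w * rho w)|%:E <= \int[leb]_w (rho w * `|h w|)%:E)%E.
Proof.
move=> lh; have ih := loc_integrable_tf lh trho.
rewrite EFin_normr_Rintegral//; apply: (le_trans (le_abse_integral _ _ _)) => //.
  by have /integrableP[] := ih.
rewrite le_eqVlt; apply/orP; left; apply/eqP; apply: eq_integral => w _.
by rewrite /= normrM (ger0_norm (rho0 w)) mulrC.
Qed.

Lemma conv_diff_le F x y : loc_integrable F ->
  (`|conv F rho y - conv F rho x|%:E <=
   \int[leb]_w (rho w * `|F (y + w) - F (x + w)|)%:E)%E.
Proof.
move=> lF; have ly := loc_integrable_shiftl y lF; have lx := loc_integrable_shiftl x lF.
rewrite !convE// -RintegralB//; [|exact: loc_integrable_tf..].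
under eq_Rintegral do rewrite -mulrBl.
apply: mollify_le; have := loc_integrableD ly (loc_integrableZ (-1) lx).
by under eq_fun do rewrite mulN1r.
Qed.

Lemma conv_dist_le F x : loc_integrable F ->
  (`|F x - conv F rho x|%:E <=
   \int[leb]_w (rho w * `|F (x + w) - F x|)%:E)%E.
Proof.
move=> lF; have lx := loc_integrable_shiftl x lF.
have -> : F x - conv F rho x = - \int[leb]_w ((F (x + w) - F x) * rho w).
  under eq_Rintegral do rewrite mulrBl.
  rewrite RintegralB//; [|exact: loc_integrable_tf|]; last first.
    exact: loc_integrable_tf (loc_integrable_cst n (F x)) trho.
  rewrite -convE// RintegralZl//; last exact: tf_integrable.
  by case: Hrho => _ _ _ ->; rewrite mulr1 opprB.
rewrite normrN; apply: mollify_le.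
exact: (loc_integrableD lx (loc_integrable_cst n (- F x))).
Qed.

Lemma integral_mollifier_le (f : E -> \bar R) C : measurable_fun setT f ->
  (forall w, (0 <= f w)%E) -> (forall w, (f w <= (rho w)%:E * C)%E) -> (0 <= C)%E ->
  (\int[leb]_w f w <= C)%E.
Proof.
move=> mf f0 fC C0.
apply: (@le_trans _ _ (\int[leb]_w ((rho w)%:E * C))%E).
  apply: ge0_le_integral => //.
  apply: emeasurable_funM; last exact: measurable_cst.
  exact/measurable_EFinP.
rewrite ge0_integralZr//.
- by rewrite integral_mollifier mul1e.
- exact/measurable_EFinP.
- by move=> w _; rewrite lee_fin.
Qed.

(** Convexity: [conv F rho] is a weighted average of translates of [F], and Tonelli moves the
    average out of the double integral. *)
Lemma double_osc_conv A F (C : \bar R) : measurable A -> loc_integrable F -> (0 <= C)%E ->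
  (forall w, (double_osc A (fun x : E => F (x + w)%R) <= C)%E) -> (double_osc A (conv F rho) <= C)%E.
Proof.
move=> mA lF C0 hC; have mF := loc_measurable lF.
pose J (x : E) : R := \1_A x.
have J0 x : 0 <= J x by rewrite /J indicE.
have mJ : measurable_fun setT J by exact: measurable_indic.
pose K (p : E * E) (y : E) : R :=
  rho p.2 * (J p.1 * J y * `|F (y + p.2) - F (p.1 + p.2)|).
have K0 p y : 0 <= K p y by rewrite !mulr_ge0.
have mK : measurable_fun setT (fun q : (E * E) * E => K q.1 q.2).
  have m1 : measurable_fun setT (fun q : E * E * E => q.1.1).
    exact: measurableT_comp measurable_fst measurable_fst.
  have m2 : measurable_fun setT (fun q : E * E * E => q.1.2).
    exact: measurableT_comp measurable_snd measurable_fst.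
  have m3 : measurable_fun setT (fun q : E * E * E => q.2) by exact: measurable_snd.
  apply: measurable_funM; first exact: (measurableT_comp mrho m2).
  apply: measurable_funM.
    by apply: measurable_funM; [exact: (measurableT_comp mJ m1)|exact: (measurableT_comp mJ m3)].
  apply: measurableT_comp => //; apply: measurable_funB.
    exact: (measurableT_comp mF (measurable_rVD m3 m2)).
  exact: (measurableT_comp mF (measurable_rVD m1 m2)).
have mKx x : measurable_fun setT (fun q : E * E => K (x, q.2) q.1).
  have mq : measurable_fun setT (fun q : E * E => ((x, q.2), q.1) : E * E * E).
    apply/measurable_fun_pairP; split; last exact: measurable_fst.
    apply/measurable_fun_pairP; split; first exact: measurable_cst.
    exact: measurable_snd.
  exact: (measurableT_comp mK mq).
have mI : measurable_fun setT (fun p : E * E => (\int[leb]_y (K p y)%:E)%E).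
  exact: (measurable_int_rV (f := K)).
have I0 (p : E * E) : (0 <= \int[leb]_y (K p y)%:E)%E.
  by apply: integral_ge0 => y _; rewrite lee_fin.
have mc : measurable_fun setT (conv F rho).
  exact: continuous_measurable_rV (conv_continuous lF trho).
apply: (@le_trans _ _ (\int[leb]_x \int[leb]_w \int[leb]_y (K (x, w) y)%:E)%E).
  apply: ge0_le_integral => //.
  - by move=> x _; apply: integral_ge0 => y _; rewrite lee_fin !mulr_ge0.
  - apply: (measurable_int_rV (f := fun x y => \1_A x * \1_A y * `|conv F rho y - conv F rho x|)).
      exact: measurable_double_osc.
    by move=> x y; rewrite !mulr_ge0.
  - exact: (@measurable_fun_fubini_tonelli_F _ _ E E R (@lebs R n)
      (fun p : E * E => (\int[leb]_y (K p y)%:E)%E)).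
  move=> x _; rewrite -(tonelli_rV (f := fun y w => K (x, w) y))//.
  apply: ge0_le_integral => //.
  - apply/measurable_EFinP.
    exact: (measurableT_comp (measurable_double_osc mA mc) (@pair1_measurable _ _ E E x)).
  - exact: (measurable_int_rV (f := fun y w => K (x, w) y)).
  move=> y _; rewrite EFinM.
  apply: (@le_trans _ _ ((J x * J y)%:E *
      \int[leb]_w (rho w * `|F (y + w) - F (x + w)|)%:E)%E).
    by rewrite lee_wpmul2l ?lee_fin ?mulr_ge0//; exact: conv_diff_le.
  have mw z : measurable_fun setT (fun w : E => F (z + w)).
    by apply: (measurableT_comp mF); exact: measurable_rVD.
  rewrite -ge0_integralZl//; first last.
  - by rewrite lee_fin mulr_ge0.
  - by move=> w _; rewrite lee_fin mulr_ge0.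
  - apply/measurable_EFinP/measurable_funM => //; apply: measurableT_comp => //.
    exact: measurable_funB.
  rewrite le_eqVlt; apply/orP; left; apply/eqP; apply: eq_integral => w _.
  by rewrite -EFinM /K /=; congr _%:E; ring.
rewrite (@fubini_tonelli _ _ E E R (@lebs R n) (@lebs R n)
  (fun p : E * E => (\int[leb]_y (K p y)%:E)%E) mI I0).
apply: integral_mollifier_le => //.
- exact: (@measurable_fun_fubini_tonelli_G _ _ E E R (@lebs R n)
      (fun p : E * E => (\int[leb]_y (K p y)%:E)%E)).
- by move=> w; apply: integral_ge0 => x _.
move=> w; have hw : ((rho w)%:E * double_osc A (fun x : E => F (x + w)%R) <= (rho w)%:E * C)%E.
  by rewrite lee_wpmul2l ?lee_fin.
apply: le_trans hw.
have mw : measurable_fun setT (fun x : E => F (x + w)).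
  by apply: (measurableT_comp mF); exact: measurable_rVD.
have md := measurable_double_osc mA mw.
rewrite /double_osc -ge0_integralZl//; first last.
- by rewrite lee_fin.
- by move=> x _; apply: integral_ge0 => y _; rewrite lee_fin !mulr_ge0.
- by apply: (measurable_int_rV md) => x y; rewrite !mulr_ge0.
rewrite le_eqVlt; apply/orP; left; apply/eqP; apply: eq_integral => x _.
rewrite -ge0_integralZl//.
- apply/measurable_EFinP.
  exact: (measurableT_comp md (@pair1_measurable _ _ E E x)).
- by rewrite lee_fin.
Qed.

(* By Tonelli, since [conv F rho x - F x] averages increments of [F] of length at most [e]. *)
Lemma conv_dist_integral A F m (C : R) : measurable A -> loc_integrable F ->
  measurable_fun setT m -> (forall x, 0 <= m x) -> line_bound F m -> 0 <= e -> 0 <= C ->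
  (forall v, (\int[leb]_x (\1_A x * m (x + v))%:E <= C%:E)%E) ->
  (\int[leb]_x (\1_A x * `|F x - conv F rho x|)%:E <= (e * C)%:E)%E.
Proof.
move=> mA lF mm m0 FB e0 C0 hC; have mF := loc_measurable lF.
have mJ : measurable_fun setT (\1_A : E -> R) by exact: measurable_indic.
have mc : measurable_fun setT (conv F rho).
  exact: continuous_measurable_rV (conv_continuous lF trho).
pose K (x w : E) : R := \1_A x * (rho w * `|F (x + w) - F x|).
have K0 x w : 0 <= K x w by rewrite !mulr_ge0.
have mK : measurable_fun setT (fun p : E * E => K p.1 p.2).
  apply: measurable_funM; first exact: (measurableT_comp mJ measurable_fst).
  apply: measurable_funM; first exact: (measurableT_comp mrho measurable_snd).
  apply: measurableT_comp => //; apply: measurable_funB.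
    exact: (measurableT_comp mF (measurable_rVD measurable_fst measurable_snd)).
  exact: (measurableT_comp mF measurable_fst).
have mFx (z : E) : measurable_fun setT (fun w : E => F (z + w)).
  by apply: (measurableT_comp mF); exact: measurable_rVD.
apply: (@le_trans _ _ (\int[leb]_x \int[leb]_w (K x w)%:E)%E).
  apply: ge0_le_integral => //.
  - apply/measurable_EFinP/measurable_funM => //; apply: measurableT_comp => //.
    exact: measurable_funB.
  - exact: measurable_int_rV.
  move=> x _; rewrite EFinM.
  apply: le_trans (lee_wpmul2l _ (conv_dist_le x lF)) _ => //.
  rewrite -ge0_integralZl//.
  - apply/measurable_EFinP/measurable_funM => //; apply: measurableT_comp => //.
    exact: measurable_funB.
  - by move=> w _; rewrite lee_fin mulr_ge0.
rewrite (tonelli_rV mK K0); apply: integral_mollifier_le => //.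
- apply: (measurable_int_rV (f := fun w x => K x w)) => //.
  exact: (measurableT_comp mK (@measurable_swap _ _ E E)).
- by move=> w; apply: integral_ge0 => x _; rewrite lee_fin.
(* Beyond distance [e] the mollifier vanishes, so only increments with [|w| <= e] count; they give
   the factor [e]. *)
- move=> w; have [we|ew] := leP `|w| e; last first.
    have r0 : rho w = 0 by case: Hrho => _ _ + _; apply.
    by rewrite (eq_integral (cst 0%E)) ?integral0 ?r0 ?mul0e// => x _; rewrite /K r0 mul0r mulr0.
  pose L (x : E) (s : R) : R := unitI s * (\1_A x * m (x + s *: w)).
  have L0 x s : 0 <= L x s by rewrite !mulr_ge0 ?unitI_ge0.
  have mxs : measurable_fun setT (fun p : E * R => p.1 + p.2 *: w).
    by apply: measurable_rVD; [exact: measurable_fst|apply: measurable_rVZ => //; exact: measurable_snd].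
  have mL : measurable_fun setT (fun p : E * R => L p.1 p.2).
    apply: measurable_funM; first exact: (measurableT_comp (@measurable_unitI R) measurable_snd).
    apply: measurable_funM; first exact: (measurableT_comp mJ measurable_fst).
    exact: (measurableT_comp mm mxs).
  have step : (\int[leb]_x (\1_A x * `|F (x + w) - F x|)%:E <=
      \int[leb]_x (`|w|%:E * \int[mu1]_s (L x s)%:E))%E.
    apply: ae_ge0_le_integral => //.
    - apply/measurable_EFinP/measurable_funM => //; apply: measurableT_comp => //.
      apply: measurable_funB => //; apply: (measurableT_comp mF); exact: measurable_rVD.
    - by move=> x _; apply: mule_ge0 => //; apply: integral_ge0 => s _; rewrite lee_fin.
    - by apply: emeasurable_funM => //; exact: (measurable_int_line mL).
    move: (FB w); apply: filterS => x hx _.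
    have [Ax|nAx] := pselect (A x); last first.
      rewrite indicE memNset// mul0r; apply: mule_ge0 => //.
      by apply: integral_ge0 => s _; rewrite lee_fin.
    rewrite indicE mem_set// mul1r; apply: le_trans hx _.
    rewrite lee_wpmul2l ?lee_fin//.
    by under [leRHS]eq_integral do rewrite /L indicE mem_set// mul1r.
  have -> : (\int[leb]_x (K x w)%:E = (rho w)%:E * \int[leb]_x (\1_A x * `|F (x + w) - F x|)%:E)%E.
    rewrite -ge0_integralZl//.
    - by apply: eq_integral => x _; rewrite -EFinM /K mulrCA.
    - apply/measurable_EFinP/measurable_funM => //; apply: measurableT_comp => //.
      apply: measurable_funB => //; apply: (measurableT_comp mF); exact: measurable_rVD.
    - by rewrite lee_fin.
  rewrite lee_wpmul2l ?lee_fin//; apply: le_trans step _.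
  rewrite ge0_integralZl//; first last.
  - by move=> x _; apply: integral_ge0 => s _; rewrite lee_fin.
  - exact: (measurable_int_line mL).
  rewrite EFinM; apply: (@le_trans _ _ (e%:E * \int[leb]_x \int[mu1]_s (L x s)%:E)%E).
    rewrite lee_wpmul2r ?lee_fin//; apply: integral_ge0 => x _.
    by apply: integral_ge0 => s _; rewrite lee_fin.
  rewrite lee_wpmul2l ?lee_fin// (tonelli_line mL L0).
  have mUI : measurable_fun [set: measurableTypeR R] (fun s : measurableTypeR R => (unitI s)%:E).
    by apply: (@measurableT_comp _ _ _ _ _ _ EFin) => //; exact: measurable_unitI.
  apply: (@le_trans _ _ (\int[mu1]_s ((unitI s)%:E * C%:E))%E).
    have mLs (s : R) : measurable_fun setT (fun x : E => \1_A x * m (x + s *: w)).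
      apply: measurable_funM => //; apply: (measurableT_comp mm).
      exact: measurable_rVD.
    apply: ge0_le_integral => //.
    - by move=> s _; apply: integral_ge0 => x _; rewrite lee_fin.
    - apply: (@measurable_integral1 _ _ (measurableTypeR R) E R (@lebs R n) (fun s x => L x s)) => //.
      exact: (measurableT_comp mL (@measurable_swap _ _ (measurableTypeR R) E)).
    - by apply: emeasurable_funM => //; exact: measurable_cst.
    move=> s _; rewrite /L; under eq_integral do rewrite EFinM.
    rewrite ge0_integralZl//.
    - by rewrite lee_wpmul2l ?lee_fin ?unitI_ge0//.
    - exact/measurable_EFinP.
    - by move=> x _; rewrite lee_fin mulr_ge0.
    - by rewrite lee_fin unitI_ge0.
  rewrite ge0_integralZr//; first by rewrite integral_unitI mul1e.
  by move=> s _; rewrite lee_fin unitI_ge0.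
- by rewrite lee_fin mulr_ge0.
Qed.

(** The graph of a power lies above its tangent at [a]. The terms are arranged without subtraction
    so that the inequality can be integrated in [\bar R]. The induction step adds
    [k.+1%:R * a ^+ k * (u - a) ^+ 2] to [u] times the previous gap. *)
Lemma tangent_power (u a : R) k : 0 <= u -> 0 <= a ->
  a ^+ k.+1 + k.+1%:R * a ^+ k * u <= u ^+ k.+1 + k.+1%:R * a ^+ k * a.
Proof.
move=> u0 a0; elim: k => [|k IH]; first by rewrite !expr1 expr0 !mul1r addrC.
have h1 : 0 <= u * (u ^+ k.+1 + k.+1%:R * a ^+ k * a - (a ^+ k.+1 + k.+1%:R * a ^+ k * u)).
  by rewrite mulr_ge0// subr_ge0.
have h2 : 0 <= k.+1%:R * a ^+ k * (u - a) ^+ 2.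
  by rewrite mulr_ge0 ?sqr_ge0// mulr_ge0// exprn_ge0.
rewrite -subr_ge0; apply: le_trans (addr_ge0 h1 h2) _.
rewrite le_eqVlt; apply/orP; left; apply/eqP; rewrite -[k.+2%:R]natr1 !exprS; ring.
Qed.

(** Jensen's inequality for the probability density [rho]: with the tangent taken at the mean [a],
    the linear terms have equal finite integrals and cancel. *)
Lemma jensen_mollifier u x : loc_integrable u -> (forall x, 0 <= u x) -> (0 < n)%N ->
  ((conv u rho x ^+ n)%:E <= \int[leb]_w (rho w * u (x + w) ^+ n)%:E)%E.
Proof.
move=> lu u0 n0; have lx := loc_integrable_shiftl x lu; have mu := loc_measurable lx.
set a := conv u rho x.
have iu := loc_integrable_tf lx trho.
have aE : (\int[leb]_w (u (x + w) * rho w)%:E = a%:E)%E.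
  by rewrite /a convE// /Rintegral fineK// (integrable_fin_num measurableT).
have a0 : 0 <= a.
  by rewrite -lee_fin -aE; apply: integral_ge0 => w _; rewrite lee_fin mulr_ge0.
have mun : measurable_fun setT (fun w => u (x + w) ^+ n) by exact: measurable_funX.
pose c := n%:R * a ^+ n.-1; have c0 : 0 <= c by rewrite mulr_ge0// exprn_ge0.
have h : (\int[leb]_w ((a ^+ n)%:E * (rho w)%:E + c%:E * (u (x + w) * rho w)%:E) <=
    \int[leb]_w ((rho w * u (x + w) ^+ n)%:E + (c * a)%:E * (rho w)%:E))%E.
  apply: ge0_le_integral => //.
  - by move=> w _; rewrite -!EFinM -EFinD lee_fin addr_ge0// !mulr_ge0// exprn_ge0.
  - by apply: emeasurable_funD; apply/measurable_EFinP; do 3 ?apply: measurable_funM.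
  - by apply: emeasurable_funD; apply/measurable_EFinP; do 3 ?apply: measurable_funM.
  move=> w _; rewrite -!EFinM -!EFinD lee_fin.
  have := tangent_power n.-1 (u0 (x + w)) a0; rewrite prednK// -/c => hh.
  have := ler_wpM2l (rho0 w) hh; rewrite !mulrDr => {}hh.
  by move: hh; congr (_ <= _); ring.
move: h; rewrite !ge0_integralD//; first last.
- by apply/measurable_EFinP; do 3 ?apply: measurable_funM.
- by move=> w _; rewrite -EFinM lee_fin !mulr_ge0// exprn_ge0.
- by apply/measurable_EFinP; do 3 ?apply: measurable_funM.
- by move=> w _; rewrite -EFinM lee_fin !mulr_ge0// exprn_ge0.
- by apply/measurable_EFinP; do 3 ?apply: measurable_funM.
- by move=> w _; rewrite -EFinM lee_fin !mulr_ge0// exprn_ge0.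
- by apply/measurable_EFinP; do 3 ?apply: measurable_funM.
- by move=> w _; rewrite lee_fin !mulr_ge0// exprn_ge0.
rewrite !ge0_integralZl//; first last.
all: try by rewrite lee_fin ?exprn_ge0// mulr_ge0.
all: try by move=> w _; rewrite lee_fin ?mulr_ge0.
all: try by apply/measurable_EFinP; try exact: measurable_funM.
rewrite integral_mollifier !mule1 aE -EFinM.
by rewrite leeD2rE.
Qed.

Lemma conv_power_integral u : loc_integrable u -> (forall x, 0 <= u x) -> (0 < n)%N ->
  (\int[leb]_x (conv u rho x ^+ n)%:E <= \int[leb]_x (u x ^+ n)%:E)%E.
Proof.
move=> lu u0 n0; have mu := loc_measurable lu.
have mc : measurable_fun setT (conv u rho).
  exact: continuous_measurable_rV (conv_continuous lu trho).
pose K (x w : E) : R := rho w * u (x + w) ^+ n.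
have K0 x w : 0 <= K x w by rewrite mulr_ge0// exprn_ge0.
have mK : measurable_fun setT (fun p : E * E => K p.1 p.2).
  apply: measurable_funM; first exact: (measurableT_comp mrho measurable_snd).
  apply: measurable_funX.
  exact: (measurableT_comp mu (measurable_rVD measurable_fst measurable_snd)).
have c0 x : 0 <= conv u rho x.
  by rewrite convE//; apply: Rintegral_ge0 => w _; rewrite mulr_ge0.
apply: (@le_trans _ _ (\int[leb]_x \int[leb]_w (K x w)%:E)%E).
  apply: ge0_le_integral => //.
  - by move=> x _; rewrite lee_fin exprn_ge0.
  - exact/measurable_EFinP/measurable_funX.
  - exact: measurable_int_rV.
  - by move=> x _; exact: jensen_mollifier.
have mun : measurable_fun setT (fun x => (u x ^+ n)%:E) by exact/measurable_EFinP/measurable_funX.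
rewrite (tonelli_rV mK K0); apply: integral_mollifier_le.
- apply: (measurable_int_rV (f := fun w x => K x w)) => //.
  exact: (measurableT_comp mK (@measurable_swap _ _ E E)).
- by move=> w; apply: integral_ge0 => x _; rewrite lee_fin.
- move=> w; rewrite /K; under eq_integral do rewrite EFinM.
  rewrite ge0_integralZl//.
  + by rewrite (ge0_integral_shift w (f := fun x => (u x ^+ n)%:E))// => x; rewrite lee_fin exprn_ge0.
  + apply/measurable_EFinP/measurable_funX; apply: (measurableT_comp mu).
    exact: measurable_rVD.
  + by move=> x _; rewrite lee_fin exprn_ge0.
  + by rewrite lee_fin.
- by apply: integral_ge0 => x _; rewrite lee_fin exprn_ge0.
Qed.

End mollifier.

(** * Approximation by mollifications in BMO *)

Section mollifier_bmo.
Context (R : realType) (n : nat).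
Local Notation E := 'rV[R]_n.
Local Notation leb := (@lebesgue_rV R n).
Implicit Types (F g h m rho : E -> R) (A B : set E).

Lemma indic_cube_shift (a v x : E) (l : R) :
  \1_(cube a l) x = \1_(cube (a + v) l) (x + v) :> R.
Proof.
rewrite !indicE; congr ((_ : bool)%:R); apply/idP/idP; rewrite !inE => h i;
  by have := h i; rewrite !mxE; lra.
Qed.

Lemma double_osc_cube_shift F (a v : E) (l : R) : measurable_fun setT F ->
  double_osc (cube a l) (fun x : E => F (x + v)) = double_osc (cube (a + v) l) F.
Proof.
move=> mF; have md := measurable_double_osc (measurable_cube (a + v) l) mF.
rewrite /double_osc -[RHS](ge0_integral_shift v); first last.
- by move=> x; apply: integral_ge0 => y _; rewrite lee_fin !mulr_ge0.
- by apply: (measurable_int_rV md) => x y; rewrite !mulr_ge0.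
apply: eq_integral => x _; rewrite -[RHS](ge0_integral_shift v); first last.
- by move=> y; rewrite lee_fin !mulr_ge0.
- apply/measurable_EFinP.
  exact: (measurableT_comp md (@pair1_measurable _ _ E E (x + v))).
by apply: eq_integral => y _; rewrite -!indic_cube_shift.
Qed.

Lemma double_osc_cube F m (a : E) (l J : R) : (0 < n)%N -> 0 < l ->
  loc_integrable F -> measurable_fun setT m -> (forall x, 0 <= m x) ->
  line_bound F m -> 0 < J ->
  (\int[leb]_x (\1_(cube a l) x * m x ^+ n)%:E <= (J ^+ n)%:E)%E ->
  (double_osc (cube a l) F <= ((l ^+ n) ^+ 2 * (2 ^+ n.+1 * J))%:E)%E.
Proof.
move=> n0 l0 lF mm m0 FB J0 mJ; have l0' := ltW l0.
have := @leb_avg_poincare R n F m (cube a l) l 1 (`|a| + l) J n0 (measurable_cube a l)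
  (@cube_convex R n a l) (addr_ge0 (normr_ge0 a) l0') (cube_cbox l0')
  (fun x y => cube_diam l0') l0 ltr01.
rewrite leb_cube// mul1r invr1 mul1r /= => /(_ (lexx _) (lexx _) lF mm m0 FB J0 mJ).
by rewrite lee_pdivrMl ?exprn_gt0// EFinM.
Qed.

(** Supplies the bound uniform over translations that [conv_dist_integral] asks for. *)
Lemma integral_cube_shift_le m (a v : E) (l J : R) : (0 < n)%N ->
  measurable_fun setT m -> (forall x, 0 <= m x) -> 0 < J -> 0 < l ->
  (\int[leb]_x (m x ^+ n)%:E <= (J ^+ n)%:E)%E ->
  (\int[leb]_x (\1_(cube a l) x * m (x + v)%R)%:E <= (2 * J * l ^+ n.-1)%:E)%E.
Proof.
move=> n0 mm m0 J0 l0 mJ; have mc := measurable_cube (a + v) l.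
have mi : measurable_fun setT (\1_(cube (a + v) l) : E -> R) by exact: measurable_indic.
under eq_integral do rewrite (indic_cube_shift _ v).
rewrite (ge0_integral_shift v (f := fun x => (\1_(cube (a + v) l) x * m x)%:E)); first last.
- by move=> x; rewrite lee_fin mulr_ge0.
- exact/measurable_EFinP/measurable_funM.
apply: power_mean => //; first by rewrite leb_cube// ltW.
apply: le_trans mJ; apply: le_integralT.
- by apply: measurable_funM => //; exact: measurable_funX.
- exact: measurable_funX.
- by move=> x; rewrite mulr_ge0 ?exprn_ge0//= ler_piMl ?exprn_ge0.
Qed.

(* On small cubes both oscillations are small by absolute continuity of the
   integral of [m ^+ n]; on large ones [F] and [conv F rho] are close in mean. *)
Lemma double_osc_mollify F m (eta : R) : (0 < n)%N -> 0 < eta ->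
  loc_integrable F -> measurable_fun setT m -> (forall x, 0 <= m x) ->
  line_bound F m -> (\int[leb]_x (m x ^+ n)%:E < +oo)%E ->
  exists2 e, 0 < e & forall rho, mollifier e rho -> forall (a : E) (l : R), 0 < l ->
    (double_osc (cube a l) (fun x => F x - conv F rho x)%R <= ((l ^+ n) ^+ 2 * eta)%:E)%E.
Proof.
move=> n0 eta0 lF mm m0 FB moo; have mF := loc_measurable lF.
have mn : measurable_fun setT (fun x => m x ^+ n) by exact: measurable_funX.
have mi : leb.-integrable setT (EFin \o (fun x => m x ^+ n)).
  apply/integrableP; split; first exact/measurable_EFinP.
  by under eq_integral do rewrite /= ger0_norm ?exprn_ge0//.
(* On a small cube [double_osc_cube] costs the factor [2 ^+ n.+1], so that [F] and its mollification
   receive [eta / 2] each. *)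
pose mu := eta / 2 ^+ n.+2; have mu0 : 0 < mu by rewrite divr_gt0// exprn_gt0.
have [d [d0 hd]] := integral_normr_continuous mi (exprn_gt0 n mu0).
have small A : measurable A -> (leb A < d%:E)%E ->
    (\int[leb]_x (\1_A x * m x ^+ n)%:E <= (mu ^+ n)%:E)%E.
  move=> mA Ad; have := hd A mA Ad.
  under eq_Rintegral do rewrite ger0_norm ?exprn_ge0//.
  rewrite Rintegral_indicM /Rintegral => /ltW; rewrite -lee_fin fineK//.
  apply: (integrable_fin_num measurableT).
  apply: (@le_integrable _ _ _ _ _ _ _ (EFin \o (fun x => m x ^+ n))) => //.
    by apply/measurable_EFinP/measurable_funM => //; exact: measurable_indic.
  move=> x _ /=; rewrite lee_fin !ger0_norm ?mulr_ge0 ?exprn_ge0//.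
  by rewrite ler_piMl ?exprn_ge0.
pose I := fine (\int[leb]_x (m x ^+ n)%:E).
have I0 : 0 <= I.
  by apply: fine_ge0; apply: integral_ge0 => x _; rewrite lee_fin exprn_ge0.
(* As [J >= 1], the integral is at most [J ^+ n]; this avoids an [n]-th root. *)
pose J := I + 1; have J0 : 0 < J by rewrite ltr_pwDr.
have mJ : (\int[leb]_x (m x ^+ n)%:E <= (J ^+ n)%:E)%E.
  have -> : (\int[leb]_x (m x ^+ n)%:E = I%:E)%E.
    by rewrite /I fineK// (integrable_fin_num measurableT).
  rewrite lee_fin (@le_trans _ _ J)// ?lerDl// -[leLHS]expr1 ler_weXn2l//.
  by rewrite lerDr.
(* For [l <= l0] the volume satisfies [l ^+ n <= l < d], the threshold of absolute continuity. *)
pose l0 := Num.min 1 (d / 2).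
have l00 : 0 < l0 by rewrite lt_min ltr01 divr_gt0.
(* For a large cube the estimates multiply to [4 * J * e * l ^ (2 n - 1)], which this choice makes
   [eta * l0 * l ^ (2 n - 1)], below [eta * l ^ (2 n)] when [l0 < l]. *)
pose e := eta * l0 / (4 * J); have e0 : 0 < e by rewrite divr_gt0 ?mulr_gt0.
exists e => // rho Hr a l lgt0; have [trho _ _ _] := Hr.
have mc : measurable_fun setT (conv F rho).
  exact: continuous_measurable_rV (conv_continuous lF trho).
have mQ := measurable_cube a l.
have l2 : 0 <= (l ^+ n) ^+ 2 by exact: sqr_ge0.
have [ll0|l0l] := leP l l0.
  have leb_small (b : E) : (leb (cube b l) < d%:E)%E.
    rewrite leb_cube ?(ltW lgt0)// lte_fin; apply: (@le_lt_trans _ _ l).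
      rewrite -[leRHS]expr1 ler_wiXn2l// ?(ltW lgt0)//.
      by rewrite (le_trans ll0)// ge_min lexx.
    apply: le_lt_trans ll0 _; rewrite gt_min; apply/orP; right.
    by rewrite ltr_pdivrMr// ltr_pMr// ltr1n.
  have dF (b : E) : (double_osc (cube b l) F <= ((l ^+ n) ^+ 2 * (eta / 2))%:E)%E.
    have -> : eta / 2 = 2 ^+ n.+1 * mu.
      rewrite /mu [2 ^+ n.+2]exprS; have : (2 : R) ^+ n.+1 != 0 by rewrite expf_neq0.
      by move: ((2 : R) ^+ n.+1) => p p0; field.
    exact: (double_osc_cube n0 lgt0 lF mm m0 FB mu0 (small _ (measurable_cube b l) (leb_small b))).
  apply: le_trans (le_double_oscD mQ mF (measurable_funN mc)) _.
  rewrite double_oscN.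
  have -> : (l ^+ n) ^+ 2 * eta = (l ^+ n) ^+ 2 * (eta / 2) + (l ^+ n) ^+ 2 * (eta / 2) by field.
  rewrite EFinD; apply: leeD; first exact: dF.
  apply: (double_osc_conv Hr mQ lF).
    by rewrite lee_fin mulr_ge0// divr_ge0// ltW.
  by move=> w; rewrite double_osc_cube_shift.
have mD : measurable_fun setT (fun x => F x - conv F rho x) by exact: measurable_funB.
apply: le_trans (double_osc_le_norm mQ mD) _.
have C0 : 0 <= 2 * J * l ^+ n.-1.
  by rewrite !mulr_ge0 ?exprn_ge0 ?(ltW J0) ?(ltW lgt0).
have hC v : (\int[leb]_x (\1_(cube a l) x * m (x + v)%R)%:E <= (2 * J * l ^+ n.-1)%:E)%E.
  exact: integral_cube_shift_le.
have := conv_dist_integral Hr mQ lF mm m0 FB (ltW e0) C0 hC.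
rewrite leb_cube ?(ltW lgt0)// => h.
apply: (@le_trans _ _ (2%:E * ((l ^+ n)%:E * (e * (2 * J * l ^+ n.-1))%:E))%E).
  by rewrite lee_wpmul2l ?lee_fin// lee_wpmul2l ?lee_fin ?exprn_ge0 ?(ltW lgt0).
rewrite -!EFinM lee_fin.
have -> : 2 * (l ^+ n * (e * (2 * J * l ^+ n.-1))) = l ^+ n * l ^+ n.-1 * (eta * l0).
  by rewrite /e; field; rewrite gt_eqF.
have -> : (l ^+ n) ^+ 2 * eta = l ^+ n * l ^+ n.-1 * (eta * l).
  by rewrite expr2 -[in X in _ * X * _](prednK n0) exprS; ring.
by rewrite ler_wpM2l ?mulr_ge0 ?exprn_ge0 ?(ltW lgt0)// ler_wpM2l ?(ltW eta0)// ltW.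
Qed.

End mollifier_bmo.

(** * Logarithmic cutoffs *)

Section cutoff.
Context (R : realType) (n : nat).
Local Notation E := 'rV[R]_n.
Local Notation leb := (@lebesgue_rV R n).
Local Notation mu1 := (@lebesgue_measure R).
Implicit Types (F U h m : E -> R) (A B : set E).

Lemma continuous_compR (T : R -> R) U : continuous T -> continuous U ->
  continuous (fun x => T (U x)).
Proof. by move=> cT cU x; exact: (continuous_cvg _ (cT (U x)) (cU x)). Qed.

Lemma continuous_subr F U : continuous F -> continuous U ->
  continuous (fun x => F x - U x).
Proof. by move=> cF cU x; exact: cvgB (cF x) (cU x). Qed.

Lemma is_derive_compR (T : R -> R) U (x v : E) (a b : R) :
  is_derive (U x) 1 T a -> is_derive x v U b -> is_derive x v (fun y => T (U y)) (a * b).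
Proof.
move=> Ta /is_derive_line Ub; apply/is_derive_line.
apply: (@is_derive1_comp _ T (fun t : R => U (x + t *: v))) => //.
by rewrite scale0r addr0.
Qed.

(** For C^1 functions the fundamental theorem of calculus gives the bound at every point. It brings
    the remainder of the cutoff under the same Poincare estimate as [F]. *)
Lemma line_bound_C1 h m (D : E -> E -> R) :
  (forall v x, is_derive x v h (D v x)) -> (forall v, continuous (D v)) ->
  measurable_fun setT m -> (forall x, 0 <= m x) ->
  (forall v x, `|D v x| <= `|v| * m x) -> line_bound h m.
Proof.
move=> hD cD mm m0 Dm v; apply: aeW => x.
have dh (s : R) : is_derive s 1 (fun u : R => h (x + u *: v)) (D v (x + s *: v)).
  by apply: is_derive_along; exact: hD.
have cl : continuous (fun s : R => x + s *: v).
  by move=> s; apply: cvgD; [exact: cvg_cst|apply: cvgZr_tmp; exact: cvg_id].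
have cDl : continuous (fun s : R => D v (x + s *: v)).
  by move=> s; exact: (continuous_cvg _ (cD v (x + s *: v)) (cl s)).
have ch : continuous (fun s : R => h (x + s *: v)).
  by move=> s; apply/differentiable_continuous/derivable1_diffP; have [] := dh s.
have FTC := @continuous_FTC2 R (fun s : R => D v (x + s *: v))
  (fun s : R => h (x + s *: v)) 0 1 ltr01 (continuous_subspaceT cDl).
have {}FTC : (\int[mu1]_(s in `[0%R, 1%R]) (D v (x + s *: v))%:E =
    (h (x + v) - h x)%:E)%E.
  rewrite FTC; first by rewrite scale1r scale0r addr0 EFinB.
  - split.
    + by move=> s _; have [] := dh s.
    + by apply: cvg_at_right_filter; exact: ch.
    + by apply: cvg_at_left_filter; exact: ch.
  - by move=> s _; rewrite derive1E; exact: (@derive_val _ _ _ _ _ _ _ (dh s)).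
have mD : measurable_fun [set: measurableTypeR R] (fun s : R => D v (x + s *: v)).
  exact: continuous_measurable_fun.
rewrite -[`|_|%:E]/(`|(h (x + v) - h x)%:E|%E) -FTC.
apply: le_trans (le_abse_integral _ _ _) _.
- exact: measurable_itv.
- exact/measurable_funTS/measurable_EFinP.
have mms : measurable_fun [set: measurableTypeR R] (fun s : R => m (x + s *: v)).
  apply: (measurableT_comp mm); apply: measurable_rVD; first exact: measurable_cst.
  by apply: measurable_rVZ; [exact: measurable_id|exact: measurable_cst].
rewrite integral_mkcond -ge0_integralZl//.
- apply: ge0_le_integral => //.
  + by move=> s _; rewrite erestrict_ge0.
  + apply/(measurable_restrictT _ _).1; first exact: measurable_itv.
    by apply: measurable_funTS; apply: measurableT_comp => //; exact/measurable_EFinP.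
  + by apply: emeasurable_funM; [exact: measurable_cst|
      apply/measurable_EFinP/measurable_funM => //; exact: measurable_unitI].
  move=> s _; rewrite patchE /unitI indicE -EFinM.
  by case: ifP => _ /=; rewrite lee_fin ?mul1r ?mul0r ?mulr0.
- by apply/measurable_EFinP/measurable_funM => //; exact: measurable_unitI.
- by move=> s _; rewrite lee_fin mulr_ge0 ?unitI_ge0.
Qed.

Definition sum_sqr (x : E) : R := \sum_(i < n) x ord0 i ^+ 2.

Lemma sum_sqr_ge0 x : 0 <= sum_sqr x.
Proof. by apply: sumr_ge0 => i _; exact: sqr_ge0. Qed.

Lemma norm_le_sum_sqr x : `|x| ^+ 2 <= sum_sqr x.
Proof.
rewrite -(@sqr_sqrtr _ (sum_sqr x)) ?sum_sqr_ge0// lerXn2r ?nnegrE ?sqrtr_ge0//.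
exact: norm_le_enorm.
Qed.

Lemma continuous_sum_sqr : continuous sum_sqr.
Proof.
apply: (@Mk_continuous R n 0); apply: Mk_sum => i.
apply: (@MkM R n 0 (fun x => x ord0 i)(fun x => x ord0 i)); exact: continuous_coord.
Qed.

Lemma is_derive_sum_sqr x v : is_derive x v sum_sqr (2 * \sum_i x ord0 i * v ord0 i).
Proof.
have d i : is_derive x v (fun y : E => y ord0 i ^+ 2) (2 * (x ord0 i * v ord0 i)).
  have d1 : is_derive x v (fun y : E => y ord0 i) (v ord0 i).
    apply/is_derive_line.
    have := @is_derive_affine R id (v ord0 i) (x ord0 i) 0 1 (is_derive_id _ _).
    rewrite mulr1; congr (is_derive _ _ _ _); apply/funext => t.
    by rewrite !mxE addrC mulrC.
  by apply: (is_derive_eq (is_deriveM d1 d1)); rewrite /GRing.scale /=; ring.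
have := is_derive_sum d; rewrite mulr_sumr; congr (is_derive _ _ _ _).
by apply/funext => y; rewrite fct_sumE.
Qed.

(** A substitute for [2 * ln |x|] that is smooth at the origin. Its derivative is of size
    [1 / (1 + |x|)], the borderline case for integrability of the [n]-th power. *)
Definition log_sqr (x : E) : R := ln (1 + sum_sqr x).

Lemma one_sum_sqr_gt0 x : 0 < 1 + sum_sqr x.
Proof. by rewrite ltr_pwDl// sum_sqr_ge0. Qed.

Lemma continuous_one_sum_sqr : continuous (fun x => 1 + sum_sqr x).
Proof. exact: (@MkD R n 0 _ _ (@Mk_cst R n 0 1) continuous_sum_sqr). Qed.

Lemma continuous_inv_pos U : continuous U -> (forall x, 0 < U x) ->
  continuous (fun x => (U x)^-1).
Proof. by move=> cU U0 x; exact: (cvgV (lt0r_neq0 (U0 x)) (cU x)). Qed.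

Lemma continuous_log_sqr : continuous log_sqr.
Proof.
move=> x; apply: (@continuous_comp _ _ _ (fun y => 1 + sum_sqr y) (@ln R)).
  exact: continuous_one_sum_sqr.
exact: continuous_ln (one_sum_sqr_gt0 x).
Qed.

Definition dlog_sqr (v x : E) : R := (1 + sum_sqr x)^-1 * (2 * \sum_i x ord0 i * v ord0 i).

Lemma is_derive_log_sqr x v : is_derive x v log_sqr (dlog_sqr v x).
Proof.
apply: (@is_derive_compR (@ln R) (fun y => 1 + sum_sqr y)).
  exact: is_derive1_ln (one_sum_sqr_gt0 x).
have := is_deriveD (is_derive_cst (1 : R) x v) (is_derive_sum_sqr x v).
by rewrite add0r.
Qed.

Lemma continuous_dlog_sqr v : continuous (dlog_sqr v).
Proof.
apply: (@MkM R n 0).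
  exact: continuous_inv_pos continuous_one_sum_sqr one_sum_sqr_gt0.
apply: (@MkZ R n 0); apply: Mk_sum => i.
apply: (@MkM R n 0 (fun x => x ord0 i)); first exact: continuous_coord.
exact: Mk_cst.
Qed.

Lemma dlog_sqr_le v x : `|dlog_sqr v x| <= `|v| * (4 * n%:R / (1 + `|x|)).
Proof.
have s0 := one_sum_sqr_gt0 x.
have m0 : 0 < 1 + `|x| by rewrite ltr_pwDl.
have h1 : `|\sum_i x ord0 i * v ord0 i| <= n%:R * (`|x| * `|v|).
  rewrite (le_trans (ler_norm_sum _ _ _))//.
  rewrite -[X in X%:R * _](card_ord n) -sumr_const mulr_suml.
  by apply: ler_sum => i _; rewrite mul1r normrM ler_pM// coord_le_norm.
have h2 : `|x| / (1 + sum_sqr x) <= 2 / (1 + `|x|).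
  rewrite ler_pdivrMr// mulrAC ler_pdivlMr//.
  have := norm_le_sum_sqr x; have := normr_ge0 x; nra.
rewrite /dlog_sqr !normrM (@gtr0_norm _ (_^-1)) ?invr_gt0// (@gtr0_norm _ 2)//.
apply: (@le_trans _ _ ((1 + sum_sqr x)^-1 * (2 * (n%:R * (`|x| * `|v|))))).
  by rewrite ler_wpM2l ?invr_ge0 ?(ltW s0)// ler_wpM2l.
have -> : (1 + sum_sqr x)^-1 * (2 * (n%:R * (`|x| * `|v|))) =
  `|v| * (2 * n%:R * (`|x| / (1 + sum_sqr x))) by ring.
have -> : 4 * n%:R / (1 + `|x|) = 2 * n%:R * (2 / (1 + `|x|)) by ring.
by rewrite ler_wpM2l// ler_wpM2l// mulr_ge0.
Qed.

(** A crude bound by a perfect square: [1 + |x| ^ 2 <= e ^ K <= 4 ^ K] becomes the dyadic radius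
    [2 ^ K] in [log_sqr_cbox]. *)
Lemma expR1_le4 : expR (1 : R) <= 4.
Proof.
have h : expR (2^-1 : R) <= 2.
  have := expR_ge1Dx (- 2^-1 : R); rewrite expRN => h.
  have e0 := expR_gt0 (2^-1 : R).
  have : 2^-1 * expR (2^-1 : R) <= 1.
    rewrite -ler_pdivlMr// div1r; apply: le_trans h; lra.
  lra.
have -> : (1 : R) = 2^-1 + 2^-1 by field.
rewrite expRD; have := expR_ge0 (2^-1 : R); nra.
Qed.

Lemma log_sqr_cbox x (K : nat) : log_sqr x <= K%:R -> cbox (2 ^+ K) x.
Proof.
move=> xK; rewrite cboxE ?exprn_ge0//=.
have h : 1 + sum_sqr x <= 4 ^+ K.
  apply: (@le_trans _ _ (expR K%:R)).
    by rewrite -(@lnK _ (1 + sum_sqr x)) ?posrE ?one_sum_sqr_gt0// ler_expR.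
  rewrite -[K%:R]mulr1 expRM_natl; apply: lerXn2r; rewrite ?nnegrE ?expR_ge0//.
  exact: expR1_le4.
rewrite -(@ler_pXn2r _ 2)// ?nnegrE ?exprn_ge0// -exprM mulnC exprM.
have -> : (2 : R) ^+ 2 = 4 by ring.
by apply: le_trans h; have := norm_le_sum_sqr x; lra.
Qed.

(** Each dyadic shell beyond [2 ^ K] has volume at most [(4 * 2 ^ K) ^ n], and the integrand is at
    most [(2 ^ K) ^- n] there, so a shell costs [4 ^ n]. The integral grows linearly in [K], the
    logarithm of the radius. *)
Lemma integral_max_norm (K : nat) :
  (\int[leb]_x (\1_(cbox (2 ^+ K)) x * (1 + `|x|) ^- n)%:E <= (K.+1%:R * 4 ^+ n)%:E)%E.
Proof.
have mx : measurable_fun setT (fun x : E => (1 + `|x|) ^- n).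
  apply: continuous_measurable_rV; rewrite (_ : (fun _ => _) = (fun x : E => ((1 + `|x|)^-1) ^+ n)).
    apply: (@continuous_compR (fun t : R => t ^+ n)); first exact: exprn_continuous.
    apply: continuous_inv_pos => [|x]; last by rewrite ltr_pwDl.
    exact: (@MkD R n 0 _ _ (@Mk_cst R n 0 1) (@norm_continuous _ E)).
  by apply/funext => x; rewrite exprVn.
have mm0 (x : E) : 0 < 1 + `|x| by rewrite ltr_pwDl.
elim: K => [|K IH].
  apply: (@le_trans _ _ (leb (cbox 1))).
    rewrite -integral_indicE; last exact: measurable_cbox.
    apply: le_integralT.
    - by apply: measurable_funM => //; apply: measurable_indic; exact: measurable_cbox.
    - by apply: measurable_indic; exact: measurable_cbox.
    move=> x; rewrite mulr_ge0 ?invr_ge0 ?exprn_ge0 ?(ltW (mm0 x))//= expr0 ler_piMr//.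
    by rewrite invf_le1 ?exprn_gt0// exprn_ege1// lerDl.
  rewrite leb_cbox// mul1r lee_fin mulr1 lerXn2r ?nnegrE//; lra.
apply: (@le_trans _ _ (\int[leb]_x (\1_(cbox (2 ^+ K)) x * (1 + `|x|) ^- n +
    (2 ^+ K) ^- n * \1_(cbox (2 ^+ K.+1)) x)%:E)%E).
  apply: le_integralT.
  - by apply: measurable_funM => //; apply: measurable_indic; exact: measurable_cbox.
  - apply: measurable_funD.
      by apply: measurable_funM => //; apply: measurable_indic; exact: measurable_cbox.
    by apply: measurable_funM => //; apply: measurable_indic; exact: measurable_cbox.
  move=> x; have i0 : 0 <= (1 + `|x|) ^- n by rewrite invr_ge0 exprn_ge0 ?(ltW (mm0 x)).
  rewrite mulr_ge0//=; have [xK|xK] := pselect ((cbox (2 ^+ K) : set E) x).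
    rewrite [X in _ <= X * _ + _]indicE mem_set// mul1r.
    rewrite ler_wpDr ?mulr_ge0 ?invr_ge0 ?exprn_ge0//.
    by rewrite ler_piMl// indicE; case: (_ \in _).
  rewrite [X in _ <= X * _ + _]indicE memNset// mul0r add0r mulrC ler_wpM2r//.
  have xK' : 2 ^+ K < `|x|.
    by move: xK; rewrite cboxE ?exprn_ge0//= => /negP; rewrite -ltNge.
  rewrite lef_pV2 ?posrE ?exprn_gt0// lerXn2r ?nnegrE ?exprn_ge0 ?(ltW (mm0 x))//.
  by rewrite (le_trans (ltW xK'))// lerDr.
under eq_integral do rewrite EFinD.
rewrite ge0_integralD//; first last.
- by apply/measurable_EFinP/measurable_funM => //; apply: measurable_indic; exact: measurable_cbox.
- by apply/measurable_EFinP/measurable_funM => //; apply: measurable_indic; exact: measurable_cbox.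
have -> : (\int[leb]_x ((2 ^+ K) ^- n * \1_(cbox (2 ^+ K.+1)) x)%:E = (4 ^+ n)%:E)%E.
  under eq_integral do rewrite EFinM.
  rewrite ge0_integralZl//.
  - rewrite integral_indicE; last exact: measurable_cbox.
    rewrite leb_cbox ?exprn_ge0// -EFinM; congr _%:E.
    rewrite -exprVn -exprMn; congr (_ ^+ _); rewrite exprS; field.
    exact: expf_neq0.
  by apply/measurable_EFinP; apply: measurable_indic; exact: measurable_cbox.
by rewrite -[K.+2%:R]natr1 mulrDl mul1r EFinD leeD2r.
Qed.

(** A smooth profile that vanishes from 1 on, normalised to 1 at 0; with continuity there, the
    cutoffs [chi k] converge to 1 pointwise. In [dcut], [flat 2] is the derivative of [flat 0]. *)
Definition cut (s : R) : R := (flat 0 1)^-1 * flat 0 (-1 * s + 1).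
Definition dcut (s : R) : R := (flat 0 1)^-1 * (-1 * flat 2 (-1 * s + 1)).

Lemma is_derive_cut (s : R) : is_derive s 1 cut (dcut s).
Proof.
have h : is_derive (-1 * s + 1) 1 (@flat R 0) (flat 2 (-1 * s + 1)).
  by have := is_derive_flat 0 (-1 * s + 1); rewrite mul0r subr0.
exact: (@is_deriveZ _ _ _ _ (flat 0 1)^-1 _ _ _ (is_derive_affine h)).
Qed.

Lemma continuous_flat k : continuous (@flat R k).
Proof.
move=> t; apply/differentiable_continuous/derivable1_diffP.
by have [] := is_derive_flat k t.
Qed.

Lemma continuous_cut : continuous cut.
Proof.
by move=> s; apply/differentiable_continuous/derivable1_diffP; have [] := is_derive_cut s.
Qed.

Lemma continuous_dcut : continuous dcut.
Proof.
have h : continuous (fun s : R => -1 * s + 1).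
  by move=> s; exact: (cvgD (cvgM (cvg_cst (-1 : R)) cvg_id) (cvg_cst (1 : R))).
move=> s; have hs : flat 2 (-1 * t + 1) @[t --> s] --> flat 2 (-1 * s + 1).
  exact: (continuous_cvg _ (@continuous_flat 2 (-1 * s + 1)) (h s)).
exact: (cvgM (cvg_cst _) (cvgM (cvg_cst (-1 : R)) hs)).
Qed.

(** The number 24 is the factorial of 4 in [flat_le] for [flat 2]. *)
Definition cutC : R := 24 / flat 0 1.

Lemma flat1_gt0 : 0 < flat 0 (1 : R). Proof. exact: flat_gt0. Qed.

Lemma cut_arg_le0 (s : R) : 1 <= s -> -1 * s + 1 <= 0.
Proof. by rewrite mulN1r addrC subr_le0. Qed.

Lemma dcut_le (s : R) : 0 <= s -> `|dcut s| <= cutC.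
Proof.
move=> s0; have f0 := flat1_gt0; rewrite /dcut normrM mulN1r normrN gtr0_norm ?invr_gt0//.
rewrite mulrC ler_pM2r ?invr_gt0//.
have [s1|s1] := leP 1 s.
  by rewrite /flat cut_arg_le0// normr0.
rewrite (le_trans (flat_le _ _))//.
have -> : (4`!)%:R = 24 :> R by [].
rewrite ler_piMr// expr_le1//; lra.
Qed.

Lemma cut_ge1 (s : R) : 1 <= s -> cut s = 0.
Proof. by move=> s1; rewrite /cut [X in _ * X]flat0 ?mulr0// cut_arg_le0. Qed.

Lemma dcut_ge1 (s : R) : 1 <= s -> dcut s = 0.
Proof.
by move=> s1; rewrite /dcut /flat cut_arg_le0// !mulr0.
Qed.

Lemma cut0 : cut 0 = 1.
Proof. by rewrite /cut mulr0 add0r mulVf// gt_eqF// flat1_gt0. Qed.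

Lemma cut_le s : `|cut s| <= (flat 0 1)^-1.
Proof.
have f0 := flat1_gt0; rewrite /cut normrM gtr0_norm ?invr_gt0//.
by rewrite ler_piMr ?invr_ge0 ?(ltW f0)// ger0_norm ?flat_ge0// flat_le1.
Qed.

End cutoff.

(** * Approximation of a smooth function by functions vanishing at infinity *)

Section cutoff_approximation.
Context (R : realType) (n : nat).
Local Notation E := 'rV[R]_n.
Local Notation leb := (@lebesgue_rV R n).
Implicit Types (F h m : E -> R) (A B : set E).

(** To be instantiated with mollifications: [U] of the function, [G] of its weak gradient, and [M]
    of the sum of the absolute values of the components of that gradient. *)
Variables (U M : E -> R) (G : 'I_n -> E -> R).
Hypotheses (cU : continuous U) (cG : forall j, continuous (G j)).
Hypothesis dU : forall x v, is_derive x v U (\sum_j v ord0 j * G j x).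
Hypotheses (mM : measurable_fun setT M) (GM : forall j x, `|G j x| <= M x).
Hypothesis M0 : forall x, 0 <= M x.

Let kR k : R := k.+1%:R.
(** With height [k] and [K] shells the cutoff term has integral of order [k ^ n * K ^ (1 - n)]; the
    fourth power makes this [k ^ (4 - 3 n)], which tends to 0 from [n = 2] on. *)
Let K k : nat := (k.+1 ^ 4)%N.
Let KR k : R := (K k)%:R.

Let kR0 k : 0 < kR k. Proof. by rewrite ltr0n. Qed.
Let KR0 k : 0 < KR k. Proof. by rewrite ltr0n expn_gt0. Qed.

(** A smooth truncation at a height comparable to [kR k]. Its slope lies in [0, 1] and tends to 1 at
    each point, so truncating does not spoil the gradient in the limit. *)
Definition trunc k (u : R) : R := kR k * atan ((kR k)^-1 * u).
Definition dtrunc k (u : R) : R := (1 + ((kR k)^-1 * u) ^+ 2)^-1.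
Definition chi k (x : E) : R := cut ((KR k)^-1 * log_sqr x).
Definition dchi k (v x : E) : R := dcut ((KR k)^-1 * log_sqr x) * ((KR k)^-1 * dlog_sqr v x).

Lemma is_derive_trunc k (u : R) : is_derive u 1 (trunc k) (dtrunc k u).
Proof.
have h : is_derive u 1 (fun t => atan ((kR k)^-1 * t + 0)) ((kR k)^-1 * dtrunc k u).
  by apply: is_derive_affine; rewrite addr0; exact: is_derive1_atan.
have := @is_deriveZ _ _ _ _ (kR k) _ _ _ h.
rewrite /GRing.scale/= mulrA divff ?gt_eqF// mul1r.
by congr (is_derive _ _ _ _); apply/funext => t; rewrite /trunc /= addr0.
Qed.

Lemma continuous_trunc k : continuous (trunc k).
Proof.
by move=> s; apply/differentiable_continuous/derivable1_diffP; have [] := is_derive_trunc k s.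
Qed.

Lemma dtrunc_arg_gt0 k (u : R) : 0 < 1 + ((kR k)^-1 * u) ^+ 2.
Proof. by rewrite ltr_pwDl// sqr_ge0. Qed.

Lemma dtrunc_itv k u : 0 <= dtrunc k u <= 1.
Proof.
have h := dtrunc_arg_gt0 k u.
by rewrite /dtrunc invr_ge0 (ltW h)/= invf_le1// lerDl sqr_ge0.
Qed.

Lemma trunc_le k u : `|trunc k u| <= kR k * 2.
Proof.
rewrite /trunc normrM gtr0_norm// ler_wpM2l ?(ltW (kR0 k))//.
have := @atan_ltpi2 R ((kR k)^-1 * u); have := @atan_gtNpi2 R ((kR k)^-1 * u).
have /andP[_ p4] := @pihalf_02 R => a1 a2.
rewrite ler_norml; apply/andP; split; lra.
Qed.

Lemma continuous_chi k : continuous (chi k).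
Proof.
apply: (@continuous_compR R n (@cut R)); first exact: continuous_cut.
apply: (@MkZ R n 0); exact: continuous_log_sqr.
Qed.

Lemma is_derive_chi k x v : is_derive x v (chi k) (dchi k v x).
Proof.
apply: (@is_derive_compR R n (@cut R)); first exact: is_derive_cut.
exact: (@is_deriveZ _ _ _ _ (KR k)^-1 _ _ _ (is_derive_log_sqr x v)).
Qed.

Lemma continuous_dchi k v : continuous (dchi k v).
Proof.
apply: (@MkM R n 0).
  apply: (@continuous_compR R n (@dcut R)); first exact: continuous_dcut.
  by apply: (@MkZ R n 0); exact: continuous_log_sqr.
by apply: (@MkZ R n 0); exact: continuous_dlog_sqr.
Qed.

Definition cut_trunc k (x : E) : R := chi k x * trunc k (U x).

Lemma continuous_cut_trunc k : continuous (cut_trunc k).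
Proof.
apply: (@MkM R n 0); first exact: continuous_chi.
by apply: continuous_compR => //; exact: continuous_trunc.
Qed.

Lemma C0_cut_trunc k : C0 (cut_trunc k).
Proof.
split; first exact: continuous_cut_trunc.
(* At this distance [1 + |x| ^ 2] exceeds [exp K], so [log_sqr x >= K] and the cutoff is exactly
   0. *)
move=> e e0; exists (expR (KR k)) => x xr; rewrite /cut_trunc /chi cut_ge1 ?mul0r ?normr0//.
rewrite mulrC ler_pdivlMr// mul1r -[KR k]expRK /log_sqr.
rewrite ler_ln ?posrE ?expR_gt0 ?one_sum_sqr_gt0//.
have e1 : 1 <= expR (KR k) by rewrite (le_trans _ (expR_ge1Dx _))// lerDl ltW.
have h : enorm x ^+ 2 = sum_sqr x by rewrite sqr_sqrtr// sum_sqr_ge0.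
nra.
Qed.

Definition dremainder k (v x : E) : R := (\sum_j v ord0 j * G j x) * (1 - chi k x * dtrunc k (U x))
  - dchi k v x * trunc k (U x).

Lemma is_derive_remainder k x v : is_derive x v (fun x => U x - cut_trunc k x) (dremainder k v x).
Proof.
have dT := is_derive_compR (is_derive_trunc k (U x)) (dU x v).
have -> : dremainder k v x = \sum_j v ord0 j * G j x -
    (chi k x *: (dtrunc k (U x) * \sum_j v ord0 j * G j x) + trunc k (U x) *: dchi k v x).
  by rewrite /dremainder /GRing.scale/=; ring.
exact: is_deriveB (dU x v) (is_deriveM (is_derive_chi k x v) dT).
Qed.

Lemma continuous_dtrunc k : continuous (fun x => dtrunc k (U x)).
Proof.
apply: continuous_inv_pos => [|x]; last exact: dtrunc_arg_gt0.
apply: (@MkD R n 0 (cst 1)); first exact: Mk_cst.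
apply: (@MkM R n 0 (fun x => (kR k)^-1 * U x)(fun x => (kR k)^-1 * U x)); exact: (@MkZ R n 0).
Qed.

Definition defect k (x : E) : R := 1 - chi k x * dtrunc k (U x).

Lemma continuous_defect k : continuous (defect k).
Proof.
apply: (@continuous_subr R n (cst 1)); first exact: cst_continuous.
apply: (@MkM R n 0); [exact: continuous_chi|exact: continuous_dtrunc].
Qed.

Lemma continuous_dremainder k v : continuous (dremainder k v).
Proof.
apply: continuous_subr.
  apply: (@MkM R n 0); last exact: continuous_defect.
  by apply: (@Mk_sum R n 0) => j; exact: (@MkZ R n 0).
apply: (@MkM R n 0); first exact: continuous_dchi.
by apply: continuous_compR => //; exact: continuous_trunc.
Qed.

(** The product of 2 from [trunc_le], [4 * n] from [dlog_sqr_le] and the bound on [dcut]. *)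
Let A : R := 8 * n%:R * cutC R.

Let A0 : 0 <= A.
Proof. by rewrite /A /cutC !mulr_ge0// invr_ge0 flat_ge0. Qed.

Let coef_ge0 k : 0 <= A * kR k / KR k.
Proof. exact: (divr_ge0 (mulr_ge0 A0 (ltW (kR0 k))) (ltW (KR0 k))). Qed.

(** The first summand is the gradient of [U] not yet captured, small by dominated convergence; the
    second comes from the derivative of the cutoff and is small by counting shells. *)
Definition remainder_bound k (x : E) : R := n%:R * M x * `|defect k x| +
  A * kR k / KR k * (\1_(cbox (2 ^+ K k)) x * (1 + `|x|)^-1).

Lemma dremainder_le k v x : `|dremainder k v x| <= `|v| * remainder_bound k x.
Proof.
rewrite /remainder_bound mulrDr; apply: le_trans (ler_normB _ _) (lerD _ _).
  rewrite normrM mulrA ler_wpM2r// (le_trans (ler_norm_sum _ _ _))//.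
  rewrite mulrCA -[X in X%:R * _](card_ord n) -sumr_const mulr_suml.
  by apply: ler_sum => j _; rewrite mul1r normrM ler_pM// coord_le_norm.
have K0 := KR0 k; have k0 := kR0 k.
have x0 : 0 < 1 + `|x| by rewrite ltr_pwDl.
have [xK|xK] := leP (log_sqr x) (KR k); last first.
  rewrite /dchi dcut_ge1 ?mul0r ?normr0.
    have h := coef_ge0 k.
    by rewrite mulr_ge0// mulr_ge0// mulr_ge0// invr_ge0 addr_ge0.
  by rewrite mulrC ler_pdivlMr// mul1r ltW.
rewrite [\1__ x]indicE mem_set; last exact: log_sqr_cbox.
rewrite mul1r normrM.
have l0 : 0 <= log_sqr x by apply: ln_ge0; rewrite lerDl sum_sqr_ge0.
have h1 : `|dchi k v x| <= cutC R * ((KR k)^-1 * (`|v| * (4 * n%:R / (1 + `|x|)))).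
  rewrite /dchi normrM ler_pM//.
    by apply: dcut_le; rewrite mulr_ge0// invr_ge0 ltW.
  by rewrite normrM gtr0_norm ?invr_gt0// ler_wpM2l ?invr_ge0 ?(ltW K0)// dlog_sqr_le.
apply: (le_trans (ler_pM _ _ h1 (trunc_le k (U x)))) => //.
rewrite le_eqVlt; apply/orP; left; apply/eqP; rewrite /A; field.
by rewrite !gt_eqF.
Qed.

Lemma measurable_ball_inv k :
  measurable_fun setT (fun x : E => \1_(cbox (2 ^+ K k)) x * (1 + `|x|)^-1).
Proof.
apply: measurable_funM; first by apply: measurable_indic; exact: measurable_cbox.
apply: continuous_measurable_rV; apply: continuous_inv_pos => [|x]; last by rewrite ltr_pwDl.
exact: (@MkD R n 0 _ _ (@Mk_cst R n 0 1) (@norm_continuous _ E)).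
Qed.

Lemma remainder_bound_ge0 k x : 0 <= remainder_bound k x.
Proof.
have K0 := KR0 k; have k0 := kR0 k.
rewrite addr_ge0//; first by rewrite !mulr_ge0.
apply: mulr_ge0; first exact: coef_ge0.
by rewrite mulr_ge0// invr_ge0 addr_ge0.
Qed.

Lemma measurable_gradient_part k : measurable_fun setT (fun x => n%:R * M x * `|defect k x|).
Proof.
apply: measurable_funM; first exact: measurable_funM.
apply: measurableT_comp => //; exact: continuous_measurable_rV (@continuous_defect k).
Qed.

Lemma measurable_remainder_bound k : measurable_fun setT (remainder_bound k).
Proof.
apply: measurable_funD; first exact: measurable_gradient_part.
by apply: measurable_funM => //; exact: measurable_ball_inv.
Qed.

Lemma line_bound_remainder k : line_bound (fun x => U x - cut_trunc k x) (remainder_bound k).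
Proof.
apply: (@line_bound_C1 R n _ _ (dremainder k)).
- by move=> v x; exact: is_derive_remainder.
- by move=> v; exact: continuous_dremainder.
- exact: measurable_remainder_bound.
- exact: remainder_bound_ge0.
- by move=> v x; exact: dremainder_le.
Qed.

Lemma cvg_kR_inv : (kR k)^-1 @[k --> \oo] --> (0 : R).
Proof. exact: cvg_harmonic. Qed.

Lemma KRE k : KR k = kR k ^+ 4.
Proof. by rewrite /KR /K natrX. Qed.

Lemma cvg_KR_inv : (KR k)^-1 @[k --> \oo] --> (0 : R).
Proof.
apply: (@squeeze_cvgr _ _ _ _ (cst 0) (fun k => (kR k)^-1)); last exact: cvg_kR_inv.
  near=> k; rewrite /= invr_ge0 (ltW (KR0 k))/= lef_pV2 ?posrE//.
  by rewrite KRE -[leLHS]expr1 ler_weXn2l// ler1n.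
exact: cvg_cst.
Unshelve. all: by end_near. Qed.

Lemma cvg_defect x : defect k x @[k --> \oo] --> (0 : R).
Proof.
rewrite -(subrr (1 : R)); apply: cvgB; first exact: cvg_cst.
rewrite -[X in _ --> X]mulr1; apply: cvgM.
  rewrite /chi -cut0; apply: (continuous_cvg _ (@continuous_cut R 0)).
  rewrite -[X in _ --> X](mul0r (log_sqr x)); apply: cvgM; last exact: cvg_cst.
  exact: cvg_KR_inv.
rewrite /dtrunc -[X in _ --> X]invr1; apply: cvgV => //.
rewrite -[X in _ --> X]addr0; apply: cvgD; first exact: cvg_cst.
rewrite -[X in _ --> X](_ : 0 ^+ 2 = 0 :> R); last by rewrite expr0n.
apply: (continuous_cvg _ (@exprn_continuous R 2 0)).
rewrite -[X in _ --> X](mul0r (U x)); apply: cvgM; last exact: cvg_cst.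
exact: cvg_kR_inv.
Qed.

Hypotheses (n1 : (1 < n)%N) (Moo : (\int[leb]_x (M x ^+ n)%:E < +oo)%E).

Let B : R := n%:R * (1 + (flat 0 1)^-1).

Lemma defect_le k x : `|defect k x| <= 1 + (flat 0 1)^-1.
Proof.
rewrite /defect (le_trans (ler_normB _ _))// normr1 lerD2l normrM.
have /andP[d0 d1] := dtrunc_itv k (U x).
by rewrite (ger0_norm d0) (le_trans _ (cut_le ((KR k)^-1 * log_sqr x)))// ler_piMr.
Qed.

(** Dominated convergence: [defect k] is bounded uniformly in [k] and tends to 0 pointwise, as
    [chi k] and the slope of the truncation tend to 1. *)
Lemma cvg_gradient_part :
  (\int[leb]_x ((n%:R * M x * `|defect k x|) ^+ n)%:E)%E @[k --> \oo] --> (0 : \bar R).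
Proof.
have f1 : 0 <= 1 + (flat 0 1 : R)^-1 by rewrite addr_ge0// invr_ge0 flat_ge0.
have mMn : measurable_fun setT (fun x => M x ^+ n) by exact: measurable_funX.
have := @dominated_cvg _ _ R leb setT measurableT
  (fun k x => ((n%:R * M x * `|defect k x|) ^+ n)%:E) (cst 0%E)
  (fun x => ((B ^+ n) * M x ^+ n)%:E).
rewrite integral0; apply.
- by move=> k; apply/measurable_EFinP/measurable_funX; exact: measurable_gradient_part.
- move=> x _; apply: cvg_EFin; first by near=> k.
  rewrite [X in X @ _](_ : _ = (fun k => (n%:R * M x * `|defect k x|) ^+ n)); last by apply/funext.
  have -> : 0 = (n%:R * M x * `|0 : R|) ^+ n :> R.
    by rewrite normr0 mulr0 expr0n -leqn0 leqNgt (ltnW n1).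
  apply: (continuous_cvg _ (@exprn_continuous R n _)).
  apply: cvgM; first exact: cvg_cst.
  exact: cvg_norm (cvg_defect x).
- by [].
- apply/integrableP; split; first exact/measurable_EFinP/measurable_funM.
  have BM0 (x : E) : 0 <= B ^+ n * M x ^+ n by rewrite mulr_ge0// exprn_ge0// mulr_ge0.
  under eq_integral do rewrite /= (ger0_norm (BM0 _)) EFinM.
  rewrite ge0_integralZl//.
  + by rewrite lte_mul_pinfty// lee_fin exprn_ge0// mulr_ge0.
  + exact/measurable_EFinP.
  + by move=> x _; rewrite lee_fin exprn_ge0.
  + by rewrite lee_fin exprn_ge0// mulr_ge0.
- move=> k x _ /=; rewrite lee_fin ger0_norm ?exprn_ge0 ?mulr_ge0//.
  rewrite -exprMn lerXn2r ?nnegrE ?mulr_ge0//.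
  by rewrite /B mulrAC ler_wpM2r// ler_wpM2l// defect_le.
Unshelve. all: by end_near. Qed.

Lemma cutoff_part_le k : (\int[leb]_x ((A * kR k / KR k * (\1_(cbox (2 ^+ K k)) x * (1 + `|x|)^-1)) ^+ n)%:E
   <= ((4 * A) ^+ n * 2 * (kR k)^-1)%:E)%E.
Proof.
have K0 := KR0 k; have k0 := kR0 k.
set c := A * kR k / KR k; have c0 : 0 <= c := coef_ge0 k.
have n0 : (0 < n)%N by exact: ltnW.
have mb := measurable_ball_inv k.
rewrite (eq_integral (fun x : E => (c ^+ n)%:E *
    (\1_(cbox (2 ^+ K k)) x * (1 + `|x|) ^- n)%:E)%E); last first.
  move=> x _; rewrite -EFinM exprMn [X in _ * X]exprMn exprVn; congr (_ * (_ * _))%:E.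
  by rewrite indicE; case: (_ \in _); rewrite ?expr1n ?expr0n ?eqn0Ngt ?n0.
have n0' (x : E) : 0 <= (1 + `|x|) ^- n by rewrite invr_ge0 exprn_ge0// addr_ge0.
rewrite ge0_integralZl//; first last.
- by rewrite lee_fin exprn_ge0.
- apply/measurable_EFinP; apply: measurable_funM; first by apply: measurable_indic; exact: measurable_cbox.
  apply: continuous_measurable_rV; apply: continuous_inv_pos => [|x]; last by rewrite exprn_gt0// ltr_pwDl.
  apply: (@continuous_compR R n (fun t : R => t ^+ n)); first exact: exprn_continuous.
  exact: (@MkD R n 0 _ _ (@Mk_cst R n 0 1) (@norm_continuous _ E)).
apply: (@le_trans _ _ ((c ^+ n)%:E * ((K k).+1%:R * 4 ^+ n)%:E)%E).
  by rewrite lee_wpmul2l ?lee_fin ?exprn_ge0// integral_max_norm.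
rewrite -EFinM lee_fin.
have h1 : (K k).+1%:R <= 2 * kR k ^+ 4.
  rewrite -natr1 -/(KR k) -KRE mulr_natl mulr2n lerD2l -[leLHS]/(1%:R) ler_nat.
  by rewrite expn_gt0.
have k1 : 1 <= kR k by rewrite ler1n.
(* The hypothesis [1 < n] acts here: [c] is of order [k ^ (-3)], and [3 * n >= 6] outweighs the
   fourth power in [h1], which [3] alone would not. *)
have h2 : c ^+ n <= A ^+ n * (kR k) ^- 5.
  have -> : c = A * (kR k) ^- 3 by rewrite /c KRE; field; rewrite gt_eqF.
  rewrite exprMn ler_wpM2l ?exprn_ge0// exprVn -exprM.
  rewrite lef_pV2 ?posrE ?exprn_gt0// ler_weXn2l//.
  by apply: (@leq_trans (3 * 2)); rewrite // leq_mul2l.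
apply: (@le_trans _ _ (A ^+ n * (kR k) ^- 5 * (2 * kR k ^+ 4 * 4 ^+ n))).
  apply: ler_pM => //; [exact: exprn_ge0|].
  by rewrite ler_wpM2r// exprn_ge0.
rewrite le_eqVlt; apply/orP; left; apply/eqP; rewrite [(4 * A) ^+ n]exprMn.
by move: (A ^+ n) (4 ^+ n) (kR k) k0 => u v t t0; field; rewrite gt_eqF.
Qed.

Lemma expr_addn_le (a b : R) : 0 <= a -> 0 <= b -> (a + b) ^+ n <= 2 ^+ n * a ^+ n + 2 ^+ n * b ^+ n.
Proof.
move=> a0 b0; rewrite -!exprMn.
have [ab|ba] := leP a b.
  rewrite ler_wpDl ?exprn_ge0 ?mulr_ge0// lerXn2r ?nnegrE ?addr_ge0 ?mulr_ge0//; lra.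
rewrite ler_wpDr ?exprn_ge0 ?mulr_ge0// lerXn2r ?nnegrE ?addr_ge0 ?mulr_ge0//; lra.
Qed.

Lemma C0_approximation (eta : R) : 0 < eta -> exists2 w, C0 w &
  forall (a : E) (l : R), 0 < l ->
    (double_osc (cube a l) (fun x => U x - w x)%R <= ((l ^+ n) ^+ 2 * eta)%:E)%E.
Proof.
move=> eta0; have n0 : (0 < n)%N by exact: ltnW.
(* The divisor is the constant of [double_osc_cube]. Each part of the remainder bound then gets half
   of [J ^+ n], divided by the [2 ^+ n] lost in [expr_addn_le]. *)
pose J := eta / 2 ^+ n.+1; have J0 : 0 < J by rewrite divr_gt0// exprn_gt0.
have J1 : 0 < J ^+ n / 2 ^+ n / 2 by rewrite !divr_gt0// exprn_gt0.
have [k [hk1 hk2]] : exists k,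
    (\int[leb]_x ((n%:R * M x * `|defect k x|) ^+ n)%:E <= (J ^+ n / 2 ^+ n / 2)%:E)%E /\
    (4 * A) ^+ n * 2 * (kR k)^-1 <= J ^+ n / 2 ^+ n / 2.
  have c1 : \forall k \near \oo,
      (\int[leb]_x ((n%:R * M x * `|defect k x|) ^+ n)%:E <= (J ^+ n / 2 ^+ n / 2)%:E)%E.
    have /fine_cvgP[f1 f2] := cvg_gradient_part.
    near=> k.
    have ff : (\int[leb]_x ((n%:R * M x * `|defect k x|) ^+ n)%:E)%E \is a fin_num by near: k.
    rewrite -(fineK ff) lee_fin; apply/ltW; near: k.
    by apply: (cvgr_lt (0 : R)).
  have c2 : \forall k \near \oo, (4 * A) ^+ n * 2 * (kR k)^-1 <= J ^+ n / 2 ^+ n / 2.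
    near=> k; apply/ltW; near: k.
    apply: (@cvgr_lt _ _ _ _ (fun k => (4 * A) ^+ n * 2 * (kR k)^-1) 0) => //.
    rewrite -[X in _ --> X](mulr0 ((4 * A) ^+ n * 2)); apply: cvgM; first exact: cvg_cst.
    exact: cvg_kR_inv.
  near \oo => k; exists k; split; near: k; [exact: c1|exact: c2].
exists (cut_trunc k); first exact: C0_cut_trunc.
move=> a l l0.
have -> : eta = 2 ^+ n.+1 * J by rewrite /J mulrC divfK// expf_neq0.
have lF : loc_integrable (fun x => U x - cut_trunc k x).
  by apply/continuous_loc_integrable/continuous_subr => //; exact: continuous_cut_trunc.
have mmk := measurable_remainder_bound k; have mk0 := remainder_bound_ge0 k.
have m1 := measurable_gradient_part k.
have m2 : measurable_fun setT (fun x : E => A * kR k / KR k * (\1_(cbox (2 ^+ K k)) x * (1 + `|x|)^-1)).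
  by apply: measurable_funM => //; exact: measurable_ball_inv.
apply: (@double_osc_cube R n _ (remainder_bound k)) => //; first exact: line_bound_remainder.
have g1 x : 0 <= n%:R * M x * `|defect k x| by rewrite !mulr_ge0.
have g2 (x : E) : 0 <= A * kR k / KR k * (\1_(cbox (2 ^+ K k)) x * (1 + `|x|)^-1).
  have h := coef_ge0 k.
  by rewrite mulr_ge0// mulr_ge0// invr_ge0 addr_ge0.
apply: (@le_trans _ _ (\int[leb]_x ((2 ^+ n)%:E * ((n%:R * M x * `|defect k x|) ^+ n)%:E +
   (2 ^+ n)%:E * ((A * kR k / KR k * (\1_(cbox (2 ^+ K k)) x * (1 + `|x|)^-1)) ^+ n)%:E))%E).
  apply: ge0_le_integral => //.
  - by move=> x _; rewrite lee_fin mulr_ge0// exprn_ge0.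
  - apply/measurable_EFinP; apply: measurable_funM; last exact: measurable_funX.
    by apply: measurable_indic; exact: measurable_cube.
  - by apply: emeasurable_funD; apply/measurable_EFinP; apply: measurable_funM => //; exact: measurable_funX.
  move=> x _; rewrite -!EFinM -EFinD lee_fin.
  apply: le_trans (expr_addn_le (g1 x) (g2 x)).
  by rewrite ler_piMl ?exprn_ge0// indicE; case: (_ \in _).
rewrite ge0_integralD//; first last.
- by apply/measurable_EFinP; apply: measurable_funM => //; exact: measurable_funX.
- by move=> x _; rewrite -EFinM lee_fin mulr_ge0// exprn_ge0.
- by apply/measurable_EFinP; apply: measurable_funM => //; exact: measurable_funX.
- by move=> x _; rewrite -EFinM lee_fin mulr_ge0// exprn_ge0.
have mm1 : measurable_fun setT (fun x => ((n%:R * M x * `|defect k x|) ^+ n)%:E).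
  exact/measurable_EFinP/measurable_funX.
have mm2 : measurable_fun setT (fun x : E =>
    ((A * kR k / KR k * (\1_(cbox (2 ^+ K k)) x * (1 + `|x|)^-1)) ^+ n)%:E).
  exact/measurable_EFinP/measurable_funX.
rewrite ge0_integralZl//; last by move=> x _; rewrite lee_fin exprn_ge0.
rewrite ge0_integralZl//; last by move=> x _; rewrite lee_fin exprn_ge0.
apply: (@le_trans _ _ ((2 ^+ n)%:E * (J ^+ n / 2 ^+ n / 2)%:E + (2 ^+ n)%:E * (J ^+ n / 2 ^+ n / 2)%:E)%E).
  apply: leeD; first by rewrite lee_wpmul2l// lee_fin.
  rewrite lee_wpmul2l ?lee_fin//; apply: le_trans (cutoff_part_le k) _.
  by rewrite lee_fin.
rewrite -EFinM -EFinD lee_fin le_eqVlt; apply/orP; left; apply/eqP; field.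
exact: expf_neq0.
Unshelve. all: by end_near. Qed.

End cutoff_approximation.

(** * Vanishing mean oscillation in dimension at least two *)

Section vmo.
Context (R : realType) (n : nat).
Local Notation E := 'rV[R]_n.
Local Notation leb := (@lebesgue_rV R n).
Implicit Types (F h m : E -> R).

Lemma loc_integrable_norm h : loc_integrable h -> loc_integrable (fun x => `|h x|).
Proof.
move=> [mh ih]; split; first exact: measurableT_comp.
by move=> K cK; under eq_integral do rewrite normr_id; exact: ih.
Qed.

Lemma mean_osc_cube_double h (a : E) (l c : R) : 0 < l -> loc_integrable h ->
  (double_osc (cube a l) h <= ((l ^+ n) ^+ 2 * c)%:E)%E -> mean_osc (cube a l) h <= c.
Proof.
move=> l0 lh hc; have l0' := ltW l0.
have Q0 : (0 < leb (cube a l))%E by rewrite leb_cube// lte_fin exprn_gt0.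
have := mean_osc_double (measurable_cube a l) (addr_ge0 (normr_ge0 a) l0') (cube_cbox l0') Q0 lh.
rewrite leb_cube//= -lee_fin => /le_trans; apply.
by rewrite lee_pdivrMl ?exprn_gt0// -EFinM.
Qed.

Lemma W1N_VMO F (f : functional R n) : (1 < n)%N -> W1N f ->
  weak_gradient F (fun i x => gradient f x ord0 i) -> VMO F.
Proof.
move=> n1 Wf Fg; have n0 : (0 < n)%N by exact: ltnW.
have [lF lg _] := Fg; have mF := loc_measurable lF.
pose g (i : 'I_n) (x : E) := gradient f x ord0 i.
pose m (x : E) := \sum_j `|g j x|.
have lm : loc_integrable m by apply: loc_integrable_sum => j; exact: loc_integrable_norm (lg j).
have mm := loc_measurable lm.
have m0 x : 0 <= m x by exact: sumr_ge0.
have FB : line_bound F m.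
  apply: (@line_identity_bound R n F g); last exact: weak_gradient_line.
  by move=> j; exact: loc_measurable (lg j).
have mg := measurable_norm_gradient Wf.
have g0 x : 0 <= norm_gradient f x by exact: enorm_ge0.
have [J J0 JE] : exists2 J, 0 <= J & LN_norm setT (norm_gradient f) = J%:E.
  by apply: LN_norm_fin => //; case: Wf.
have moo : (\int[leb]_x (m x ^+ n)%:E < +oo)%E.
  apply: (@le_lt_trans _ _ ((n%:R * J) ^+ n)%:E); last exact: ltry.
  rewrite -(LN_norm_scale n0 measurableT mg g0 J0 JE); apply: le_integralT.
  - exact: measurable_funX.
  - apply: measurable_funM; first exact: measurable_indic.
    by apply: measurable_funX; exact: measurable_funM.
  move=> x; rewrite exprn_ge0//= indicT mul1r lerXn2r ?nnegrE ?mulr_ge0//.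
  rewrite -[X in X%:R * _](card_ord n) -sumr_const mulr_suml.
  by apply: ler_sum => i _; rewrite mul1r coord_le_enorm.
split.
  split => //; apply: le_lt_trans (bmo_W1N n0 Wf Fg) _.
  by rewrite lte_mul_pinfty ?lee_fin ?mulr_ge0//; case: Wf.
(* Mollification and cutoff cost [e / 4] each on every cube; the total [e / 2] leaves room for the
   strict inequality after the supremum. *)
move=> e e0; have e40 : 0 < e / 4 by rewrite divr_gt0.
have [e1 e10 he1] := double_osc_mollify n0 e40 lF mm m0 FB moo.
have [rho Hr] := mollifier_exists n e10; have [trho rho0 _ _] := Hr.
have cU := conv_continuous lF trho.
have GM j x : `|conv (g j) rho x| <= conv m rho x.
  have lgx := loc_integrable_shiftl x (lg j); have lmx := loc_integrable_shiftl x lm.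
  rewrite (convE Hr x (lg j)) (convE Hr x lm) -lee_fin.
  apply: le_trans (mollify_le Hr lgx) _.
  have imx := loc_integrable_tf lmx trho.
  rewrite /Rintegral fineK; last exact: (integrable_fin_num measurableT imx).
  have mrho := continuous_measurable_rV (tf_continuous trho).
  apply: le_integralT.
  - by apply: measurable_funM => //; apply: measurableT_comp => //; exact: loc_measurable lgx.
  - by apply: measurable_funM => //; exact: loc_measurable lmx.
  move=> w; rewrite mulr_ge0//= mulrC ler_wpM2r// /m (bigD1 j)//= lerDl.
  exact: sumr_ge0.
have M0 x : 0 <= conv m rho x by apply: Rintegral_ge0 => y _; rewrite mulr_ge0.
have Moo := le_lt_trans (conv_power_integral Hr lm m0 n0) moo.
have mM : measurable_fun setT (conv m rho).
  exact: continuous_measurable_rV (conv_continuous lm trho).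
have [w C0w hw] := @C0_approximation R n (conv F rho) (conv m rho) (fun j => conv (g j) rho)
  cU (fun j => conv_continuous (lg j) trho) (fun x v => conv_is_derive x v Fg trho)
  mM GM M0 n1 Moo _ e40.
exists w => //; apply: (@le_lt_trans _ _ (e / 2)%:E); last first.
  by rewrite lte_fin ltr_pdivrMr// ltr_pMr// ltr1n.
have lw := continuous_loc_integrable C0w.1.
have lFw : loc_integrable (fun x => F x - w x).
  have := loc_integrableD lF (loc_integrableZ (-1) lw).
  by under eq_fun do rewrite mulN1r.
apply: ub_ereal_sup => _ [[a l] /= l0 <-]; rewrite lee_fin.
apply: mean_osc_cube_double => //.
rewrite (_ : (fun x => F x - w x) = (fun x => (F x - conv F rho x) + (conv F rho x - w x))); last first.
  by apply/funext => x; rewrite addrA subrK.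
have mU := continuous_measurable_rV cU; have mw := loc_measurable lw.
apply: le_trans (le_double_oscD (measurable_cube a l) (measurable_funB mF mU) (measurable_funB mU mw)) _.
have -> : e / 2 = e / 4 + e / 4 by field.
rewrite [_ * (_ + _)]mulrDr EFinD.
exact: leeD (he1 rho Hr a l l0) (hw a l l0).
Qed.

End vmo.

(** * The Hardy condition in dimension one *)

Section hardy.
Context (R : realType).
Implicit Types (T t : R).

(* Avoids proving that [radial_maximal] is measurable. *)
Lemma le_integral_nonmeasurable d (X : measurableType d)
    (mu : {measure set X -> \bar R}) (f g : X -> \bar R) :
  (forall x, (0 <= f x)%E) -> (forall x, (f x <= g x)%E) ->
  (\int[mu]_x f x <= \int[mu]_x g x)%E.
Proof.
move=> f0 fg; have g0 x : (0 <= g x)%E by exact: le_trans (fg x).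
rewrite !ge0_integralTE//; apply: le_ereal_sup => _ [s /= sf <-]; exists s => //= x.
exact: le_trans (fg x).
Qed.

Section maximal.
Variable n : nat.
Local Notation E := 'rV[R]_n.
Local Notation leb := (@lebesgue_rV R n).

(** As [t] grows, [phi (y0 - t^-1 *: y)] tends to [phi y0], so by dominated convergence the integral
    tends to [phi y0] times that of [h]; half of this limit is kept. *)
Lemma integral_dilation_lb (h phi : E -> R) (y0 : E) :
  leb.-integrable setT (EFin \o h) -> (forall x, 0 <= h x) ->
  tf phi -> phi y0 != 0 -> 0 < \int[leb]_x h x ->
  exists2 T, 0 < T & forall t, T <= t ->
    `|phi y0| * \int[leb]_x h x / 2 <= `|\int[leb]_y (h y * phi (y0 - t^-1 *: y))|.
Proof.
(* Dominated convergence is used along sequences: without a threshold [T] there would be bad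
   parameters [t k >= k + 1]. *)
move=> ih h0 tphi phi0 I0; apply: contrapT => hT.
have /choice[t ht] : forall k : nat, exists t : R, k.+1%:R <= t /\
    `|\int[leb]_y (h y * phi (y0 - t^-1 *: y))| < `|phi y0| * \int[leb]_x h x / 2.
  move=> k; apply: contrapT => /forallNP hk; apply: hT; exists k.+1%:R => // t kt.
  by rewrite leNgt; apply/negP => lt; apply: (hk t).
have [C C0 hC] := tf_bounded tphi.
have mh : measurable_fun setT h by case/integrableP: ih => /measurable_EFinP.
have mphi := continuous_measurable_rV (tf_continuous tphi).
have t0 k : 0 < t k by rewrite (lt_le_trans _ (ht k).1).
have cti : (t k)^-1 @[k --> \oo] --> (0 : R).
  apply: (@squeeze_cvgr _ _ _ _ (cst 0) (fun k => k.+1%:R^-1)).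
  - near=> k; rewrite /= invr_ge0 (ltW (t0 k))/= lef_pV2 ?posrE ?ltr0n//.
    exact: (ht k).1.
  - exact: cvg_cst.
  - exact: cvg_harmonic.
have mf k : measurable_fun setT (fun y => h y * phi (y0 - (t k)^-1 *: y)).
  apply: measurable_funM => //; apply: (measurableT_comp mphi).
  by apply: measurable_rVB => //; exact: measurable_rVZ.
have ic : leb.-integrable setT (fun y => (h y * phi y0)%:E).
  by under eq_fun do rewrite EFinM; exact: integrableZr.
have lim : (\int[leb]_y (h y * phi (y0 - (t k)^-1 *: y))%:E)%E @[k --> \oo] -->
    (\int[leb]_y (h y * phi y0)%:E)%E.
  apply: (@dominated_cvg _ _ R leb setT measurableT _ _ (fun y => (C * h y)%:E)) => //.
  - by move=> k; exact/measurable_EFinP.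
  - move=> y _; apply: cvg_EFin; first by near=> k.
    rewrite [X in X @ _](_ : _ = (fun k => h y * phi (y0 - (t k)^-1 *: y))); last exact/funext.
    apply: cvgM; first exact: cvg_cst.
    have cl : y0 - (t k)^-1 *: y @[k --> \oo] --> y0.
      rewrite -[X in _ --> X]subr0; apply: cvgB; first exact: cvg_cst.
      by rewrite -(scale0r y); apply: cvgZr_tmp.
    by apply: continuous_cvg => //; exact: tf_continuous.
  - by under eq_fun do rewrite EFinM; exact: integrableZl.
  - move=> k y _; rewrite lee_fin normrM (ger0_norm (h0 y)) mulrC.
    by rewrite ler_wpM2r.
have limE : (\int[leb]_y (h y * phi y0)%:E = (phi y0 * \int[leb]_x h x)%:E)%E.
  rewrite mulrC -RintegralZr// /Rintegral fineK//.
  exact: (integrable_fin_num measurableT).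
have {}lim : `|\int[leb]_y (h y * phi (y0 - (t k)^-1 *: y))| @[k --> \oo] -->
    `|phi y0| * \int[leb]_x h x.
  rewrite -[X in _ * X](gtr0_norm I0) -normrM; apply: cvg_norm.
  by rewrite limE in lim; exact: (fine_cvg lim).
have c0 : 0 < `|phi y0| * \int[leb]_x h x by rewrite mulr_gt0// normr_gt0.
have : \forall k \near \oo, `|phi y0| * \int[leb]_x h x / 2 <
    `|\int[leb]_y (h y * phi (y0 - (t k)^-1 *: y))|.
  by apply: (cvgr_gt _ lim _); rewrite ltr_pdivrMr// ltr_pMr// ltr1n.
move=> [k _ /(_ k (leqnn k))] /lt_trans /(_ (ht k).2).
by rewrite ltxx.
Unshelve. all: by end_near. Qed.

End maximal.

Section dimension_one.
Local Notation E := 'rV[R]_1.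
Local Notation leb := (@lebesgue_rV R 1).
Local Notation coord x := (x ord0 ord0).

(* Equal to [1 / u] up to a factor 2 on [u >= T], and [2 * tailfn T (2 * u) = tailfn (T / 2) u]. *)
Definition tailfn T (x : E) : R :=
  \1_(`[T, +oo[%classic : set R) (coord x) * (coord x / (T ^+ 2 + coord x ^+ 2)).

Lemma tailfn_lt T (x : E) : coord x < T -> tailfn T x = 0.
Proof.
move=> xT; rewrite /tailfn indicE memNset ?mul0r//.
by rewrite /= in_itv/= andbT => /le_lt_trans /(_ xT); rewrite ltxx.
Qed.

Lemma tailfn_ge T (x : E) : T <= coord x ->
  tailfn T x = coord x / (T ^+ 2 + coord x ^+ 2).
Proof. by move=> xT; rewrite /tailfn indicE mem_set ?mul1r//= in_itv/= xT. Qed.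

Lemma tailfn_ge0 T x : 0 < T -> 0 <= tailfn T x.
Proof.
move=> T0; have [xT|/tailfn_lt-> //] := leP T (coord x); rewrite tailfn_ge//.
by rewrite divr_ge0 ?(le_trans (ltW T0) xT)// addr_ge0// sqr_ge0.
Qed.

Lemma measurable_tailfn T : 0 < T -> measurable_fun setT (tailfn T).
Proof.
move=> T0; apply: measurable_funM.
  apply: (@measurable_indic_comp _ _ E (measurableTypeR R) R).
    exact: measurable_itv.
  exact: (@measurable_rV_coord R 1 ord0).
apply: continuous_measurable_rV.
apply: (@MkM R 1 0 (fun x : E => coord x)); first exact: continuous_coord.
apply: continuous_inv_pos => [|x]; last by rewrite ltr_pwDl ?exprn_gt0// sqr_ge0.
apply: (@MkD R 1 0 (cst (T ^+ 2))); first exact: Mk_cst.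
by apply: (@MkM R 1 0 (fun x => coord x)(fun x => coord x)); exact: continuous_coord.
Qed.

Lemma tailfn_scale T x : 0 < T -> 2 * tailfn T (2 *: x) = tailfn (T / 2) x.
Proof.
move=> T0; rewrite /tailfn !mxE.
have -> : \1_(`[T, +oo[%classic : set R) (2 * coord x) = \1_(`[T / 2, +oo[%classic : set R) (coord x) :> R.
  rewrite !indicE; congr ((_ : bool)%:R).
  by rewrite !mem_setE !in_itv/= !andbT ler_pdivrMr// mulrC.
have d0 : (T / 2) ^+ 2 + coord x ^+ 2 != 0.
  by rewrite gt_eqF// ltr_pwDl ?sqr_ge0// exprn_gt0// divr_gt0.
have -> : T ^+ 2 + (2 * coord x) ^+ 2 = 4 * ((T / 2) ^+ 2 + coord x ^+ 2) by field.
by rewrite mulrCA; congr (_ * _); move: ((T / 2) ^+ 2 + _) d0 => d d0; field.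
Qed.

(** A scaling argument instead of a logarithm: by [tailfn_scale] the integral is the same for [T]
    and [T / 2], although [tailfn (T / 2)] is larger by a fixed amount on an interval. A finite
    integral would contradict this. *)
Lemma integral_tailfn T : 0 < T -> (\int[leb]_x (tailfn T x)%:E = +oo)%E.
Proof.
move=> T0; have T20 : 0 < T / 2 by rewrite divr_gt0.
have mT := measurable_tailfn T0; have mT2 := measurable_tailfn T20.
have t0 x := tailfn_ge0 x T0.
have I0 : (0 <= \int[leb]_x (tailfn T x)%:E)%E.
  by apply: integral_ge0 => x _; rewrite lee_fin.
apply/eqP; rewrite -leye_eq leNgt; apply/negP => Ioo.
have If : (\int[leb]_x (tailfn T x)%:E)%E \is a fin_num by rewrite ge0_fin_numE.
have two0 : (2 : R) != 0 by [].
have E1 : (\int[leb]_x (tailfn (T / 2) x)%:E = \int[leb]_x (tailfn T x)%:E)%E.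
  under eq_integral do rewrite -tailfn_scale// EFinM.
  rewrite ge0_integralZl//; first last.
  - by move=> x _; rewrite lee_fin.
  - apply/measurable_EFinP; apply: (measurableT_comp mT); exact: measurable_rVZ.
  have mT' : measurable_fun setT (fun x => (tailfn T x)%:E) by exact/measurable_EFinP.
  have t0' x : (0 <= (tailfn T x)%:E)%E by rewrite lee_fin.
  have -> : (\int[leb]_x (tailfn T (2 *: x))%:E =
      (`|2| ^- 1)%:E * \int[leb]_x (tailfn T x)%:E)%E.
    rewrite -(ge0_integral_affine 0 two0 mT' t0'); apply: eq_integral => x _.
    by rewrite add0r.
  by rewrite normr_nat expr1 muleA -EFinM divff// mul1e.
(* On this interval, to the left of [T], [tailfn T] vanishes while [tailfn (T / 2)] is at least
   [c]. *)
pose A := box (fun _ : 'I_1 => T / 2) (fun=> 3 * T / 4).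
pose c := (T / 2) / ((T / 2) ^+ 2 + T ^+ 2).
have c0 : 0 < c by rewrite divr_gt0// addr_gt0// exprn_gt0.
have E2 : (\int[leb]_x (tailfn T x + c * \1_A x)%:E <= \int[leb]_x (tailfn (T / 2) x)%:E)%E.
  apply: le_integralT => //.
  - by apply: measurable_funD => //; exact: measurable_funM.
  move=> x; apply/andP; split.
    by apply: addr_ge0 => //; apply: mulr_ge0 => //; exact: ltW.
  have [xA|xA] := pselect (A x).
    have /andP[x1 x2] := xA ord0; rewrite indicE mem_set// mulr1.
    have u0 : 0 < coord x by lra.
    have uT : coord x < T by lra.
    rewrite (tailfn_lt uT) add0r (tailfn_ge x1).
    apply: ler_pM => //; first by rewrite ltW.
      by rewrite invr_ge0 addr_ge0// sqr_ge0.
    rewrite lef_pV2 ?posrE ?ltr_pwDl ?sqr_ge0 ?exprn_gt0// lerD2l.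
    by rewrite lerXn2r ?nnegrE// ltW.
  rewrite indicE memNset// mulr0 addr0.
  have [xT|/tailfn_lt->] := leP T (coord x); last exact: tailfn_ge0.
  have u0 : 0 < coord x by lra.
  have uT2 : T / 2 <= coord x by lra.
  rewrite (tailfn_ge xT) (tailfn_ge uT2) ler_wpM2l ?(ltW u0)//.
  rewrite lef_pV2 ?posrE ?ltr_pwDl ?sqr_ge0 ?exprn_gt0// lerD2r.
  rewrite lerXn2r ?nnegrE ?(ltW T0) ?(ltW T20)//; lra.
have E3 : (\int[leb]_x (tailfn T x + c * \1_A x)%:E =
    \int[leb]_x (tailfn T x)%:E + (c * (T / 4))%:E)%E.
  under eq_integral do rewrite EFinD.
  rewrite ge0_integralD//; first last.
  - exact/measurable_EFinP/measurable_funM.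
  - by move=> x _; rewrite lee_fin mulr_ge0// ltW.
  - exact/measurable_EFinP.
  - by move=> x _; rewrite lee_fin.
  congr (_ + _)%E; under eq_integral do rewrite EFinM.
  rewrite ge0_integralZl//; last first.
  - by rewrite lee_fin ltW.
  - exact/measurable_EFinP.
  rewrite integral_indicE; last exact: measurable_box.
  rewrite leb_box => [|i]; last by lra.
  by rewrite big_ord1 -EFinM; congr (_ * _)%:E; field.
move: E2; rewrite E3 E1 -leeBrDl// subee// lee_fin leNgt; apply/negP/negPn.
by rewrite mulr_gt0// divr_gt0.
Qed.

(* If the integral of [h] is not 0 and [phi y0 != 0], the maximal function at [t *: y0] is
   at least a constant over [t] for large [t], hence not integrable. *)
Lemma hardy_integral0 (h phi : E -> R) : leb.-integrable setT (EFin \o h) ->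
  (forall x, 0 <= h x) -> tf phi -> \int[leb]_x phi x = 1 ->
  hardy phi 1 (dist_of h) -> \int[leb]_x h x = 0.
Proof.
move=> ih h0 tphi phi1 [_ Moo].
apply/eqP; rewrite eq_le; apply/andP; split; last exact: Rintegral_ge0.
rewrite leNgt; apply/negP => I0.
(* A nonzero point is required so that its multiples sweep out a half-line. It exists: if [phi]
   vanished off the origin it would vanish everywhere by continuity, against its integral 1. *)
have [y0 phi0 y00] : exists2 y0, phi y0 != 0 & coord y0 != 0.
  apply: contrapT => hn.
  have z (y : E) : coord y != 0 -> phi y = 0.
    by move=> y0; apply/eqP; apply: contrapT => /negP py; apply: hn; exists y.
  have phi00 : phi 0 = 0.
    pose yk (k : nat) : E := k.+1%:R^-1 *: const_mx 1.
    have c1 : yk k @[k --> \oo] --> (0 : E).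
      rewrite -(scale0r (const_mx 1 : E)); apply: cvgZr_tmp.
      exact: cvg_harmonic.
    have c2 : phi (yk k) @[k --> \oo] --> phi 0.
      by apply: continuous_cvg => //; exact: tf_continuous.
    have c3 : phi (yk k) @[k --> \oo] --> (0 : R).
      rewrite [X in X @ _](_ : _ = cst 0); first exact: cvg_cst.
      by apply/funext => k; apply: z; rewrite !mxE mulr1 invr_eq0 pnatr_eq0.
    exact: (cvg_unique _ c2 c3).
  have pz y : phi y = 0.
    have [y0|] := eqVneq (coord y) 0; last exact: z.
    by rewrite (_ : y = 0)//; apply/rowP => i; rewrite (ord1 i) y0 mxE.
  move: phi1; under eq_Rintegral do rewrite pz.
  by rewrite Rintegral_cst// mul0r => /esym/eqP; rewrite oner_eq0.
have [T T0 hT] := integral_dilation_lb ih h0 tphi phi0 I0.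
set k := `|phi y0| * _ / 2 in hT.
have k0 : 0 < k by rewrite /k divr_gt0// mulr_gt0// normr_gt0.
pose b := coord y0.
have bi0 : b^-1 != 0 by rewrite invr_eq0.
have : (\int[leb]_x (k * tailfn T (b^-1 *: x))%:E <=
    \int[leb]_x `|radial_maximal phi (dist_of h) x|)%E.
  apply: le_integral_nonmeasurable => x.
    by rewrite lee_fin mulr_ge0 ?(ltW k0)// tailfn_ge0.
  (* In dimension one [x = u *: y0]; choosing the dilation [t = u] in the maximal function makes
     [phi] be evaluated at [y0 - u^-1 *: y]. *)
  set u := coord x / b.
  have cu : coord (b^-1 *: x) = u by rewrite mxE mulrC.
  have [uT|uT] := leP T u; last first.
    by rewrite tailfn_lt ?cu// mulr0 abse_ge0.
  have u0 : 0 < u by exact: lt_le_trans uT.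
  have xE : x = u *: y0.
    apply/rowP => i; rewrite !mxE (ord1 i) /u divfK//.
  apply: (@le_trans _ _ (`|dist_of h (fun y => u ^- 1 * phi (u^-1 *: (x - y)))|%:E)); last first.
    apply: le_trans (lee_abs _); apply: ereal_sup_ubound.
    by exists u.
  rewrite lee_fin /dist_of expr1.
  rewrite (eq_Rintegral _ (g := fun y => u^-1 * (h y * phi (y0 - u^-1 *: y)))); last first.
    by move=> y _; rewrite mulrCA xE scalerBr scalerA mulVf ?gt_eqF// scale1r.
  have [C C0 hC] := tf_bounded tphi.
  have mh : measurable_fun setT h by case/integrableP: ih => /measurable_EFinP.
  have mphi := continuous_measurable_rV (tf_continuous tphi).
  rewrite RintegralZl//; last first.
    apply: (@le_integrable _ _ _ leb setT measurableT _ (fun y => (C%:E * (h y)%:E)%E)).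
    - apply/measurable_EFinP/measurable_funM => //; apply: (measurableT_comp mphi).
      by apply: measurable_rVB => //; exact: measurable_rVZ.
    - move=> y _; rewrite -EFinM /= lee_fin !normrM (ger0_norm (h0 y)) (ger0_norm C0) mulrC.
      by rewrite ler_wpM2r.
    - exact: integrableZl.
  rewrite normrM gtr0_norm ?invr_gt0//.
  apply: (@le_trans _ _ (u^-1 * k)); last by rewrite ler_wpM2l ?hT// invr_ge0 ltW.
  rewrite mulrC ler_wpM2r ?(ltW k0)// tailfn_ge cu//.
  rewrite ler_pdivrMr; last by rewrite ltr_pwDl ?sqr_ge0// exprn_gt0.
  rewrite [_^-1 * _]mulrC ler_pdivlMr// -expr2 lerDr; exact: sqr_ge0.
move: Moo; rewrite Lnorm1 => Moo /le_lt_trans /(_ Moo).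
under eq_integral do rewrite EFinM.
rewrite ge0_integralZl//; first last.
- by rewrite lee_fin ltW.
- by move=> x _; rewrite lee_fin tailfn_ge0.
- apply/measurable_EFinP/(measurableT_comp (measurable_tailfn T0)).
  exact: measurable_rVZ.
have mT' : measurable_fun setT (fun x => (tailfn T x)%:E).
  by apply/measurable_EFinP; exact: measurable_tailfn.
have t0' x : (0 <= (tailfn T x)%:E)%E by rewrite lee_fin tailfn_ge0.
have -> : (\int[leb]_x (tailfn T (b^-1 *: x))%:E =
    (`|b^-1| ^- 1)%:E * \int[leb]_x (tailfn T x)%:E)%E.
  rewrite -(ge0_integral_affine 0 bi0 mT' t0'); apply: eq_integral => x _.
  by rewrite add0r.
rewrite integral_tailfn// gt0_muley ?lte_fin ?invr_gt0 ?exprn_gt0 ?normr_gt0//.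
by rewrite gt0_muley ?lte_fin.
Qed.

End dimension_one.

End hardy.

Lemma W1N_VMO1 (R : realType) (F phi : 'rV[R]_1 -> R) (f : functional R 1) : W1N f ->
  test_function phi -> \int[lebesgue_rV R 1]_x phi x = 1 ->
  hardy phi 1 (dist_of (norm_gradient f)) ->
  weak_gradient F (fun i x => gradient f x ord0 i) -> VMO F.
Proof.
move=> Wf /test_functionP tphi phi1 Hf Fg; have [lF _ _] := Fg.
have mg := measurable_norm_gradient Wf.
have g0 x : 0 <= norm_gradient f x by exact: enorm_ge0.
have [J J0 JE] : exists2 J, 0 <= J & LN_norm setT (norm_gradient f) = J%:E.
  by apply: LN_norm_fin => //; case: Wf.
have gJ : (\int[lebesgue_rV R 1]_x (norm_gradient f x)%:E = J%:E)%E.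
  have := @LN_norm_integral R 1 setT _ J isT g0 J0 JE; rewrite expr1 => <-.
  by apply: eq_integral => x _; rewrite indicT mul1r.
have ig : (lebesgue_rV R 1).-integrable setT (EFin \o norm_gradient f).
  apply/integrableP; split; first exact/measurable_EFinP.
  by under eq_integral do rewrite /= ger0_norm//; rewrite gJ ltry.
have J00 : J = 0.
  by have := hardy_integral0 ig g0 tphi phi1 Hf; rewrite /Rintegral gJ.
have b0 : (bmo_norm F <= 0)%E.
  by have := bmo_W1N (ltn0Sn 0) Wf Fg; rewrite /W1N_norm JE J00 mule0.
split; first by split => //; exact: le_lt_trans b0 _.
move=> e e0; exists (cst 0).
  split; first exact: cst_continuous.
  by move=> e' e'0; exists 0 => x _; rewrite normr0.
rewrite (_ : (fun x => _) = F); last by apply/funext => x; rewrite subr0.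
by apply: le_lt_trans b0 _; rewrite lte_fin.
Qed.

Theorem theorem5p1 (R : realType) (N : nat) (hN : (1 <= N)%N) :
  (exists C : R, forall f : functional R N, W1N f ->
     exists2 F : 'rV[R]_N -> R, represents f F &
       (bmo_norm F <= C%:E * W1N_norm f)%E) /\
  (forall phi : 'rV[R]_N -> R,
     test_function phi -> \int[lebesgue_rV R N]_x phi x = 1 ->
     forall f : functional R N, W1N f ->
       hardy phi N%:R (dist_of (norm_gradient f)) ->
       exists2 F : 'rV[R]_N -> R, represents f F & VMO F) /\
  (exists C : R, forall f : functional R N, W1N f ->
     exists2 F : 'rV[R]_N -> R, represents f F &
       forall (x0 : 'rV[R]_N) (r : R), 0 < r ->
         ((mean_osc (eball x0 r) F)%:E <=
            C%:E * LN_norm (eball x0 r) (norm_gradient f))%E).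
Proof.
split; [|split].
(* The Jacobian in [poincare_slice] accounts for [2 ^+ N], [power_mean] for another 2, and
   [line_bound_norm_gradient] for [N]. *)
- exists (2 ^+ N.+1 * N%:R) => f Wf; have [F fF Fg] := W1N_function Wf.
  by exists F => //; exact: bmo_W1N.
- move=> phi tphi phi1 f Wf Hf; have [F fF Fg] := W1N_function Wf.
  exists F => //; have [N1|] := ltnP 1 N; first exact: W1N_VMO N1 Wf Fg.
  case: N hN phi tphi phi1 f Wf Hf F fF Fg => [//|[|//]] _ phi tphi phi1 f Wf Hf F _ Fg _.
  exact: W1N_VMO1 Wf tphi phi1 Hf Fg.
(* Compared with cubes there is the extra factor [(2 * N) ^+ N], which bounds the volume of the
   circumscribed cube over that of the ball. *)
- exists (((2 * N%:R) ^- N)^-1 * 2 ^+ N.+1 * N%:R) => f Wf.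
  have [F fF Fg] := W1N_function Wf; exists F => // x0 r r0.
  exact: eball_W1N.
Qed.
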